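(* Let $N\ge3$ and let $\kappa:\wedge^2V_N\to U(\mathfrak{so}_N)$ be an $\mathfrak{so}_N$-equivariant $\mathbb{C}$-linear map. The algebra $H_\kappa(\mathfrak{so}_N,V_N)$ satisfies the PBW property if and only if $\kappa=\sum_{j=0}^k\zeta_j r_{2j+1}$ for some non-negative integer $k$ and parameters $\zeta_0,\ldots,\zeta_k\in\mathbb{C}$.
   Context: The ground field is $\mathbb{C}$. $V_N=\mathbb{C}^N$ with the standard form $(x,y)=x^{T}y$; $\mathfrak{so}_N$ is the Lie algebra of skew-symmetric $N\times N$ matrices acting naturally on $V_N$. For a Lie algebra $\mathfrak g$, a representation $V$ and a $\mathfrak g$-equivariant map $\kappa:\wedge^2V\to U(\mathfrak g)$ (adjoint action on the target), $H_\kappa(\mathfrak g,V):=U(\mathfrak g)\ltimes TV/([x,y]-\kappa(x,y)\mid x,y\in V)$, where in $U(\mathfrak g)\ltimes TV$ one has $[A,x]=A(x)$ for $A\in\mathfrak g$, $x\in V$. It is filtered by $\deg V=1$, $\deg\mathfrak g=0$, and satisfies the PBW property if the natural surjection $U(\mathfrak g)\ltimes SV\to\mathrm{gr}\,H_\kappa(\mathfrak g,V)$ is an isomorphism. For $x,y\in V_N$, the polynomials $\gamma_{2j+1}(x,y)\in\mathbb{C}[\mathfrak{so}_N]$ are defined by $$(x,A(1+\tau^2A^2)^{-1}y)\,\det(1+\tau^2A^2)^{-1/2}=\sum_{j\ge0}\gamma_{2j+1}(x,y)(A)\,\tau^{2j},\qquad A\in\mathfrak{so}_N,$$ where $(1+T)^\alpha=1+\sum_{n\ge1}\frac{\alpha(\alpha-1)\cdots(\alpha-n+1)}{n!}T^n$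 as formal power series. Identify $\mathbb{C}[\mathfrak{so}_N]\simeq S(\mathfrak{so}_N)$ by sending $B\in\mathfrak{so}_N$ to the function $A\mapsto\mathrm{tr}(AB)$ (rescaling this form only rescales each $\gamma_{2j+1}$). Then $r_{2j+1}(x,y)\in U(\mathfrak{so}_N)$ is the image of $\gamma_{2j+1}(x,y)$ under the symmetrization map $S(\mathfrak{so}_N)\to U(\mathfrak{so}_N)$. *)

(* Defs.v *)
From HB Require Import structures.
From mathcomp Require Import all_boot all_order perm all_algebra.
From mathcomp Require Import boolp functions reals complex.
From mathcomp Require Import monalg.
From mathcomp Require Import mpoly.

Set Implicit Arguments.
Unset Strict Implicit.
Unset Printing Implicit Defensive.

Import GRing.Theory Num.Theory.

Local Open Scope ring_scope.
Local Open Scope quotient_scope.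

(* ---------------------------------------------------------------------- *)
(* An associative unital K-algebra is a ring together with a ring morphism
   from K to its centre. MathComp's algType cannot be used here, because it
   requires 1 != 0, which is not known a priori for an algebra presented by
   generators and relations. Scaling by c is multiplication by c%:S.        *)

HB.mixin Record hasScalars (K : comNzRingType) A of GRing.PzRing A := {
  scal : K -> A;
  scal_zmod_subproof : zmod_morphism scal;
  scal_monoid_subproof : monoid_morphism scal;
  scalC : forall c a, scal c * a = a * scal c
}.

#[short(type="pzAlgType")]
HB.structure Definition PzAlgebra (K : comNzRingType) :=
  { A of GRing.PzRing A & hasScalars K A }.

Notation "c %:S" := (scal c) (at level 2, left associativity, format "c %:S")
  : ring_scope.

Section ScalTheory.
Variables (K : comNzRingType) (A : pzAlgType K).
HB.instance Definition _ :=
  GRing.isZmodMorphism.Build K A (@scal K A) scal_zmod_subproof.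
HB.instance Definition _ :=
  GRing.isMonoidMorphism.Build K A (@scal K A) scal_monoid_subproof.
End ScalTheory.

Definition lin_map (K : comNzRingType) (V : lmodType K) (A : pzAlgType K)
    (f : V -> A) : Prop :=
  forall (c : K) (x y : V), f (c *: x + y) = c%:S * f x + f y.

Definition alg_morphism (K : comNzRingType) (A B : pzAlgType K)
    (f : A -> B) : Prop :=
  [/\ zmod_morphism f, monoid_morphism f & forall c : K, f c%:S = c%:S].

(* ---------------------------------------------------------------------- *)
(* Quotient of an algebra by the two-sided ideal generated by a set S.      *)

Section QuotientAlgebra.
Context {K : comNzRingType} {A : pzAlgType K}.
Implicit Types (S : A -> Prop) (a b c : A).

Inductive gen_ideal S : A -> Prop :=
| gen_ideal_gen a : S a -> gen_ideal S a
| gen_ideal0 : gen_ideal S 0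
| gen_idealD a b : gen_ideal S a -> gen_ideal S b -> gen_ideal S (a + b)
| gen_idealMl c a : gen_ideal S a -> gen_ideal S (c * a)
| gen_idealMr c a : gen_ideal S a -> gen_ideal S (a * c).

Definition ideal_pred S : {pred A} := fun a => `[< gen_ideal S a >].

Lemma ideal_predP S a : reflect (gen_ideal S a) (a \in ideal_pred S).
Proof. exact: asboolP. Qed.

Fact ideal_pred_zmod S : zmod_closed (ideal_pred S).
Proof.
split=> [|a b /ideal_predP Sa /ideal_predP Sb]; apply/ideal_predP.
  exact: gen_ideal0.
by rewrite -mulN1r; apply: gen_idealD => //; apply: gen_idealMl.
Qed.

HB.instance Definition _ S :=
  GRing.isZmodClosed.Build A (ideal_pred S) (ideal_pred_zmod S).

Definition quot_alg S : Type := {ideal_quot (ideal_pred S)}.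

Variable S : A -> Prop.
Local Notation Q := (quot_alg S).

HB.instance Definition _ := GRing.Zmodule.on Q.
HB.instance Definition _ : EqQuotient A (Quotient.equiv (ideal_pred S)) Q :=
  EqQuotient.on Q.

Definition quot_pi (a : A) : Q := \pi_Q a.

Lemma quot_piP a b : (quot_pi a = quot_pi b) <-> gen_ideal S (a - b).
Proof.
split=> [/eqP|/ideal_predP]; rewrite /quot_pi.
  by rewrite -Quotient.idealrBE => /ideal_predP.
by rewrite Quotient.idealrBE => /eqP.
Qed.

Lemma quot_pi_surj (u : Q) : exists a, u = quot_pi a.
Proof. by exists (repr u); rewrite /quot_pi reprK. Qed.

Definition quot_one : Q := quot_pi 1.
Definition quot_mul (u v : Q) : Q := quot_pi (repr u * repr v).
Definition quot_scal (c : K) : Q := quot_pi c%:S.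

Fact quot_pi_zmod : zmod_morphism quot_pi.
Proof. by move=> a b; rewrite /quot_pi !piE. Qed.

HB.instance Definition _ :=
  GRing.isZmodMorphism.Build A Q quot_pi quot_pi_zmod.

Fact quot_piM a b : quot_pi (a * b) = quot_mul (quot_pi a) (quot_pi b).
Proof.
apply/quot_piP; set a' := repr _; set b' := repr _.
have Ha : gen_ideal S (a - a') by apply/quot_piP; rewrite /quot_pi reprK.
have Hb : gen_ideal S (b - b') by apply/quot_piP; rewrite /quot_pi reprK.
have -> : a * b - a' * b' = (a - a') * b + a' * (b - b').
  by rewrite mulrBl mulrBr addrA subrK.
by apply: gen_idealD; [apply: gen_idealMr|apply: gen_idealMl].
Qed.

Fact quot_mulA : associative quot_mul.
Proof.
move=> u v w; have [a ->] := quot_pi_surj u; have [b ->] := quot_pi_surj v.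
by have [c ->] := quot_pi_surj w; rewrite -!quot_piM mulrA.
Qed.
Fact quot_mul1 : left_id quot_one quot_mul.
Proof.
by move=> u; have [a ->] := quot_pi_surj u; rewrite -quot_piM mul1r.
Qed.
Fact quot_1mul : right_id quot_one quot_mul.
Proof.
by move=> u; have [a ->] := quot_pi_surj u; rewrite -quot_piM mulr1.
Qed.
Fact quot_mulDl : left_distributive quot_mul +%R.
Proof.
move=> u v w; have [a ->] := quot_pi_surj u; have [b ->] := quot_pi_surj v.
by have [c ->] := quot_pi_surj w; rewrite -raddfD -!quot_piM -raddfD mulrDl.
Qed.
Fact quot_mulDr : right_distributive quot_mul +%R.
Proof.
move=> u v w; have [a ->] := quot_pi_surj u; have [b ->] := quot_pi_surj v.
by have [c ->] := quot_pi_surj w; rewrite -raddfD -!quot_piM -raddfD mulrDr.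
Qed.

HB.instance Definition _ := GRing.Zmodule_isPzRing.Build Q
  quot_mulA quot_mul1 quot_1mul quot_mulDl quot_mulDr.

Fact quot_pi_monoid : monoid_morphism quot_pi.
Proof. by split=> // a b; rewrite quot_piM. Qed.

HB.instance Definition _ :=
  GRing.isMonoidMorphism.Build A Q quot_pi quot_pi_monoid.

Fact quot_scal_zmod : zmod_morphism quot_scal.
Proof. by move=> c d; rewrite /quot_scal !raddfB. Qed.
Fact quot_scal_monoid : monoid_morphism quot_scal.
Proof. by split=> [|c d]; rewrite /quot_scal ?rmorph1 ?rmorphM. Qed.
Fact quot_scalC (c : K) (u : Q) : quot_scal c * u = u * quot_scal c.
Proof.
by have [a ->] := quot_pi_surj u; rewrite /quot_scal -!rmorphM scalC.
Qed.

HB.instance Definition _ := hasScalars.Build K Q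
  quot_scal_zmod quot_scal_monoid quot_scalC.

End QuotientAlgebra.

(* ---------------------------------------------------------------------- *)
(* The free algebra on a set X: the monoid algebra of the free monoid.      *)

Definition free_alg (K : comNzRingType) (X : choiceType) : Type :=
  {malg K[{fmonom X}]}.

Section FreeAlgebra.
Variables (K : comNzRingType) (X : choiceType).

HB.instance Definition _ := GRing.NzRing.on (free_alg K X).

Definition free_scal (c : K) : free_alg K X := @malgC {fmonom X} K c.
Definition free_gen (x : X) : free_alg K X := << fmu x >>.

Fact free_scal_zmod : zmod_morphism free_scal.
Proof. exact: raddfB. Qed.
Fact free_scal_monoid : monoid_morphism free_scal.
Proof. by split=> [|c d]; [exact: rmorph1|exact: rmorphM]. Qed.
Fact free_scalC c (a : free_alg K X) : free_scal c * a = a * free_scal c.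
Proof.
rewrite /free_scal /GRing.mul /= fgmulUg fgmulgU; apply: eq_bigr => k _.
by rewrite mul1m mulm1 mulrC.
Qed.

HB.instance Definition _ := hasScalars.Build K (free_alg K X)
  free_scal_zmod free_scal_monoid free_scalC.

End FreeAlgebra.

(* ---------------------------------------------------------------------- *)
(* Filtered algebras and their associated graded algebras.                  *)

Section Filtration.
Context {K : comNzRingType} (A : pzAlgType K).

Record filtration := Filtration {
  fil :> nat -> A -> Prop;
  fil_lin n (c : K) a b : fil n a -> fil n b -> fil n (c%:S * a + b);
  fil_one : fil 0 1;
  fil_mul m n a b : fil m a -> fil n b -> fil (m + n) (a * b);
  fil_incr n a : fil n a -> fil n.+1 a
}.

(* The smallest filtration in which every element a with S n a has degree
   at most n.                                                               *)
Inductive gen_fil (S : nat -> A -> Prop) : nat -> A -> Prop :=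
| gen_fil_gen n a : S n a -> gen_fil S n a
| gen_fil_lin n c a b :
    gen_fil S n a -> gen_fil S n b -> gen_fil S n (c%:S * a + b)
| gen_fil_one : gen_fil S 0 1
| gen_fil_mul m n a b :
    gen_fil S m a -> gen_fil S n b -> gen_fil S (m + n) (a * b)
| gen_fil_incr n a : gen_fil S n a -> gen_fil S n.+1 a.

Definition generated_filtration (S : nat -> A -> Prop) : filtration :=
  Filtration (@gen_fil_lin S) (@gen_fil_one S) (@gen_fil_mul S)
    (@gen_fil_incr S).

Variable F : filtration.

Lemma fil0 n : F n 0.
Proof.
elim: n => [|n]; last exact: fil_incr.
have := fil_lin (-1) (fil_one F) (fil_one F).
by rewrite rmorphN1 mulN1r addNr.
Qed.

Lemma filD n a b : F n a -> F n b -> F n (a + b).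
Proof. by move=> Fa /(fil_lin 1 Fa); rewrite rmorph1 mul1r. Qed.

Lemma filB n a b : F n a -> F n b -> F n (a - b).
Proof. by move=> Fa /(fil_lin (-1))/(_ Fa); rewrite rmorphN1 mulN1r addrC. Qed.

Lemma fil_scal n (c : K) a : F n a -> F n (c%:S * a).
Proof. by move=> /(fil_lin c)/(_ (fil0 n)); rewrite addr0. Qed.

Lemma fil_leq m n a : (m <= n)%N -> F m a -> F n a.
Proof.
by move=> /subnK <-; elim: (n - m)%N => // k IH /IH /fil_incr.
Qed.

Lemma fil_sum n (I : Type) (r : seq I) (P : pred I) (f : I -> A) :
  (forall i, P i -> F n (f i)) -> F n (\sum_(i <- r | P i) f i).
Proof.
by move=> Ff; elim/big_rec: _ => [|i a Pi]; [exact: fil0|apply/filD/Ff].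
Qed.

(* The Rees algebra, i.e. the direct sum of the F n over n, with elements
   (a_n)_n written as functions of n.                                       *)
Definition rees_pred : {pred nat -> A} := fun f =>
  `[< (forall n, F n (f n)) /\
      (exists d : nat, forall n, (d < n)%N -> f n = 0) >].

Lemma rees_predP (f : nat -> A) :
  reflect ((forall n, F n (f n)) /\
           (exists d : nat, forall n, (d < n)%N -> f n = 0))
    (f \in rees_pred).
Proof. exact: asboolP. Qed.

Fact rees_pred_zmod : zmod_closed rees_pred.
Proof.
split=> [|f g /rees_predP[Ff [d f0]] /rees_predP[Fg [e g0]]].
  by apply/rees_predP; split=> [n|]; [exact: fil0|exists 0%N].
apply/rees_predP; split=> [n|]; first exact: filB.
exists (maxn d e) => n; rewrite gtn_max => /andP[dn en].
by change (f n - g n = 0); rewrite f0 // g0 // subrr.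
Qed.

HB.instance Definition _ :=
  GRing.isZmodClosed.Build (nat -> A) rees_pred rees_pred_zmod.

Record rees := Rees { rees_fun :> nat -> A; _ : rees_fun \in rees_pred }.

HB.instance Definition _ := [isSub for rees_fun].
HB.instance Definition _ := [Choice of rees by <:].
HB.instance Definition _ := [SubChoice_isSubZmodule of rees by <:].

Lemma rees_fil (f : rees) n : F n (f n).
Proof. by case: f => f /= /rees_predP[]. Qed.

Lemma rees_eqP (f g : rees) : (forall n, f n = g n) <-> f = g.
Proof. by split=> [fg|->//]; apply/val_inj/funext => n; exact: fg. Qed.

Lemma reesD (f g : rees) n : (f + g) n = f n + g n.
Proof. by []. Qed.

Lemma reesB (f g : rees) n : (f - g) n = f n - g n.
Proof. by []. Qed.

Definition cauchy (f g : nat -> A) (n : nat) : A :=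
  \sum_(i < n.+1) f i * g (n - i)%N.

Lemma cauchyE (f g : nat -> A) n m : (n <= m)%N ->
  cauchy f g n = \sum_(i < m.+1) \sum_(j < m.+1 | (i + j == n)%N) f i * g j.
Proof.
move=> nm; rewrite /cauchy.
rewrite (big_ord_widen m.+1 (fun i => f i * g (n - i)%N)) //.
rewrite big_mkcond; apply: eq_bigr => i _; case: ifP => [|ni].
  rewrite ltnS => le_in.
  have lt_ni : (n - i < m.+1)%N by rewrite ltnS (leq_trans (leq_subr _ _)).
  rewrite (big_pred1 (Ordinal lt_ni)) // => j.
  by rewrite /= -val_eqE /= -[RHS](eqn_add2l i) subnKC.
rewrite big_pred0 // => j; apply/negP => /eqP ijn.
by move: ni; rewrite -ijn ltnS leq_addr.
Qed.

Fact cauchy_rees (f g : rees) : cauchy f g \in rees_pred.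
Proof.
apply/rees_predP; split=> [n|].
  apply: fil_sum => i _; have /subnKC {1}<- : (i <= n)%N by rewrite -ltnS.
  exact: fil_mul (rees_fil _ _) (rees_fil _ _).
case: f g => f /= /rees_predP[_ [d f0]] [g /= /rees_predP[_ [e g0]]].
exists (d + e)%N => n den; apply: big1 => i _.
have [di|id] := ltnP d i; first by rewrite f0 ?mul0r.
by rewrite g0 ?mulr0 // ltn_subRL (leq_ltn_trans _ den) // leq_add2r.
Qed.

Definition rees_mul (f g : rees) : rees := Rees (cauchy_rees f g).

(* The element of the Rees algebra concentrated in degree n. *)
Definition homog_seq n (a : A) : nat -> A := fun m => if m == n then a else 0.

Fact homog_rees n a : F n a -> homog_seq n a \in rees_pred.
Proof.
move=> Fa; apply/rees_predP; rewrite /homog_seq; split=> [m|].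
  by case: eqP => [->//|_]; exact: fil0.
by exists n => m; case: ltngtP.
Qed.

Definition rees_homog n a (Fa : F n a) : rees := Rees (homog_rees Fa).

Definition rees_one : rees := rees_homog (fil_one F).

Lemma fil_scal1 (c : K) : F 0 c%:S.
Proof. by rewrite -[c%:S]mulr1; apply/fil_scal/fil_one. Qed.

Definition rees_scal (c : K) : rees := rees_homog (fil_scal1 c).

Fact rees_mulA : associative rees_mul.
Proof.
move=> f g h; apply/rees_eqP => n /=.
rewrite !(@cauchyE _ _ n n) //.
transitivity (\sum_(i < n.+1) \sum_(j < n.+1) \sum_(k < n.+1 | (i + j + k == n)%N)
   f i * g j * h k).
  apply: eq_bigr => i _.
  transitivity (\sum_(l < n.+1 | (i + l == n)%N) \sum_(j < n.+1)
     \sum_(k < n.+1 | (j + k == l)%N) f i * g j * h k).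
    apply: eq_bigr => l _; rewrite (@cauchyE _ _ l n) -1?ltnS //.
    rewrite mulr_sumr; apply: eq_bigr => j _.
    by rewrite mulr_sumr; apply: eq_bigr => k _; rewrite mulrA.
  rewrite exchange_big /=; apply: eq_bigr => j _.
  rewrite (exchange_big_dep predT) //= [RHS]big_mkcond; apply: eq_bigr => k _.
  case: eqP => [ijk|nijk].
    have lt_jk : (j + k < n.+1)%N.
      by rewrite ltnS; move: (leq_addl i (j + k)); rewrite addnA ijk.
    rewrite (big_pred1 (Ordinal lt_jk)) // => l.
    rewrite /= -val_eqE /=; apply/idP/eqP => [/andP[_ /eqP->]//|->].
    by rewrite addnA ijk !eqxx.
  rewrite big_pred0 // => l; apply/negP => /andP[/eqP il /eqP jk].
  by apply: nijk; rewrite -addnA jk.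
symmetry.
transitivity (\sum_(k < n.+1) \sum_(l < n.+1 | (l + k == n)%N) \sum_(i < n.+1)
   \sum_(j < n.+1 | (i + j == l)%N) f i * g j * h k).
  rewrite (exchange_big_dep predT) //=; apply: eq_bigr => k _.
  apply: eq_bigr => l _; rewrite (@cauchyE _ _ l n) -1?ltnS //.
  rewrite mulr_suml; apply: eq_bigr => i _.
  by rewrite mulr_suml.
transitivity (\sum_(k < n.+1) \sum_(i < n.+1) \sum_(j < n.+1 |
    (i + j + k == n)%N) f i * g j * h k); last first.
  rewrite exchange_big /=; apply: eq_bigr => i _.
  by rewrite (exchange_big_dep predT).
apply: eq_bigr => k _.
rewrite exchange_big /=; apply: eq_bigr => i _.
rewrite (exchange_big_dep predT) //= [RHS]big_mkcond; apply: eq_bigr => j _.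
case: eqP => [ijk|nijk].
  have lt_ij : (i + j < n.+1)%N.
    by rewrite ltnS; move: (leq_addr k (i + j)); rewrite ijk.
  rewrite (big_pred1 (Ordinal lt_ij)) // => l.
  rewrite /= -val_eqE /=; apply/idP/eqP => [/andP[_ /eqP->]//|->].
  by rewrite ijk !eqxx.
rewrite big_pred0 // => l; apply/negP => /andP[/eqP lk /eqP ij].
by apply: nijk; rewrite ij.
Qed.

Lemma cauchy_homog0l a (g : nat -> A) n : cauchy (homog_seq 0 a) g n = a * g n.
Proof.
rewrite /cauchy big_ord_recl /= subn0 big1 ?addr0 // => i _.
by rewrite mul0r.
Qed.

Lemma cauchy_homog0r a (g : nat -> A) n : cauchy g (homog_seq 0 a) n = g n * a.
Proof.
rewrite /cauchy big_ord_recr /= subnn big1 ?add0r // => i _.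
by rewrite /homog_seq subn_eq0 leqNgt ltn_ord mulr0.
Qed.

Fact rees_mul1 : left_id rees_one rees_mul.
Proof. by move=> f; apply/rees_eqP => n /=; rewrite cauchy_homog0l mul1r. Qed.
Fact rees_1mul : right_id rees_one rees_mul.
Proof. by move=> f; apply/rees_eqP => n /=; rewrite cauchy_homog0r mulr1. Qed.
Fact rees_mulDl : left_distributive rees_mul +%R.
Proof.
move=> f g h; apply/rees_eqP => n; rewrite reesD /= /cauchy -big_split /=.
by apply: eq_bigr => i _; rewrite -mulrDl.
Qed.
Fact rees_mulDr : right_distributive rees_mul +%R.
Proof.
move=> f g h; apply/rees_eqP => n; rewrite reesD /= /cauchy -big_split /=.
by apply: eq_bigr => i _; rewrite -mulrDr.
Qed.

HB.instance Definition _ := GRing.Zmodule_isPzRing.Build rees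
  rees_mulA rees_mul1 rees_1mul rees_mulDl rees_mulDr.

Fact rees_scal_zmod : zmod_morphism rees_scal.
Proof.
move=> c d; apply/rees_eqP => n; rewrite reesB /= /homog_seq.
by case: eqP => _; rewrite ?subr0 ?rmorphB.
Qed.
Fact rees_scal_monoid : monoid_morphism rees_scal.
Proof.
split=> [|c d]; apply/rees_eqP => n /=; first by rewrite /homog_seq rmorph1.
rewrite cauchy_homog0l /homog_seq.
by case: eqP => _; rewrite ?mulr0 ?rmorphM.
Qed.
Fact rees_scalC c (f : rees) : rees_scal c * f = f * rees_scal c.
Proof.
by apply/rees_eqP => n /=; rewrite cauchy_homog0l cauchy_homog0r scalC.
Qed.

HB.instance Definition _ := hasScalars.Build K rees
  rees_scal_zmod rees_scal_monoid rees_scalC.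

(* gr A is the quotient of the direct sum of the F_n by the direct sum of
   the F_{n-1}, where F_{-1} = 0. The latter is already a two-sided ideal.  *)
Definition gr_rel (f : rees) : Prop := f 0%N = 0 /\ forall n, F n (f n.+1).

Lemma gr_rel_ideal f : gen_ideal gr_rel f <-> gr_rel f.
Proof.
split=> [|Sf]; last exact: gen_ideal_gen.
elim=> [//||{}f g _ [f0 Ff] _ [g0 Fg]|c {}f _ [f0 Ff]|c {}f _ [f0 Ff]].
- by split=> // n; exact: fil0.
- by split=> [|n]; rewrite reesD ?f0 ?g0 ?addr0 //; exact: filD.
- split=> [|n] /=; first by rewrite /cauchy big_ord1 f0 mulr0.
  rewrite /cauchy big_ord_recr /= subnn f0 mulr0 addr0.
  apply: fil_sum => i _; have le_in : (i <= n)%N by rewrite -ltnS.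
  rewrite subSn //; have /subnKC {1}<- := le_in.
  exact: fil_mul (rees_fil _ _) (Ff _).
- split=> [|n] /=; first by rewrite /cauchy big_ord1 f0 mul0r.
  rewrite /cauchy big_ord_recl /= f0 mul0r add0r.
  apply: fil_sum => i _; rewrite /bump /= add1n subSS.
  have le_in : (i <= n)%N by rewrite -ltnS.
  have /subnKC {1}<- := le_in.
  exact: fil_mul (Ff _) (rees_fil _ _).
Qed.

Definition gr : Type := quot_alg gr_rel.
HB.instance Definition _ := PzAlgebra.on gr.

Definition gr_class n a (Fa : F n a) : gr := quot_pi gr_rel (rees_homog Fa).

End Filtration.

(* ---------------------------------------------------------------------- *)
(* Algebras attached to a Lie algebra g with bracket br and a representation
   act of g on V.                                                           *)

Section LieAlgebra.
Context {K : comNzRingType} {g V : lmodType K}.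
Variables (br : g -> g -> g) (act : g -> V -> V).

(* The universal enveloping algebra U(g). *)
Inductive uea_rel : free_alg K g -> Prop :=
| uea_rel_lin (c : K) (a b : g) :
    uea_rel (free_gen K (c *: a + b) - (c%:S * free_gen K a + free_gen K b))
| uea_rel_br (a b : g) :
    uea_rel (free_gen K a * free_gen K b - free_gen K b * free_gen K a
             - free_gen K (br a b)).

Definition uea : Type := quot_alg uea_rel.
HB.instance Definition _ := PzAlgebra.on uea.
Definition uea_in (a : g) : uea := quot_pi uea_rel (free_gen K a).

(* The semidirect product U(g) |x TV: the algebra generated by the algebra
   U(g) and the vector space V subject to [A, x] = A(x) for A in g, x in V. *)
Local Notation genU u := (free_gen K (inl u : (uea + V)%type)).
Local Notation genV x := (free_gen K (inr x : (uea + V)%type)).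

Inductive sdT_rel : free_alg K (uea + V)%type -> Prop :=
| sdT_rel_scalU (c : K) : sdT_rel (genU c%:S - c%:S)
| sdT_rel_addU (u v : uea) : sdT_rel (genU (u + v) - (genU u + genU v))
| sdT_rel_mulU (u v : uea) : sdT_rel (genU (u * v) - genU u * genU v)
| sdT_rel_linV (c : K) (x y : V) :
    sdT_rel (genV (c *: x + y) - (c%:S * genV x + genV y))
| sdT_rel_act (a : g) (x : V) :
    sdT_rel (genU (uea_in a) * genV x - genV x * genU (uea_in a)
             - genV (act a x)).

Definition sdT : Type := quot_alg sdT_rel.
HB.instance Definition _ := PzAlgebra.on sdT.
Definition sdT_U (u : uea) : sdT := quot_pi sdT_rel (genU u).
Definition sdT_V (x : V) : sdT := quot_pi sdT_rel (genV x).

(* The semidirect product U(g) |x SV. *)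
Inductive sdS_rel : sdT -> Prop :=
| sdS_rel_comm (x y : V) : sdS_rel (sdT_V x * sdT_V y - sdT_V y * sdT_V x).

Definition sdS : Type := quot_alg sdS_rel.
HB.instance Definition _ := PzAlgebra.on sdS.
Definition sdS_U (u : uea) : sdS := quot_pi sdS_rel (sdT_U u).
Definition sdS_V (x : V) : sdS := quot_pi sdS_rel (sdT_V x).

(* A linear map from the second exterior power of V to U(g), given as an
   alternating bilinear map on V.                                           *)
Definition alternating (kappa : V -> V -> uea) : Prop :=
  [/\ forall x, lin_map (kappa x),
      forall y, lin_map (fun x => kappa x y)
    & forall x, kappa x x = 0].

Definition equivariant (kappa : V -> V -> uea) : Prop :=
  forall (a : g) (x y : V),
    kappa (act a x) y + kappa x (act a y)
    = uea_in a * kappa x y - kappa x y * uea_in a.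

Section Hkappa.
Variable kappa : V -> V -> uea.

Inductive Hk_rel : sdT -> Prop :=
| Hk_rel_comm (x y : V) :
    Hk_rel (sdT_V x * sdT_V y - sdT_V y * sdT_V x - sdT_U (kappa x y)).

Definition Hk : Type := quot_alg Hk_rel.
HB.instance Definition _ := PzAlgebra.on Hk.
Definition Hk_U (u : uea) : Hk := quot_pi Hk_rel (sdT_U u).
Definition Hk_V (x : V) : Hk := quot_pi Hk_rel (sdT_V x).

Inductive Hk_deg : nat -> Hk -> Prop :=
| Hk_deg_U (u : uea) : Hk_deg 0 (Hk_U u)
| Hk_deg_V (x : V) : Hk_deg 1 (Hk_V x).

Definition Hk_fil : filtration Hk := generated_filtration Hk_deg.

Lemma Hk_fil_U u : Hk_fil 0 (Hk_U u).
Proof. exact/gen_fil_gen/Hk_deg_U. Qed.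

Lemma Hk_fil_V x : Hk_fil 1 (Hk_V x).
Proof. exact/gen_fil_gen/Hk_deg_V. Qed.

(* The natural map U(g) |x SV -> gr H_kappa is the algebra morphism sending
   u in U(g) to its class in degree 0 and x in V to its class in degree 1;
   it is unique because U(g) and V generate U(g) |x SV.                     *)
Definition natural_map (f : sdS -> gr Hk_fil) : Prop :=
  [/\ alg_morphism f,
      forall u, f (sdS_U u) = gr_class (Hk_fil_U u)
    & forall x, f (sdS_V x) = gr_class (Hk_fil_V x)].

Definition PBW : Prop :=
  exists f : sdS -> gr Hk_fil, natural_map f /\ bijective f.

End Hkappa.
End LieAlgebra.

(* ---------------------------------------------------------------------- *)
(* The Lie algebra so_N of skew-symmetric matrices, acting on V_N = K^N.    *)

Section Orthogonal.
Variables (K : fieldType) (N : nat).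

Definition skew_pred : {pred 'M[K]_N} := fun A => A^T == - A.

Fact skew_pred_submod : submod_closed skew_pred.
Proof.
split=> [|c A B /eqP sA /eqP sB]; apply/eqP; first by rewrite trmx0 oppr0.
by rewrite linearD linearZ /= sA sB opprD scalerN.
Qed.

HB.instance Definition _ :=
  GRing.isSubmodClosed.Build K 'M[K]_N skew_pred skew_pred_submod.

Record so := So { so_mx :> 'M[K]_N; _ : so_mx \in skew_pred }.

HB.instance Definition _ := [isSub for so_mx].
HB.instance Definition _ := [Choice of so by <:].
HB.instance Definition _ := [SubChoice_isSubZmodule of so by <:].
HB.instance Definition _ := [SubZmodule_isSubLmodule of so by <:].

Lemma so_tr (A : so) : (so_mx A)^T = - so_mx A.
Proof. by case: A => A /= /eqP. Qed.

Fact so_br_skew (A B : so) : A *m B - B *m A \in skew_pred.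
Proof.
apply/eqP; rewrite linearB /= !trmx_mul !so_tr !mulNmx !mulmxN !opprK.
by rewrite opprB.
Qed.

Definition so_br (A B : so) : so := So (so_br_skew A B).

Definition so_act (A : so) (x : 'cV[K]_N) : 'cV[K]_N := A *m x.

(* The index set of the coordinates A i j, i < j, on so_N. *)
Definition so_coord : Type := {ij : 'I_N * 'I_N | (ij.1 < ij.2)%N}.
HB.instance Definition _ := Finite.on so_coord.

(* K[so_N], as the polynomial ring in these coordinates. *)
Local Notation so_dim := #|{: so_coord}|.
Local Notation so_poly := {mpoly K[so_dim]}.

Definition coord_fun (i j : 'I_N) : so_poly :=
  if insub (i, j) is Some p then 'X_(enum_rank (p : so_coord)) else 0.

(* The generic element of so_N: entry (i, j) is the function A |-> A i j. *)
Definition generic_mx : 'M[so_poly]_N :=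
  \matrix_(i, j) (coord_fun i j - coord_fun j i).

(* The identification of K[so_N] with S(so_N): under the trace form, the
   coordinate function A |-> A i j is represented by (E_ji - E_ij) / 2.     *)
Fact so_dual_skew (i j : 'I_N) :
  2^-1 *: (delta_mx j i - delta_mx i j) \in skew_pred.
Proof.
by apply/eqP; rewrite linearZ linearB /= !trmx_delta -scalerN opprB.
Qed.

Definition so_dual (i j : 'I_N) : so := So (so_dual_skew i j).

Lemma so_dualE (A : so) i j :
  2 != 0 :> K -> \tr (so_mx A *m so_mx (so_dual i j)) = A i j.
Proof.
move=> nz2; have tr_delta k l : \tr (so_mx A *m delta_mx k l) = A l k.
  rewrite /mxtrace (bigD1 l) //= big1 => [|m ml].
    rewrite addr0 mxE (bigD1 k) //= big1 => [|m mk].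
      by rewrite !mxE !eqxx mulr1 addr0.
    by rewrite !mxE (negPf mk) mulr0.
  by rewrite mxE big1 // => q _; rewrite !mxE (negPf ml) andbF mulr0.
rewrite /= -scalemxAr mulmxBr linearZ linearB /= !tr_delta.
have -> : A j i = - A i j by have /matrixP/(_ i j) := so_tr A; rewrite !mxE.
by rewrite opprK -mulr2n -[X in _ * X]mulr_natl mulKf.
Qed.

(* Symmetrization S(so_N) -> U(so_N), on monomials and then by linearity:
   a product b_1 ... b_d goes to the average of its d! reorderings.         *)
Local Notation U := (uea so_br).

Definition coord_elt (k : 'I_so_dim) : U :=
  let p := val (enum_val k) in uea_in so_br (so_dual p.1 p.2).

Definition mon_word (m : 'X_{1..so_dim}) : seq 'I_so_dim :=
  flatten [seq nseq (m k) k | k <- enum 'I_so_dim].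

Definition sym_mon (m : 'X_{1..so_dim}) : U :=
  let w := in_tuple (mon_word m) in
  (((size w)`!)%:R^-1 : K)%:S
  * \sum_(s : 'S_(size w)) \prod_(k < size w) coord_elt (tnth w (s k)).

Definition symmetrization (p : so_poly) : U :=
  \sum_(m <- msupp p) (p@_m)%:S * sym_mon m.

Definition gen_binom (alpha : K) (n : nat) : K :=
  (\prod_(i < n) (alpha - i%:R)) / (n`!)%:R.

Local Notation P := {poly so_poly}.
Local Notation tau := ('X : P).
Definition const_poly (c : K) : P := ((c%:MP : so_poly)%:P).

Local Notation Agen := (map_mx polyC generic_mx : 'M[P]_N).
Local Notation T := (tau ^+ 2 *: (Agen *m Agen) : 'M[P]_N).

(* Both series are cut after m + 1 terms. As T and \det (1 + T) - 1 are
   divisible by tau ^+ 2, this does not affect coefficients of tau ^+ k for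
   k <= 2 * m + 1.                                                          *)
Definition resolvent_series (m : nat) : 'M[P]_N :=
  \sum_(n < m.+1) const_poly (gen_binom (-1) n) *: (T ^+ n).

Definition det_series (m : nat) : P :=
  \sum_(n < m.+1) const_poly (gen_binom (- 2^-1) n) * (\det (1%:M + T) - 1) ^+ n.

(* gamma j is gamma_(2j+1), and so_r j is r_(2j+1); (x, y) is x^T *m y. *)
Definition gamma (j : nat) (x y : 'cV[K]_N) : so_poly :=
  (((map_mx const_poly x)^T *m (Agen *m resolvent_series j) *m map_mx const_poly y) 0 0
   * det_series j)`_(2 * j).

Definition so_r (j : nat) (x y : 'cV[K]_N) : U := symmetrization (gamma j x y).

End Orthogonal.

(* Main.v *)
(* Write kappa = sym(k) for an alternating map k from V x V to C[so_N].

   H_kappa has the PBW property iff the Jacobi identity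
   [kappa(x,y),z] + [kappa(y,z),x] + [kappa(z,x),y] = 0 holds in U(so_N) |x TV.
   For the if part U |x TV acts on functions from words in a basis
   of V to U; for every word w there is such a function which is compatible
   with sorting letters (the diamond lemma for adjacent transpositions) and
   reads off the coefficient of w, so no relation is lost in gr H_kappa.

   By symmetrization the Jacobi identity becomes the linear system
   D_{z^w} k(x,y) + D_{x^w} k(y,z) + D_{y^w} k(z,x) = 0, where D_{z^w} is the
   derivative in the direction z^w = z w^T - w z^T of so_N. It splits into
   homogeneous components. A solution k of degree n is determined by the
   numbers q(u,v), the value of k(u,v) at u^v. By equivariance q satisfies
   2 g q' = (n+1) g' q along every line v + t c, where g is the Gram
   determinant of u and v + t c. Hence k is determined by the single number
   q(e_1,e_2), and a parity argument with e_1, e_2, e_3 shows that k = 0 when n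
   is even.

   For n = 2j+1 the polynomial gamma_(2j+1) is a solution: if A is the generic
   matrix, R = (1 + tau^2 A^2)^(-1), E = A R and B is a constant direction, then
   D_B E = R B R - tau^2 E B E and
   D_B det^(-1/2) = - tau^2 tr(E B) det^(-1/2), from which the system follows.
   It is not zero, because q(e_1,e_2) = j + 1. *)
Require Import Defs.
From HB Require Import structures.
From mathcomp Require Import all_boot all_order perm all_algebra.
From mathcomp Require Import reals complex.
From mathcomp Require Import boolp functions finmap monalg mpoly.
From mathcomp Require Import zify ring.

Set Implicit Arguments.
Unset Strict Implicit.
Unset Printing Implicit Defensive.

Import GRing.Theory Num.Theory.

Local Open Scope ring_scope.

(** * Algebras presented by generators and relations *)

(** No basis of [U] enters, and the PBW theorem for so_N is not invoked. A function from words to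
    [U] is read as a right [U]-linear functional on T = U |x TV, and t in T acts on it by
    precomposition with left multiplication by t. The value at the empty word then recovers
    coefficients in [U], so T is free over [U] on words. The same freeness makes symmetrization
    injective: for i != j the coefficient of e_i in sym(p) e_j is the symmetrization of a first
    derivative of p plus terms of lower degree, and induction on the degree applies.

    The equation 2 g q' = (n+1) g' q says that q is locally a constant times g^((n+1)/2). For even n
    one also has q(u,-v) = -q(u,v), and a third basis vector gives room to move v to -v with g
    nonzero, which forces q = 0; this is where N >= 3 enters.

    The exponent -1/2 of the determinant is dictated by the Jacobi identity: its derivative
    contributes 2 tau^2 E(x,y) E(z,w), exactly what balances the products coming from - tau^2 E B E
    in the cyclic sum. *)

Section ScalLemmas.
Context {K : comNzRingType} {A : pzAlgType K}.
Local Notation sc := (@scal K A).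
Lemma scalD c d : sc (c + d) = sc c + sc d. Proof. exact: raddfD. Qed.
Lemma scalB c d : sc (c - d) = sc c - sc d. Proof. exact: raddfB. Qed.
Lemma scalM c d : sc (c * d) = sc c * sc d. Proof. exact: rmorphM. Qed.
Lemma scalN c : sc (- c) = - sc c. Proof. exact: raddfN. Qed.
Lemma scal0 : sc 0 = 0. Proof. exact: raddf0. Qed.
Lemma scal1 : sc 1 = 1. Proof. exact: rmorph1. Qed.
Lemma scal_sum J (r : seq J) (P : pred J) (h : J -> K) :
  sc (\sum_(i <- r | P i) h i) = \sum_(i <- r | P i) sc (h i).
Proof. exact: raddf_sum. Qed.
Lemma scal_nat n : sc n%:R = n%:R. Proof. exact: rmorph_nat. Qed.
End ScalLemmas.

Section AlgMorphism.
Context {K : comNzRingType} {A B : pzAlgType K} {f : A -> B}.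
Hypothesis fm : alg_morphism f.

Lemma alg_morB a b : f (a - b) = f a - f b.
Proof. by case: fm => h _ _; exact: h. Qed.
Lemma alg_mor0 : f 0 = 0.
Proof. by rewrite -(subrr 0) alg_morB subrr. Qed.
Lemma alg_morN a : f (- a) = - f a.
Proof. by rewrite -sub0r alg_morB alg_mor0 sub0r. Qed.
Lemma alg_morD a b : f (a + b) = f a + f b.
Proof. by rewrite -{1}(opprK b) alg_morB alg_morN opprK. Qed.
Lemma alg_morM a b : f (a * b) = f a * f b.
Proof. by case: fm => _ [_ h] _; exact: h. Qed.
Lemma alg_mor1 : f 1 = 1.
Proof. by case: fm => _ [h _] _. Qed.
Lemma alg_morS c : f c%:S = c%:S.
Proof. by case: fm => _ _ h; exact: h. Qed.
Lemma alg_mor_sum I (r : seq I) (P : pred I) F :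
  f (\sum_(i <- r | P i) F i) = \sum_(i <- r | P i) f (F i).
Proof. by apply: (big_morph f) => [a b|]; [exact: alg_morD|exact: alg_mor0]. Qed.
Lemma alg_mor_lin a c b d : f (a - (c%:S * b + d)) = f a - (c%:S * f b + f d).
Proof. by rewrite alg_morB alg_morD alg_morM alg_morS. Qed.
Lemma alg_mor_comm a b c : f (a * b - b * a - c) = f a * f b - f b * f a - f c.
Proof. by rewrite !alg_morB !alg_morM. Qed.
End AlgMorphism.

Lemma quot_pi_morph (K : comNzRingType) (A : pzAlgType K) (S : A -> Prop) :
  alg_morphism (quot_pi S).
Proof.
by split; [exact: (raddfB (quot_pi S))|split; [|exact: (rmorphM (quot_pi S))]|].
Qed.

Lemma alg_morphism_comp (K : comNzRingType) (A B C : pzAlgType K)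
    (g : B -> C) (f : A -> B) :
  alg_morphism g -> alg_morphism f -> alg_morphism (g \o f).
Proof.
move=> gm fm; split=> [a b|/=|c] /=.
- by rewrite (alg_morB fm) (alg_morB gm).
- split=> [|a b] /=; first by rewrite (alg_mor1 fm) (alg_mor1 gm).
  by rewrite (alg_morM fm) (alg_morM gm).
- by rewrite (alg_morS fm) (alg_morS gm).
Qed.

Section QuotUniversal.
Context {K : comNzRingType} {A B : pzAlgType K} (S : A -> Prop) (f : A -> B).
Hypotheses (fm : alg_morphism f) (f0 : forall a, S a -> f a = 0).

Lemma quot_universal :
  exists g : quot_alg S -> B, alg_morphism g /\ forall a, g (quot_pi S a) = f a.
Proof.
have id0 a : gen_ideal S a -> f a = 0.
  elim=> {a} [a /f0//||a b _ fa _ fb|c a _ fa|c a _ fa].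
  - exact: alg_mor0.
  - by rewrite (alg_morD fm) fa fb addr0.
  - by rewrite (alg_morM fm) fa mulr0.
  - by rewrite (alg_morM fm) fa mul0r.
pose g (u : quot_alg S) := f (generic_quotient.repr u).
have gE a : g (quot_pi S a) = f a.
  apply/eqP; rewrite -subr_eq0 -(alg_morB fm); apply/eqP/id0.
  by apply/quot_piP; rewrite /quot_pi generic_quotient.reprK.
exists g; split=> //; split=> [u v||c].
- have [a ->] := quot_pi_surj u; have [b ->] := quot_pi_surj v.
  by rewrite -raddfB !gE (alg_morB fm).
- split=> [|u v]; first by rewrite -[1]/(quot_pi S 1) gE (alg_mor1 fm).
  have [a ->] := quot_pi_surj u; have [b ->] := quot_pi_surj v.
  by rewrite -rmorphM !gE (alg_morM fm).
- by rewrite -[c%:S]/(quot_pi S c%:S) gE (alg_morS fm).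
Qed.
End QuotUniversal.

Section FreeUniversal.
Context {K : comNzRingType} {X : choiceType}.
Local Open Scope fset_scope.
Local Open Scope ring_scope.

Lemma free_monE (m : {fmonom X}) :
  << m >> = \prod_(x <- (m : seq X)) free_gen K x :> free_alg K X.
Proof.
have E (s : seq X) : << FMonom s >> = \prod_(x <- s) free_gen K x :> free_alg K X.
  elim: s => [|x s IH].
    by rewrite big_nil -fmoneE.
  rewrite big_cons -IH /free_gen /GRing.mul /= fgmulUU mulr1.
  congr << _ >>; apply/eqP; rewrite fmP /= /mmul /=.
  by rewrite fmmulE /= fmuE.
by rewrite -[m in LHS]fmK E.
Qed.

Lemma free_algE (a : free_alg K X) :
  a = \sum_(m <- monalg.msupp a)
        (monalg.mcoeff m a)%:S * \prod_(x <- (m : seq X)) free_gen K x.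
Proof.
rewrite {1}[a]monalgE; apply: eq_bigr => m _; rewrite -free_monE.
by rewrite /GRing.mul /= /scal /= /free_scal fgmulUU mulr1 mul1m.
Qed.

Lemma free_alg_ind (P : free_alg K X -> Prop) :
  (forall c, P c%:S) -> (forall x, P (free_gen K x)) ->
  (forall a b, P a -> P b -> P (a + b)) ->
  (forall a b, P a -> P b -> P (a * b)) -> forall a, P a.
Proof.
move=> Pc Px PD PM a; rewrite [a]free_algE.
apply: (big_ind P) => [||m _]; [by move: (Pc 0); rewrite rmorph0|exact: PD|].
apply: (PM _ _ (Pc _)); elim: (fmonom_val m) => [|x s IH].
  by rewrite big_nil; move: (Pc 1); rewrite rmorph1.
by rewrite big_cons; exact: PM.
Qed.

Lemma free_universal (B : pzAlgType K) (h : X -> B) :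
  exists f : free_alg K X -> B,
    alg_morphism f /\ forall x, f (free_gen K x) = h x.
Proof.
pose F (m : {fmonom X}) : B := \prod_(x <- (m : seq X)) h x.
pose f (a : free_alg K X) : B :=
  \sum_(m <- monalg.msupp a) (monalg.mcoeff m a)%:S * F m.
have fw (d : {fset {fmonom X}}) (a : free_alg K X) : monalg.msupp a `<=` d ->
    f a = \sum_(k <- d) (monalg.mcoeff k a)%:S * F k.
  move=> le; rewrite [LHS](big_fset_incl _ le) => //= x xd /mcoeff_outdom ->.
  by rewrite raddf0 mul0r.
have fB : zmod_morphism f.
  move=> a b; pose d := monalg.msupp a `|` monalg.msupp b `|` monalg.msupp (a - b).
  have da : monalg.msupp a `<=` d by rewrite /d -fsetUA fsubsetUl.
  have db : monalg.msupp b `<=` d by rewrite /d fsetUAC fsubsetUr.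
  rewrite (fw d (a - b)) ?fsubsetUr // (fw d a) // (fw d b) //.
  rewrite -sumrB; apply: eq_bigr => m _.
  by rewrite -mulrBl -raddfB -raddfB.
have fU c m : f << c *g m >> = c%:S * F m.
  by rewrite (fw _ _ msuppU_le) big_seq_fset1 mcoeffUU.
pose fA := GRing.isZmodMorphism.Build _ _ f fB.
pose f' : {additive free_alg K X -> B} := HB.pack f fA.
have FM m1 m2 : F (mmul m1 m2) = F m1 * F m2.
  by rewrite /F fmM big_cat.
exists f; split; last first.
  by move=> x; rewrite /free_gen fU rmorph1 mul1r /F fmU big_seq1.
have fS c : f c%:S = c%:S.
  by rewrite -[c%:S]/(free_scal X c) /free_scal fU /F fm1 big_nil mulr1.
split=> //; split=> [|a b].
  by rewrite -(rmorph1 (@scal K (free_alg K X))) fS rmorph1.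
have fE u : f u = \sum_(m <- monalg.msupp u) (monalg.mcoeff m u)%:S * F m by [].
rewrite -[f (a * b)]/(f' (a * b)) malgME raddf_sum (fE a) mulr_suml.
apply: eq_bigr => m _; rewrite raddf_sum (fE b) mulr_sumr.
apply: eq_bigr => n _.
rewrite /= fU rmorphM FM -!mulrA; congr (_ * _); rewrite !mulrA.
by congr (_ * _); rewrite scalC.
Qed.
End FreeUniversal.

Lemma quot_free_ind (K : comNzRingType) (X : choiceType)
    (S : free_alg K X -> Prop) (P : quot_alg S -> Prop) :
  (forall c, P c%:S) -> (forall x, P (quot_pi S (free_gen K x))) ->
  (forall a b, P a -> P b -> P (a + b)) ->
  (forall a b, P a -> P b -> P (a * b)) -> forall a, P a.
Proof.
move=> Pc Px PD PM u; have [a ->] := quot_pi_surj u.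
apply: (@free_alg_ind K X (fun a => P (quot_pi S a))) => [c||b c|b c] //.
- exact: Pc.
- by rewrite raddfD; exact: PD.
- by rewrite rmorphM; exact: PM.
Qed.

(* Operators act on the right, so that composition is read from left to right. *)
Section OperatorAlgebra.
Variables (K : comNzRingType) (A : pzAlgType K) (T : Type).
Local Notation F := (T -> A).

Definition scalf (c : K) (f : F) : F := fun t => c%:S * f t.

Definition oper_pred : {pred F -> F} := fun e =>
  `[< (forall f g, e (f + g) = e f + e g) /\
      (forall c f, e (scalf c f) = scalf c (e f)) >].

Lemma oper_predP (e : F -> F) :
  reflect ((forall f g, e (f + g) = e f + e g) /\
      (forall c f, e (scalf c f) = scalf c (e f))) (e \in oper_pred).
Proof. exact: asboolP. Qed.

Fact oper_pred_zmod : zmod_closed oper_pred.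
Proof.
split=> [|e e' /oper_predP[eD eZ] /oper_predP[e'D e'Z]]; apply/oper_predP; split.
- by move=> f g; change (0 = 0 + 0 :> F); rewrite addr0.
- by move=> c f; apply/funext => t; rewrite /scalf /= mulr0.
- move=> f g; change (e (f + g) - e' (f + g) = (e f - e' f) + (e g - e' g)).
  by rewrite eD e'D opprD addrACA.
- move=> c f; change (e (scalf c f) - e' (scalf c f) = scalf c (e f - e' f)).
  by rewrite eZ e'Z; apply/funext => t; rewrite /scalf mulrBr.
Qed.

HB.instance Definition _ :=
  GRing.isZmodClosed.Build (F -> F) oper_pred oper_pred_zmod.

Record oper := Oper { oper_fun :> F -> F; _ : oper_fun \in oper_pred }.

HB.instance Definition _ := [isSub for oper_fun].
HB.instance Definition _ := [Choice of oper by <:].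
HB.instance Definition _ := [SubChoice_isSubZmodule of oper by <:].

Implicit Types (e : oper) (f g : F).

Lemma operD e f g : e (f + g) = e f + e g.
Proof. by case: e => e /= /oper_predP[]. Qed.
Lemma operZ e c f : e (scalf c f) = scalf c (e f).
Proof. by case: e => e /= /oper_predP[]. Qed.
Lemma oper0 e : e 0 = 0.
Proof. by apply: (addrI (e 0)); rewrite -operD !addr0. Qed.
Lemma operN e f : e (- f) = - e f.
Proof. by apply: (addrI (e f)); rewrite -operD !subrr oper0. Qed.
Lemma operB e f g : e (f - g) = e f - e g.
Proof. by rewrite operD operN. Qed.
Lemma oper_sum e I (r : seq I) (P : pred I) (h : I -> F) :
  e (\sum_(i <- r | P i) h i) = \sum_(i <- r | P i) e (h i).
Proof. by apply: (big_morph e) => [a b|]; [exact: operD|exact: oper0]. Qed.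

Lemma oper_eqP e e' : (forall f, e f = e' f) <-> e = e'.
Proof. by split=> [h|->//]; apply/val_inj/funext => f; exact: h. Qed.

Lemma oper_addE e e' f : (e + e') f = e f + e' f. Proof. by []. Qed.
Lemma oper_subE e e' f : (e - e') f = e f - e' f. Proof. by []. Qed.

Fact oper_one_subproof : id \in oper_pred.
Proof. exact/oper_predP. Qed.
Definition oper_one : oper := Oper oper_one_subproof.

Fact oper_mul_subproof e e' : e' \o e \in oper_pred.
Proof. by apply/oper_predP; split=> *; rewrite /= ?operD ?operZ. Qed.
Definition oper_mul e e' : oper := Oper (oper_mul_subproof e e').

Fact oper_scal_subproof c : scalf c \in oper_pred.
Proof.
apply/oper_predP; split=> [f g|d f]; apply/funext => t; rewrite /scalf.
  by rewrite /= mulrDr.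
by rewrite !mulrA scalC.
Qed.
Definition oper_scal c : oper := Oper (oper_scal_subproof c).

Fact oper_mulA : associative oper_mul.
Proof. by move=> e1 e2 e3; apply/oper_eqP. Qed.
Fact oper_mul1 : left_id oper_one oper_mul.
Proof. by move=> e; apply/oper_eqP. Qed.
Fact oper_1mul : right_id oper_one oper_mul.
Proof. by move=> e; apply/oper_eqP. Qed.
Fact oper_mulDl : left_distributive oper_mul +%R.
Proof. by move=> e1 e2 e3; apply/oper_eqP => f; rewrite /= operD. Qed.
Fact oper_mulDr : right_distributive oper_mul +%R.
Proof. by move=> e1 e2 e3; apply/oper_eqP. Qed.

HB.instance Definition _ := GRing.Zmodule_isPzRing.Build oper
  oper_mulA oper_mul1 oper_1mul oper_mulDl oper_mulDr.

Lemma oper_mulE e e' f : (e * e') f = e' (e f). Proof. by []. Qed.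

Fact oper_scal_zmod : zmod_morphism oper_scal.
Proof.
move=> c d; apply/oper_eqP => f; apply/funext => t.
by rewrite /= /scalf raddfB mulrBl.
Qed.
Fact oper_scal_monoid : monoid_morphism oper_scal.
Proof.
split=> [|c d]; apply/oper_eqP => f; apply/funext => t.
  by rewrite /= /scalf rmorph1 mul1r.
by rewrite /= /scalf [c * d]mulrC rmorphM mulrA.
Qed.
Fact oper_scalC c e : oper_scal c * e = e * oper_scal c.
Proof. by apply/oper_eqP => f; rewrite !oper_mulE /= operZ. Qed.

HB.instance Definition _ := hasScalars.Build K oper
  oper_scal_zmod oper_scal_monoid oper_scalC.

Lemma oper_scalE c f t : (c%:S : oper) f t = c%:S * f t. Proof. by []. Qed.
End OperatorAlgebra.

Lemma uea_in_linear (K : comNzRingType) (g : lmodType K) (br : g -> g -> g)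
    (c : K) (a b : g) :
  uea_in br (c *: a + b) = c%:S * uea_in br a + uea_in br b.
Proof.
rewrite /uea_in -[c%:S]/(quot_pi _ c%:S) -rmorphM -raddfD; apply/quot_piP.
exact/gen_ideal_gen/uea_rel_lin.
Qed.

Lemma uea_in_br (K : comNzRingType) (g : lmodType K) (br : g -> g -> g)
    (a b : g) :
  uea_in br a * uea_in br b - uea_in br b * uea_in br a = uea_in br (br a b).
Proof.
rewrite /uea_in -!rmorphM -raddfB; apply/quot_piP.
exact/gen_ideal_gen/uea_rel_br.
Qed.

Lemma uea_universal (K : comNzRingType) (g : lmodType K) (br : g -> g -> g)
    (B : pzAlgType K) (h : g -> B) :
    (forall c a b, h (c *: a + b) = c%:S * h a + h b) ->
    (forall a b, h a * h b - h b * h a = h (br a b)) ->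
  exists f : uea br -> B, alg_morphism f /\ forall a, f (uea_in br a) = h a.
Proof.
move=> hlin hbr; have [f [fm fE]] := free_universal h.
have [|f' [f'm f'E]] := quot_universal (S := uea_rel br) fm.
  move=> _ [c a b|a b].
    by rewrite (alg_mor_lin fm) !fE hlin subrr.
  by rewrite (alg_mor_comm fm) !fE hbr subrr.
by exists f'; split=> // a; rewrite /uea_in f'E fE.
Qed.

(** * Functions on words as a module over U and V *)

Section Representation.
Context {K : comNzRingType} {g : lmodType K} {N : nat}.
Local Notation V := 'cV[K]_N.
Local Notation I := 'I_N.
Context {br : g -> g -> g} {act : g -> V -> V}.
Context {U : pzAlgType K} {uin : g -> U}.
Hypothesis uin_lin : forall c a b, uin (c *: a + b) = c%:S * uin a + uin b.
Hypothesis uin_br : forall a b, uin a * uin b - uin b * uin a = uin (br a b).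
Hypothesis act_linl : forall c a b x, act (c *: a + b) x = c *: act a x + act b x.
Hypothesis act_linr : forall a c x y, act a (c *: x + y) = c *: act a x + act a y.
Hypothesis act_br : forall a b x,
  act (br a b) x = act a (act b x) - act b (act a x).

Local Notation F := (seq I -> U).
Local Notation E := (oper U (seq I)).

Definition bas (j : I) : V := delta_mx j 0.
Definition act_mx (a : g) (i j : I) : K := act a (bas j) i 0.

Lemma basE (x : V) : x = \sum_i x i 0 *: bas i.
Proof.
apply/colP => k; rewrite summxE (bigD1 k) //= big1 => [|i ik].
  by rewrite !mxE !eqxx mulr1 addr0.
by rewrite !mxE eq_sym (negPf ik) mulr0.
Qed.

Let act0 a : act a 0 = 0.
Proof.
by have := act_linr a (-1) 0 0; rewrite scaler0 add0r scaleN1r addNr.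
Qed.

Lemma act_sum a (J : Type) (r : seq J) (c : J -> K) (x : J -> V) :
  act a (\sum_(i <- r) c i *: x i) = \sum_(i <- r) c i *: act a (x i).
Proof.
elim: r => [|i r IH]; first by rewrite !big_nil act0.
by rewrite !big_cons act_linr IH.
Qed.

Lemma act_mxE a x i : act a x i 0 = \sum_j act_mx a i j * x j 0.
Proof.
rewrite {1}[x]basE act_sum summxE; apply: eq_bigr => j _.
by rewrite !mxE mulrC.
Qed.

(** With [f] read as a right [U]-linear functional on the semidirect product, this is its value at
    the product [a w]: [a] is commuted to the right past each letter, and what arrives at the end
    leaves the functional as a right factor. Precomposition reverses products, which is why
    operators compose from left to right. *)
Fixpoint act_word (a : g) (w : seq I) (f : F) : U :=
  if w is j :: w' then
    act_word a w' (fun v => f (j :: v)) + \sum_i (act_mx a i j)%:S * f (i :: w')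
  else f [::] * uin a.

Definition opaf (a : g) (f : F) : F := fun w => act_word a w f.

Lemma opaf_cons a f j w :
  opaf a f (j :: w) = opaf a (fun v => f (j :: v)) w
                      + \sum_i (act_mx a i j)%:S * f (i :: w).
Proof. by []. Qed.

Fact opaf_oper a : opaf a \in @oper_pred K U (seq I).
Proof.
apply/oper_predP; split=> [f h|c f]; apply/funext => w.
  change (opaf a (f + h) w = opaf a f w + opaf a h w).
  elim: w f h => [|j w IH] f h; first by rewrite /opaf /= mulrDl.
  rewrite !opaf_cons -[fun v => (f + h) _]/((fun v => f (j :: v)) + (fun v => h (j :: v))).
  rewrite IH addrACA -big_split; congr (_ + _); apply: eq_bigr => i _.
  exact: mulrDr.
rewrite /scalf; elim: w f => [|j w IH] f; first by rewrite /opaf /= mulrA.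
rewrite !opaf_cons IH mulrDr mulr_sumr; congr (_ + _); apply: eq_bigr => i _.
by rewrite !mulrA scalC.
Qed.
Definition opa a : E := Oper (opaf_oper a).

Lemma opa_cons a f j w :
  opa a f (j :: w) = opa a (fun v => f (j :: v)) w
                      + \sum_i (act_mx a i j)%:S * f (i :: w).
Proof. by []. Qed.

Lemma act_mx_lin c a b i j : act_mx (c *: a + b) i j = c * act_mx a i j + act_mx b i j.
Proof. by rewrite /act_mx act_linl !mxE. Qed.

Lemma act_mx_br a b i j : act_mx (br a b) i j =
  \sum_k (act_mx a i k * act_mx b k j - act_mx b i k * act_mx a k j).
Proof.
rewrite /act_mx act_br !mxE sumrB; congr (_ - _); rewrite act_mxE //.
Qed.

Lemma opa_lin c a b : opa (c *: a + b) = c%:S * opa a + opa b.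
Proof.
apply/oper_eqP => f; rewrite oper_addE oper_mulE.
change (opa (c *: a + b) f = opa a (scalf c f) + opa b f); rewrite operZ.
apply/funext => w; change (opa (c *: a + b) f w = c%:S * opa a f w + opa b f w).
elim: w f => [|j w IH] f.
  rewrite /opa /opaf /= uin_lin mulrDr; congr (_ + _).
  by rewrite !mulrA scalC.
rewrite !opa_cons IH mulrDr -!addrA; congr (_ + _); rewrite addrCA; congr (_ + _).
rewrite mulr_sumr -big_split; apply: eq_bigr => i _ /=.
by rewrite act_mx_lin scalD scalM mulrDl mulrA.
Qed.

Lemma opa_br a b : opa a * opa b - opa b * opa a = opa (br a b).
Proof.
apply/oper_eqP => f; rewrite oper_subE !oper_mulE; apply/funext => w.
change (opa b (opa a f) w - opa a (opa b f) w = opa (br a b) f w).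
elim: w f => [|j w IH] f.
  by rewrite /= /opaf /= -uin_br mulrBr !mulrA.
have sh c h k : (fun v => opa c h (k :: v)) = opa c (fun v => h (k :: v))
     + \sum_i scalf (act_mx c i k) (fun v => h (i :: v)).
  apply/funext => v; rewrite opa_cons.
  rewrite fctE /=; congr (_ + _); rewrite fct_sumE //.
(* Besides the double matrix action there are two mixed sums. They are exchanged when the two
   elements are, so they cancel in the commutator by [sub3]. *)
have ex a' b' : opa b' (opa a' f) (j :: w) =
   opa b' (opa a' (fun v => f (j :: v))) w
   + (\sum_i (act_mx a' i j)%:S * opa b' (fun v => f (i :: v)) w
   + \sum_i (act_mx b' i j)%:S * opa a' (fun v => f (i :: v)) w)
   + \sum_i \sum_k (act_mx b' k j * act_mx a' i k)%:S * f (i :: w).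
  rewrite opa_cons sh operD oper_sum fctE fct_sumE -!addrA; congr (_ + _).
  congr (_ + _).
    by apply: eq_bigr => i _; rewrite operZ.
  rewrite [X in _ = _ + X]exchange_big -big_split /=; apply: eq_bigr => i _.
  rewrite mulrDr mulr_sumr; congr (_ + _); apply: eq_bigr => k _.
  by rewrite mulrA scalM.
have sub3 (x y y' z t v : U) :
    x + (y + y') + z - (t + (y' + y) + v) = x - t + (z - v).
  rewrite (addrC y' y); set s := y + y'.
  by rewrite (addrAC x) (addrAC t) opprD addrACA subrr addr0 opprD addrACA.
rewrite !ex sub3 opa_cons -IH.
congr (_ + _); rewrite -sumrB; apply: eq_bigr => i _.
rewrite -sumrB act_mx_br scal_sum mulr_suml; apply: eq_bigr => k _.
by rewrite scalB mulrBl; congr (_%:S * _ - _%:S * _); rewrite mulrC.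
Qed.

Fact opx_oper (x : V) :
  (fun (f : F) (w : seq I) => \sum_i (x i 0)%:S * f (i :: w)) \in @oper_pred K U (seq I).
Proof.
apply/oper_predP; split=> [f h|c f]; apply/funext => w.
  change (\sum_i (x i 0)%:S * (f (i :: w) + h (i :: w)) =
     \sum_i (x i 0)%:S * f (i :: w) + \sum_i (x i 0)%:S * h (i :: w)).
  by rewrite -big_split; apply: eq_bigr => i _ /=; rewrite mulrDr.
rewrite /scalf mulr_sumr; apply: eq_bigr => i _.
by rewrite !mulrA scalC.
Qed.
Definition opx x : E := Oper (opx_oper x).

Lemma opxE x f w : opx x f w = \sum_i (x i 0)%:S * f (i :: w).
Proof. by []. Qed.

Lemma opx_lin c x y : opx (c *: x + y) = c%:S * opx x + opx y.
Proof.
apply/oper_eqP => f; apply/funext => w.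
change (opx (c *: x + y) f w = opx x (scalf c f) w + opx y f w).
rewrite operZ /scalf !opxE mulr_sumr -big_split; apply: eq_bigr => i _ /=.
by rewrite !mxE scalD scalM mulrDl mulrA.
Qed.

Lemma opx_bas i f w : opx (bas i) f w = f (i :: w).
Proof.
rewrite opxE (bigD1 i) //= big1 => [|k ki].
  by rewrite mxE !eqxx scal1 mul1r addr0.
by rewrite mxE (negPf ki) scal0 mul0r.
Qed.

Lemma opa_opx a x : opa a * opx x - opx x * opa a = opx (act a x).
Proof.
apply/oper_eqP => f; apply/funext => w.
change (opx x (opa a f) w - opa a (opx x f) w = opx (act a x) f w).
have -> : opx x f = \sum_i scalf (x i 0) (fun v => f (i :: v)).
  by apply/funext => v; rewrite fct_sumE opxE.
rewrite oper_sum fct_sumE !opxE -sumrB.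
transitivity (\sum_i \sum_k (x i 0)%:S * ((act_mx a k i)%:S * f (k :: w))).
  apply: eq_bigr => i _; rewrite operZ /scalf opa_cons mulrDr addrC addKr.
  by rewrite mulr_sumr.
rewrite exchange_big; apply: eq_bigr => k _ /=.
rewrite act_mxE scal_sum mulr_suml; apply: eq_bigr => i _.
by rewrite mulrA -scalM mulrC.
Qed.

End Representation.

(** * Confluence of sorting words *)

(** These are the critical pairs of the rewriting of adjacent letters: the same place, an overlap in
    one letter, or two disjoint places. *)
Lemma adjacent_splits (T : Type) (p p' r r' : seq T) (a b a' b' : T) :
    (size p <= size p')%N -> p ++ a :: b :: r = p' ++ a' :: b' :: r' ->
  [\/ [/\ p = p', a = a', b = b' & r = r'],
      [/\ p' = rcons p a, a' = b & r = b' :: r'] |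
      exists q, p' = p ++ a :: b :: q /\ r = q ++ a' :: b' :: r'].
Proof.
elim: p p' => [|x p IH] [|y p'] //=.
- by move=> _ [-> -> ->]; constructor 1.
- case: p' => [|z q] /= _ [-> -> ->]; first by constructor 2.
  by constructor 3; exists q.
- rewrite ltnS => /IH {}IH [<- /IH[[-> -> -> ->]|[-> -> ->]|[q [-> ->]]]].
  + by constructor 1.
  + by constructor 2.
  + by constructor 3; exists q.
Qed.

(* Rewriting descents [.. a b ..] with [b < a] into [.. b a ..] is confluent,
   by the diamond lemma; the two hypotheses on the cost d of a step say that
   the disjoint and the overlapping critical pairs have the same total cost. *)
Section SortingPotential.
Variables (N n : nat) (M : zmodType).
Local Notation I := 'I_N.
Variable d : seq I -> I -> I -> seq I -> M.
Hypothesis d_square : forall p q r (a b a' b' : I), (b < a)%N -> (b' < a')%N ->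
  size (p ++ a :: b :: q ++ a' :: b' :: r) = n ->
  d p a b (q ++ a' :: b' :: r) + d (p ++ b :: a :: q) a' b' r
  = d (p ++ a :: b :: q) a' b' r + d p a b (q ++ b' :: a' :: r).
Hypothesis d_hexagon : forall p r (a b e : I), (b < a)%N -> (e < b)%N ->
  size (p ++ a :: b :: e :: r) = n ->
  d p a b (e :: r) + (d (rcons p b) a e r + d p b e (a :: r))
  = d (rcons p a) b e r + (d p a e (b :: r) + d (rcons p e) a b r).

(** A termination measure: a letter is weighted by its position counted from the end, so moving the
    larger letter of a descent to the right lowers the sum. *)
Fixpoint word_weight (w : seq I) : nat :=
  if w is a :: w' then ((size w').+1 * a + word_weight w')%N else 0%N.

Lemma word_weight_swap p r (a b : I) : (b < a)%N ->
  (word_weight (p ++ b :: a :: r) < word_weight (p ++ a :: b :: r))%N.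
Proof.
move=> ba; elim: p => [|x p IH] /=; last by rewrite !size_cat /= ltn_add2l.
lia.
Qed.

Lemma word_weight_bound w : (word_weight w <= size w * size w * N)%N.
Proof.
elim: w => //= a w IH; have aN := ltn_ord a.
have : (size w * a <= size w * N)%N by rewrite leq_mul2l ltnW ?orbT.
lia.
Qed.

Definition potential_upto k (c : seq I -> M) :=
  forall p r (a b : I), (b < a)%N -> size (p ++ a :: b :: r) = n ->
    (word_weight (p ++ a :: b :: r) <= k)%N ->
    c (p ++ a :: b :: r) = c (p ++ b :: a :: r) + d p a b r.

(** After either first swap the weight is at most [k], so [c] may be expanded further until both
    sides reach the same word: two more swaps for overlapping descents, one for disjoint ones. The
    costs then agree by [d_hexagon] or [d_square]. *)
Lemma potential_confluent k c p p' r r' (a b a' b' : I) :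
    potential_upto k c -> (b < a)%N -> (b' < a')%N ->
    size (p ++ a :: b :: r) = n -> (word_weight (p ++ a :: b :: r) <= k.+1)%N ->
    p ++ a :: b :: r = p' ++ a' :: b' :: r' -> (size p <= size p')%N ->
  c (p ++ b :: a :: r) + d p a b r = c (p' ++ b' :: a' :: r') + d p' a' b' r'.
Proof.
move=> cP ba ba' sw kw ew le_pp'.
case: (adjacent_splits le_pp' ew) => [[<- <- <- <-] //||] {ew le_pp'}.
  move=> [Ep Ea Er]; subst p' a' r; rename b' into e.
  have cw := word_weight_swap p (e :: r') ba.
  have cw' := word_weight_swap (rcons p a) r' ba'.
  rewrite !cat_rcons in cw'.
  have lt1 := leq_trans cw kw; have lt2 := leq_trans cw' kw.
  have ea := ltn_trans ba' ba.
  have c1 := cP (rcons p b) r' a e ea; rewrite !cat_rcons in c1.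
  have w1 := word_weight_swap (rcons p b) r' ea; rewrite !cat_rcons in w1.
  have c2 := cP p (a :: r') b e ba'.
  have c3 := cP p (b :: r') a e ea.
  have w3 := word_weight_swap p (b :: r') ea.
  have c4 := cP (rcons p e) r' a b ba; rewrite !cat_rcons in c4.
  have sz x y z : size (p ++ x :: y :: z :: r') = n by rewrite -sw !size_cat.
  rewrite !cat_rcons c1 ?sz // c2 ?sz //; last exact: ltnW (leq_trans w1 _).
  rewrite c3 ?sz // c4 ?sz //; last exact: ltnW (leq_trans w3 _).
  have rev3 (x y z : M) : x + (y + z) = z + (y + x).
    by rewrite addrC (addrC y) -addrA.
  rewrite -!addrA; congr (_ + _); rewrite rev3 [RHS]rev3.
  by rewrite (d_hexagon ba ba') // sz.
case=> q [Ep Er]; subst p' r.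
have cw := word_weight_swap p (q ++ a' :: b' :: r') ba.
have cw' := word_weight_swap (p ++ a :: b :: q) r' ba'.
rewrite -!catA /= in cw' kw sw *.
have lt1 := leq_trans cw kw; have lt2 := leq_trans cw' kw.
have c1 := cP (p ++ b :: a :: q) r' _ _ ba'; rewrite -!catA /= in c1.
have c2 := cP p (q ++ b' :: a' :: r') _ _ ba.
have sz x y z t : size (p ++ x :: y :: q ++ z :: t :: r') = n.
  by rewrite -sw !size_cat /= !size_cat.
rewrite c1 ?sz // c2 ?sz // -!addrA; congr (_ + _).
by rewrite addrC d_square ?sz // addrC.
Qed.

Lemma potential_upto_ex k : exists c, potential_upto k c.
Proof.
elim: k => [|k [c cP]].
  exists (fun=> 0) => p r a b ba _; rewrite leqn0 => /eqP w0.
  by have := word_weight_swap p r ba; rewrite w0.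
(* Above weight [k] the value is defined through an arbitrarily chosen descent, and
   [potential_confluent] makes the choice immaterial at weight [k.+1]. Words without a descent get
   0. *)
pose split w (z : seq I * I * I * seq I) :=
  let: (p, a, b, r) := z in w = p ++ a :: b :: r /\ (b < a)%N.
pose c' w := if (word_weight w <= k)%N then c w else
  if pselect (exists z, split w z) is left h then
    let: (p, a, b, r) := sval (cid h) in c (p ++ b :: a :: r) + d p a b r
  else 0.
exists c' => p r a b ba sw kw.
have c'E : c' (p ++ b :: a :: r) = c (p ++ b :: a :: r).
  by rewrite /c' -ltnS (leq_trans (word_weight_swap p r ba) kw).
rewrite c'E /c'; case: ifP => [kw'|_]; first exact: cP.
case: pselect => [h|[]]; last by exists (p, a, b, r).
case: cid => -[[[p' a'] b'] r'] /= [ew ba'].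
have [le_pp'|/ltnW le_pp'] := leqP (size p) (size p').
  by rewrite (potential_confluent cP ba ba' sw kw ew le_pp').
have Esym := esym ew.
by rewrite (potential_confluent cP ba' ba _ _ Esym le_pp') -?ew.
Qed.

Lemma sorting_potential : exists c : seq I -> M,
  forall p r (a b : I), (b < a)%N -> size (p ++ a :: b :: r) = n ->
    c (p ++ a :: b :: r) = c (p ++ b :: a :: r) + d p a b r.
Proof.
have [c cP] := potential_upto_ex (n * n * N).
exists c => p r a b ba sw; apply: cP => //.
by rewrite -{1 2}sw word_weight_bound.
Qed.
End SortingPotential.

(** * Functionals compatible with sorting *)

Section NormalForm.
Context {K : comNzRingType} {g : lmodType K} {N : nat}.
Local Notation V := 'cV[K]_N.
Local Notation I := 'I_N.
Context {act : g -> V -> V}.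
Context {U : pzAlgType K} {uin : g -> U}.
Local Notation F := (seq I -> U).
Local Notation E := (oper U (seq I)).
Local Notation opa := (@opa K g N act U uin).
Local Notation opx := (@opx K N U).
Local Notation amx := (@act_mx K g N act).
Context {opU : U -> E}.
Hypothesis opU_morph : alg_morphism opU.
Hypothesis opU_in : forall a, opU (uin a) = opa a.
Hypothesis U_ind : forall P : U -> Prop,
  (forall c, P c%:S) -> (forall x, P (uin x)) ->
  (forall a b, P a -> P b -> P (a + b)) ->
  (forall a b, P a -> P b -> P (a * b)) -> forall a, P a.
Variable kap : I -> I -> U.
Hypothesis kap_alt : forall a, kap a a = 0.
Hypothesis kap_anti : forall a b, kap a b = - kap b a.
Hypothesis kap_equiv : forall c a b,
  \sum_i (amx c i a)%:S * kap i b + \sum_i (amx c i b)%:S * kap a i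
  = uin c * kap a b - kap a b * uin c.
Hypothesis kap_jacobi : forall a b e,
  opU (kap a b) * opx (@bas K N e) - opx (@bas K N e) * opU (kap a b)
  + (opU (kap b e) * opx (@bas K N a) - opx (@bas K N a) * opU (kap b e))
  + (opU (kap e a) * opx (@bas K N b) - opx (@bas K N b) * opU (kap e a)) = 0.

Definition shift_word (p : seq I) (f : F) : F := fun v => f (p ++ v).

Definition agree k (f f' : F) := forall w, size w = k -> f w = f' w.

(** The Lie algebra has degree 0: it never changes the length of a word. *)
Lemma opa_local a k f f' : agree k f f' -> agree k (opa a f) (opa a f').
Proof.
move=> ff' w; elim: w k f f' ff' => [|j w IH] k f f' ff' sw.
  by rewrite /= /opaf /= ff'.
rewrite !opa_cons (IH (size w) _ (fun v => f' (j :: v))) //.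
  by congr (_ + _); apply: eq_bigr => i _; rewrite ff'.
by move=> v sv; rewrite ff' //= sv.
Qed.

Lemma opU_local u k f f' : agree k f f' -> agree k (opU u f) (opU u f').
Proof.
move: u k f f'; apply: U_ind => [c|x|u v Hu Hv|u v Hu Hv] k f f' ff' w sw.
- by rewrite (alg_morS opU_morph) !oper_scalE ff'.
- by rewrite opU_in; exact: opa_local ff' _ _.
- rewrite (alg_morD opU_morph).
  by change (opU u f w + opU v f w = opU u f' w + opU v f' w); rewrite (Hu k f f') // (Hv k f f').
- by rewrite (alg_morM opU_morph) !oper_mulE; exact: (Hv k) (Hu k _ _ ff') _ sw.
Qed.

(** The functional [f] kills the relation between the letters [a] and [b] at any place of a word of
    length at most [n]; the right-hand side is its value at [p (kap a b) r]. *)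
Definition sorts_upto n (f : F) := forall p a b r, (size (p ++ a :: b :: r) <= n)%N ->
  f (p ++ a :: b :: r) - f (p ++ b :: a :: r) = opU (kap a b) (shift_word p f) r.

Lemma sorts_uptoD n f f' : sorts_upto n f -> sorts_upto n f' -> sorts_upto n (f + f').
Proof.
move=> Hf Hf' p a b r s.
change (f (p ++ a :: b :: r) + f' (p ++ a :: b :: r)
  - (f (p ++ b :: a :: r) + f' (p ++ b :: a :: r)) =
  opU (kap a b) (shift_word p f + shift_word p f') r).
by rewrite operD opprD addrACA Hf // Hf'.
Qed.

Lemma sorts_uptoZ n c f : sorts_upto n f -> sorts_upto n (scalf c f).
Proof.
move=> Hf p a b r s; rewrite /scalf -mulrBr Hf //.
by rewrite -[RHS]/(opU (kap a b) (scalf c (shift_word p f)) r) operZ.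
Qed.

Lemma sorts_upto_shift n m p f : (size p + m <= n)%N ->
  sorts_upto n f -> sorts_upto m (shift_word p f).
Proof.
move=> pmn Hf q a b r s; rewrite /shift_word !catA Hf.
  by congr (opU _ _ _); apply/funext => v; rewrite /shift_word catA.
by rewrite -catA size_cat (leq_trans _ pmn) // leq_add2l.
Qed.

(** The relations between letters form a space stable under the Lie algebra, which acts on the pair
    [a b] by the Leibniz rule and on [kap a b] by the commutator; [kap_equiv] says that the two
    actions match. The induction is on the prefix before the pair. *)
Lemma sorts_upto_opa n c f : sorts_upto n f -> sorts_upto n (opa c f).
Proof.
move=> Hf p; elim: p n f Hf => [|j p IH] n f Hf a b r s.
  have ex x y : opa c f (x :: y :: r) = opa c (shift_word [:: x; y] f) r
    + \sum_i (amx c i y)%:S * f (x :: i :: r)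
    + \sum_i (amx c i x)%:S * f (i :: y :: r) by rewrite !opa_cons.
  have fswap x y : f (x :: y :: r) - f (y :: x :: r) = opU (kap x y) f r.
    exact: (Hf [::]).
  transitivity (opa c (shift_word [:: a; b] f - shift_word [:: b; a] f) r
    + (\sum_i (amx c i a)%:S * opU (kap i b) f r
       + \sum_i (amx c i b)%:S * opU (kap a i) f r)).
    rewrite operB !ex.
    have arr (x y z x' y' z' : U) : x + y + z - (x' + y' + z') =
       x - x' + (z - y' + (y - z')).
      by rewrite -(addrA x) -(addrA x') opprD addrACA (addrC y) opprD [X in _ + X = _]addrACA.
    rewrite arr; congr (_ + (_ + _)).
      by rewrite -sumrB; apply: eq_bigr => i _; rewrite -fswap mulrBr.
    by rewrite -sumrB; apply: eq_bigr => i _; rewrite -fswap mulrBr.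
  rewrite (@opa_local c (size r) _ (opU (kap a b) f)) //; last first.
    move=> v sv; change (f (a :: b :: v) - f (b :: a :: v) = opU (kap a b) f v).
    by apply: (Hf [::]); rewrite /= sv.
  have -> : \sum_i (amx c i a)%:S * opU (kap i b) f r
       + \sum_i (amx c i b)%:S * opU (kap a i) f r =
     opU (uin c * kap a b - kap a b * uin c) f r.
    rewrite -kap_equiv (alg_morD opU_morph) !(alg_mor_sum opU_morph).
    have ev (G : I -> E) : (\sum_i G i) f r = \sum_i G i f r.
      have evD (e e' : E) : (e + e') f r = e f r + e' f r by [].
      by apply: (big_morph (fun e : E => e f r)) => [e e'|].
    have evD (e e' : E) : (e + e') f r = e f r + e' f r by [].
    rewrite evD !ev.
    congr (_ + _); apply: eq_bigr => i _;
      by rewrite (alg_morM opU_morph) (alg_morS opU_morph) oper_mulE operZ.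
  rewrite (alg_morB opU_morph) !(alg_morM opU_morph) opU_in.
  change (opa c (opU (kap a b) f) r + (opU (kap a b) (opa c f) r - opa c (opU (kap a b) f) r)
    = opU (kap a b) (shift_word [::] (opa c f)) r).
  by rewrite addrCA subrr addr0.
have sh : shift_word (j :: p) (opa c f) = shift_word p (opa c (shift_word [:: j] f))
    + \sum_i scalf (amx c i j) (shift_word (i :: p) f).
  apply/funext => v; rewrite fctE fct_sumE; exact: opa_cons.
rewrite sh operD oper_sum fctE fct_sumE !cat_cons !opa_cons opprD addrACA.
have Hf' : sorts_upto n.-1 (shift_word [:: j] f).
  by apply: sorts_upto_shift Hf => /=; case: n s.
congr (_ + _); first by apply: (IH n.-1) => //; case: n s {Hf Hf'}.
rewrite -sumrB; apply: eq_bigr => i _; rewrite operZ /scalf -mulrBr; congr (_ * _).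
exact: (Hf (i :: p)).
Qed.

Lemma sorts_upto_opU u n f : sorts_upto n f -> sorts_upto n (opU u f).
Proof.
move: u n f; apply: U_ind => [c|x|u v Hu Hv|u v Hu Hv] n f Hf.
- by rewrite (alg_morS opU_morph); exact: sorts_uptoZ.
- by rewrite opU_in; exact: sorts_upto_opa.
- by rewrite (alg_morD opU_morph); apply: sorts_uptoD; [exact: Hu|exact: Hv].
- by rewrite (alg_morM opU_morph); apply: Hv; exact: Hu.
Qed.

(** The cost [d] of a swap in a word of length [n.+1] only involves values of [f] on words two
    letters shorter, so it is already known. Disjoint swaps commute because [opU (kap a b)]
    preserves the sorting condition, and the hexagon is [kap_jacobi]; [sorting_potential] then
    supplies the new values. *)
Lemma sorts_upto_extend n f : sorts_upto n f ->
  exists2 f', forall w, (size w <= n)%N -> f' w = f w & sorts_upto n.+1 f'.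
Proof.
move=> Hf; pose d p a b r := opU (kap a b) (shift_word p f) r.
have shA p q h : shift_word q (shift_word p h) = shift_word (p ++ q) h.
  by apply/funext => v; rewrite /shift_word catA.
have [p q r a b a' b' _ _ sw|p r a b e _ _ sw|c cP] := @sorting_potential N n.+1 U d.
- have sz : (size (q ++ a' :: b' :: r) < n)%N.
    by move: sw; rewrite !size_cat /= !size_cat /=; lia.
  have H1 : d p a b (q ++ a' :: b' :: r) - d p a b (q ++ b' :: a' :: r)
      = opU (kap a' b') (shift_word q (opU (kap a b) (shift_word p f))) r.
    apply: (@sorts_upto_opU _ (size (q ++ a' :: b' :: r))) => //.
    apply: sorts_upto_shift Hf.
    by move: sw; rewrite !size_cat /= !size_cat /=; lia.
  have H2 : d (p ++ a :: b :: q) a' b' r - d (p ++ b :: a :: q) a' b' r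
      = opU (kap a' b') (shift_word q (opU (kap a b) (shift_word p f))) r.
    rewrite /d; set h1 := shift_word _ f; set h2 := shift_word _ f.
    have -> : opU (kap a' b') h1 r - opU (kap a' b') h2 r = opU (kap a' b') (h1 - h2) r.
      by rewrite operB.
    apply: (@opU_local _ (size r)) => // v sv.
    change (f ((p ++ a :: b :: q) ++ v) - f ((p ++ b :: a :: q) ++ v)
      = opU (kap a b) (shift_word p f) (q ++ v)).
    rewrite -!catA /=; apply: Hf.
    by move: sw; rewrite !size_cat /= !size_cat /= sv; lia.
  move: (etrans H1 (esym H2)) => /eqP.
  by rewrite subr_eq addrAC eq_sym subr_eq eq_sym => /eqP.
- have comm x y z : opU (kap x y) (shift_word p f) (z :: r)
      - opU (kap x y) (shift_word (rcons p z) f) r =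
      (opU (kap x y) * opx (@bas K N z) - opx (@bas K N z) * opU (kap x y)) (shift_word p f) r.
    transitivity (opx (@bas K N z) (opU (kap x y) (shift_word p f)) r
      - (opU (kap x y) (opx (@bas K N z) (shift_word p f)) r)); last by [].
    rewrite opx_bas; congr (_ - opU _ _ r).
    by apply/funext => v; rewrite opx_bas /shift_word cat_rcons.
  have arr (A A' B B' C C' : U) : A + (C' + B) - (B' + (C + A')) = (A - A') + (B - B') + (C' - C).
    rewrite (addrC B') (addrC C) -(addrA A') opprD addrACA opprD [X in _ + X = _]addrACA.
    by rewrite (addrC (C' - C)) addrA.
  apply/eqP; rewrite -subr_eq0 arr /d (kap_anti a e) (alg_morN opU_morph).
  change (opU (kap a b) (shift_word p f) (e :: r) - opU (kap a b) (shift_word (rcons p e) f) r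
     + (opU (kap b e) (shift_word p f) (a :: r) - opU (kap b e) (shift_word (rcons p a) f) r)
     + (- opU (kap e a) (shift_word (rcons p b) f) r
        - - opU (kap e a) (shift_word p f) (b :: r)) == 0).
  rewrite opprK (addrC (- _)) !comm; apply/eqP.
  exact: (congr1 (fun e : E => e (shift_word p f) r) (kap_jacobi a b e)).
exists (fun w => if (size w <= n)%N then f w else c w) => [w ->//|].
move=> p a b r sw.
have -> : opU (kap a b) (shift_word p (fun w => if (size w <= n)%N then f w else c w)) r
   = d p a b r.
  apply: (@opU_local _ (size r)) => // v sv; rewrite /shift_word.
  by rewrite ifT //; move: sw; rewrite !size_cat /= sv; lia.
have -> : size (p ++ b :: a :: r) = size (p ++ a :: b :: r) by rewrite !size_cat.
case: ifP => [/Hf//|/negbT]; rewrite -ltnNge => sw'.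
have {sw sw'}sw : size (p ++ a :: b :: r) = n.+1 by apply/eqP; rewrite eqn_leq sw.
have sw' : size (p ++ b :: a :: r) = n.+1 by rewrite -sw !size_cat.
case: (ltngtP b a) => [lt_ba|lt_ab|/ord_inj ->].
- by rewrite cP // addrC addKr.
- by rewrite (cP p r b a) // opprD addrA subrr sub0r /d (kap_anti a) (alg_morN opU_morph).
- by rewrite subrr /d kap_alt (alg_mor0 opU_morph).
Qed.

(** In length [size w0] the start is the indicator of the rearrangements of [w0], with 0 on shorter
    words; it is compatible with sorting because the correction terms only see shorter words. Each
    extension by one length keeps the earlier values, so the stages glue to [L]. *)
Lemma normal_coef_ex (w0 : seq I) : exists L : F,
  (forall n, sorts_upto n L) /\
  forall w, (size w <= size w0)%N ->
    L w = if size w == size w0 then (perm_eq w w0)%:R else 0.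
Proof.
pose n0 := size w0.
pose f0 : F := fun w => if size w == n0 then (perm_eq w w0)%:R else 0.
have Hf0 : sorts_upto n0 f0.
  move=> p a b r sw; rewrite /f0.
  have -> : size (p ++ b :: a :: r) = size (p ++ a :: b :: r) by rewrite !size_cat.
  have -> : perm_eq (p ++ b :: a :: r) w0 = perm_eq (p ++ a :: b :: r) w0.
    have /permPl -> // : perm_eq (p ++ b :: a :: r) (p ++ a :: b :: r).
    by rewrite perm_cat2l -[b :: _]/([:: b] ++ [:: a] ++ r) perm_catCA.
  rewrite subrr (@opU_local _ (size r) _ 0) ?oper0 // => v sv.
  by rewrite /shift_word ifF //; move: sw; rewrite !size_cat /= sv -/n0; lia.
pose step n f f' := (forall w, (size w <= n)%N -> f' w = f w) /\ sorts_upto n.+1 f'.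
have [G [G0 GS]] : exists G : nat -> F, G 0%N = f0 /\
    forall k, sorts_upto (n0 + k) (G k) /\
      forall w, (size w <= n0 + k)%N -> G k.+1 w = G k w.
  pose T k := {f : F | sorts_upto (n0 + k) f}.
  have next k (f : T k) : {f' : T k.+1 |
      forall w, (size w <= n0 + k)%N -> sval f' w = sval f w}.
    apply/cid; have [f' ff' Hf'] := sorts_upto_extend (svalP f).
    by rewrite -addnS in Hf'; exists (exist _ f' Hf').
  have Hf0' : sorts_upto (n0 + 0) f0 by rewrite addn0.
  pose H := fix H k : T k := if k is k'.+1 then sval (next k' (H k'))
            else exist _ f0 Hf0'.
  exists (fun k => sval (H k)); split=> // k; split; first exact: (svalP (H k)).
  exact: (svalP (next k (H k))).
have Gmono i j w : (i <= j)%N -> (size w <= n0 + i)%N -> G j w = G i w.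
  move=> /subnKC <-; elim: (j - i)%N => [|k IH] sw; first by rewrite addn0.
  rewrite addnS (GS _).2 ?IH //; lia.
pose L : F := fun w => G (size w) w.
have LG k w : (size w <= n0 + k)%N -> L w = G k w.
  move=> sw; rewrite /L; have [le|/ltnW le] := leqP (size w) k.
    by rewrite (Gmono (size w)) // leq_addl.
  by rewrite (Gmono k).
exists L; split=> [n p a b r sw|w sw]; last by rewrite (LG 0%N) ?G0 ?addn0.
have szb : size (p ++ b :: a :: r) = size (p ++ a :: b :: r) by rewrite !size_cat.
rewrite !(LG n) ?szb ?(leq_trans sw (leq_addl _ _)) //.
rewrite (GS n).1 ?(leq_trans sw (leq_addl _ _)) //.
apply: (@opU_local _ (size r)) => // v sv; rewrite /shift_word (LG n) //.
by move: sw; rewrite !size_cat /= sv; lia.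
Qed.
End NormalForm.

(** * The PBW property and the Jacobi identity *)

Section AssociatedGraded.
Context {K : comNzRingType} {A : pzAlgType K} (F : filtration A).

Lemma gr_class_eq n a (Fa Fa' : F n a) : gr_class Fa = gr_class Fa'.
Proof. by congr quot_pi; apply/rees_eqP. Qed.

Lemma gr_classM m n a b (Fa : F m a) (Fb : F n b) (Fab : F (m + n)%N (a * b)) :
  gr_class Fa * gr_class Fb = gr_class Fab.
Proof.
rewrite /gr_class -rmorphM; congr quot_pi; apply/rees_eqP => k.
rewrite -[LHS]/(cauchy (homog_seq m a) (homog_seq n b) k).
rewrite (@cauchyE _ _ _ _ k (maxn k (m + n))) ?leq_maxl //.
have lm : (m < (maxn k (m + n)).+1)%N by rewrite ltnS leq_max leq_addr orbT.
have ln : (n < (maxn k (m + n)).+1)%N by rewrite ltnS leq_max leq_addl orbT.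
rewrite (bigD1 (Ordinal lm)) //= [X in _ + X]big1 ?addr0 => [|i im]; last first.
  apply: big1 => j _; rewrite /homog_seq ifF ?mul0r //.
  by move: im; rewrite -val_eqE /=; exact: negbTE.
rewrite big_mkcond (bigD1 (Ordinal ln)) //= big1 ?addr0 => [|i im]; last first.
  case: ifP => // _; rewrite {2}/homog_seq [X in _ * X]ifF ?mulr0 //.
  by move: im; rewrite -val_eqE /=; exact: negbTE.
by rewrite /homog_seq !eqxx (eq_sym k).
Qed.

Lemma gr_classD n a b (Fa : F n a) (Fb : F n b) (Fab : F n (a + b)) :
  gr_class Fa + gr_class Fb = gr_class Fab.
Proof.
rewrite /gr_class -raddfD; congr quot_pi; apply/rees_eqP => k.
by rewrite reesD /= /homog_seq; case: eqP; rewrite ?addr0.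
Qed.

Lemma gr_class0 n (F0 : F n 0) : gr_class F0 = 0.
Proof.
rewrite /gr_class -(raddf0 (quot_pi (@gr_rel K A F))); congr quot_pi.
by apply/rees_eqP => k; rewrite /= /homog_seq; case: eqP.
Qed.

Lemma gr_class_scal (c : K) (Fc : F 0 c%:S) : gr_class Fc = c%:S.
Proof. by congr quot_pi; apply/rees_eqP. Qed.

Lemma gr_class_incr n a (Fa : F n a) (Fa' : F n.+1 a) : gr_class Fa' = 0.
Proof.
rewrite /gr_class -(raddf0 (quot_pi (@gr_rel K A F))); apply/quot_piP.
rewrite subr0; apply/gr_rel_ideal; split=> // k /=; rewrite /homog_seq.
by case: eqP => [[->]//|_]; exact: fil0.
Qed.

(** Vanishing in [gr] is membership in the ideal [gr_rel] of the Rees algebra, which is tested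
    degree by degree. Degree 0 is separate because the filtration step before it is 0. *)
Lemma gr_class_sum0 (J : Type) (l : seq J) (d : J -> nat) (h : J -> A)
    (Fh : forall j, F (d j) (h j)) :
  \sum_(j <- l) gr_class (Fh j) = 0 ->
  \sum_(j <- l | d j == 0%N) h j = 0 /\
  forall n, F n (\sum_(j <- l | d j == n.+1) h j).
Proof.
rewrite /gr_class -raddf_sum -(raddf0 (quot_pi (@gr_rel K A F))) => /quot_piP.
rewrite subr0 => /gr_rel_ideal.
have E n : (\sum_(j <- l) rees_homog (Fh j)) n = \sum_(j <- l | d j == n) h j.
  elim: l => [|j l IH]; first by rewrite !big_nil.
  rewrite !big_cons reesD IH /= /homog_seq eq_sym.
  by case: eqP; rewrite ?add0r.
by move=> [E0 H]; split=> [|n]; rewrite -E.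
Qed.

Lemma gr_sum_classes (y : gr F) : exists (d : nat) (r : rees F),
  y = \sum_(n < d) gr_class (rees_fil r n).
Proof.
have [r ->] := quot_pi_surj y; have := valP r => /rees_predP[_ [d r0]].
exists d.+1, r; rewrite /gr_class -raddf_sum; congr quot_pi; apply/rees_eqP => k.
have evD (f f' : rees F) : (f + f') k = f k + f' k by [].
rewrite (big_morph (fun f : rees F => f k) evD (erefl : (0 : rees F) k = 0)) /=.
have [dk|kd] := ltnP d k.
  rewrite r0 // big1 // => i _; rewrite /homog_seq ifF //.
  by apply/negbTE; rewrite neq_ltn (leq_trans (ltn_ord i)) ?orbT.
rewrite (bigD1 (Ordinal (kd : (k < d.+1)%N))) //= big1 ?addr0 => [|i ik].
  by rewrite /homog_seq eqxx.
rewrite /homog_seq ifF //; apply/negbTE; move: ik.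
by rewrite -val_eqE /= eq_sym.
Qed.

(* gr_class as a function of a alone, with junk value 0 outside F n *)
Definition grc n (a : A) : gr F :=
  if pselect (F n a) is left Fa then gr_class Fa else 0.

Lemma grcE n a (Fa : F n a) : grc n a = gr_class Fa.
Proof. by rewrite /grc; case: pselect => // Fa'; exact: gr_class_eq. Qed.

Lemma grcM m n a b : F m a -> F n b -> grc m a * grc n b = grc (m + n) (a * b).
Proof.
move=> Fa Fb; rewrite (grcE Fa) (grcE Fb) (grcE (fil_mul Fa Fb)); exact: gr_classM.
Qed.

Lemma grcD n a b : F n a -> F n b -> grc n (a + b) = grc n a + grc n b.
Proof.
move=> Fa Fb; rewrite (grcE Fa) (grcE Fb) (grcE (filD Fa Fb)); exact/esym/gr_classD.
Qed.

Lemma grc0 n : grc n 0 = 0.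
Proof. by rewrite (grcE (fil0 F n)) gr_class0. Qed.

Lemma grcB n a b : F n a -> F n b -> grc n (a - b) = grc n a - grc n b.
Proof.
move=> Fa Fb; apply/eqP; rewrite eq_sym subr_eq -grcD ?subrK //; exact: filB.
Qed.

Lemma grc_incr n a : F n a -> grc n.+1 a = 0.
Proof. by move=> Fa; rewrite (grcE (fil_incr Fa)); exact: gr_class_incr. Qed.

Lemma grc_scal c : grc 0 c%:S = c%:S.
Proof. by rewrite (grcE (fil_scal1 F c)); exact: gr_class_scal. Qed.

Lemma grc_sum n (J : Type) (r : seq J) (h : J -> A) :
  (forall j, F n (h j)) -> grc n (\sum_(j <- r) h j) = \sum_(j <- r) grc n (h j).
Proof.
move=> Fh; elim: r => [|j r IH]; first by rewrite !big_nil grc0.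
by rewrite !big_cons grcD ?IH //; exact: fil_sum.
Qed.

End AssociatedGraded.

(** * The criterion for algebras given by their universal properties *)

Section PBWCriterion.
Context {K : comNzRingType} {g : lmodType K} {N : nat}.
Local Notation V := 'cV[K]_N.
Local Notation I := 'I_N.
Context {act : g -> V -> V}.
Context {U : pzAlgType K} {uin : g -> U}.
Local Notation F := (seq I -> U).
Local Notation E := (oper U (seq I)).
Local Notation opa := (@opa K g N act U uin).
Local Notation opx := (@opx K N U).
Local Notation amx := (@act_mx K g N act).
Local Notation bas := (@bas K N).
Hypothesis U_ind : forall P : U -> Prop,
  (forall c, P c%:S) -> (forall x, P (uin x)) ->
  (forall a b, P a -> P b -> P (a + b)) ->
  (forall a b, P a -> P b -> P (a * b)) -> forall a, P a.

Context {T : pzAlgType K} {TU : U -> T} {TV : V -> T}.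
Hypothesis TU_morph : alg_morphism TU.
Hypothesis TV_lin : forall c x y, TV (c *: x + y) = c%:S * TV x + TV y.
Hypothesis T_act : forall a x, TU (uin a) * TV x - TV x * TU (uin a) = TV (act a x).
Hypothesis T_ind : forall P : T -> Prop,
  (forall c, P c%:S) -> (forall u, P (TU u)) -> (forall x, P (TV x)) ->
  (forall a b, P a -> P b -> P (a + b)) ->
  (forall a b, P a -> P b -> P (a * b)) -> forall a, P a.

Lemma TV_sum (J : Type) (l : seq J) (c : J -> K) (x : J -> V) :
  TV (\sum_(j <- l) c j *: x j) = \sum_(j <- l) (c j)%:S * TV (x j).
Proof.
elim: l => [|j l IH]; last by rewrite !big_cons TV_lin IH.
rewrite !big_nil; have := TV_lin (-1) 0 0.
by rewrite scaler0 addr0 scalN scal1 mulN1r addNr.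
Qed.

Lemma TV_E x : TV x = \sum_i (x i 0)%:S * TV (bas i).
Proof. by rewrite {1}[x]basE TV_sum. Qed.

Definition Tword (w : seq I) : T := \prod_(i <- w) TV (bas i).

Lemma Tword_nil : Tword [::] = 1.
Proof. exact: big_nil. Qed.
Lemma Tword_cons i w : Tword (i :: w) = TV (bas i) * Tword w.
Proof. exact: big_cons. Qed.

(** The normal form of [T]: letters on the left, one coefficient in [U] on the right. Every element
    has such a form by [Tspan_all]; independence comes from [opT_coef]. *)
Inductive Tspan : T -> Prop :=
| Tspan0 : Tspan 0
| TspanD w u t : Tspan t -> Tspan (Tword w * TU u + t).

Lemma Tspan_word w u : Tspan (Tword w * TU u).
Proof. by rewrite -[_ * _]addr0; apply: TspanD; exact: Tspan0. Qed.

Lemma Tspan_add s t : Tspan s -> Tspan t -> Tspan (s + t).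
Proof.
move=> Hs Ht; elim: Hs => [|w u s' _ IH]; first by rewrite add0r.
by rewrite -addrA; exact: TspanD.
Qed.

Lemma Tspan_sum (J : Type) (l : seq J) (h : J -> T) :
  (forall j, Tspan (h j)) -> Tspan (\sum_(j <- l) h j).
Proof.
move=> H; elim: l => [|j l IH]; rewrite ?big_nil ?big_cons; first exact: Tspan0.
exact: Tspan_add.
Qed.

Lemma Tspan_scal c t : Tspan t -> Tspan (c%:S * t).
Proof.
elim=> [|w u s _ IH]; first by rewrite mulr0; exact: Tspan0.
rewrite mulrDr; apply: Tspan_add => //.
by rewrite mulrA scalC -mulrA -(alg_morS TU_morph) -(alg_morM TU_morph); exact: Tspan_word.
Qed.

Lemma Tspan_V x t : Tspan t -> Tspan (TV x * t).
Proof.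
elim=> [|w u s _ IH]; first by rewrite mulr0; exact: Tspan0.
rewrite mulrDr; apply: Tspan_add => //; rewrite TV_E mulr_suml.
apply: Tspan_sum => i; rewrite -mulrA; apply: Tspan_scal.
by rewrite mulrA -Tword_cons; exact: Tspan_word.
Qed.

Lemma Tspan_U u t : Tspan t -> Tspan (TU u * t).
Proof.
move: u t; apply: U_ind => [c|a|u v Hu Hv|u v Hu Hv] t.
- by rewrite (alg_morS TU_morph); exact: Tspan_scal.
- elim=> [|w v s _ IH]; first by rewrite mulr0; exact: Tspan0.
  rewrite mulrDr; apply: Tspan_add => // {s IH}.
  elim: w => [|i w IH].
    by rewrite Tword_nil mul1r -(alg_morM TU_morph) -[TU _]mul1r -Tword_nil; exact: Tspan_word.
  rewrite Tword_cons -mulrA mulrA.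
  rewrite -(subrK (TV (bas i) * TU (uin a)) (TU (uin a) * _)) T_act mulrDl.
  apply: Tspan_add; first exact/Tspan_V/Tspan_word.
  by rewrite -mulrA; apply: Tspan_V.
- by move=> Ht; rewrite (alg_morD TU_morph) mulrDl; apply: Tspan_add; [exact: Hu|exact: Hv].
- by move=> Ht; rewrite (alg_morM TU_morph) -mulrA; apply/Hu/Hv.
Qed.

Lemma Tspan_all t : Tspan t.
Proof.
have H : forall s, Tspan s -> Tspan (t * s).
  move: t; apply: T_ind => [c|u|x|s t Hs Ht|s t Hs Ht] r Hr.
  - exact: Tspan_scal.
  - exact: Tspan_U.
  - exact: Tspan_V.
  - by rewrite mulrDl; apply: Tspan_add; [exact: Hs|exact: Ht].
  - by rewrite -mulrA; apply/Hs/Ht.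
rewrite -[t]mulr1; apply: H.
have := Tspan_word [::] 1; by rewrite Tword_nil (alg_mor1 TU_morph) mulr1.
Qed.

Lemma TU_TV_linear u x : exists c : I -> U, TU u * TV x = \sum_i TV (bas i) * TU (c i).
Proof.
move: u x; apply: U_ind => [c|a|u v Hu Hv|u v Hu Hv] x.
- exists (fun i => (c * x i 0)%:S); rewrite (alg_morS TU_morph) TV_E mulr_sumr.
  by apply: eq_bigr => i _; rewrite (alg_morS TU_morph) mulrA -scalM scalC.
- exists (fun i => (act a x i 0)%:S + (x i 0)%:S * uin a).
  rewrite -(subrK (TV x * TU (uin a)) (_ * _)) T_act (TV_E (act a x)) (TV_E x).
  rewrite mulr_suml -big_split; apply: eq_bigr => i _ /=.
  rewrite (alg_morD TU_morph) (alg_morM TU_morph) !(alg_morS TU_morph) mulrDr scalC.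
  by rewrite (scalC (x i 0)) mulrA.
- have [c Hc] := Hu x; have [d Hd] := Hv x; exists (fun i => c i + d i).
  rewrite (alg_morD TU_morph) mulrDl Hc Hd -big_split; apply: eq_bigr => i _ /=.
  by rewrite (alg_morD TU_morph) mulrDr.
- have [d Hd] := Hv x; have [c Hc] := choice (fun j => Hu (bas j)).
  exists (fun i => \sum_j c j i * d j).
  rewrite (alg_morM TU_morph) -mulrA Hd mulr_sumr.
  transitivity (\sum_j \sum_i TV (bas i) * TU (c j i * d j)).
    apply: eq_bigr => j _; rewrite mulrA Hc mulr_suml; apply: eq_bigr => i _.
    by rewrite (alg_morM TU_morph) mulrA.
  rewrite exchange_big; apply: eq_bigr => i _ /=.
  by rewrite (alg_mor_sum TU_morph) mulr_sumr.
Qed.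

Context {opT : T -> E}.
Hypothesis opT_morph : alg_morphism opT.
Hypothesis opT_in : forall a, opT (TU (uin a)) = opa a.
Hypothesis opT_V : forall x, opT (TV x) = opx x.
Local Notation opU := (opT \o TU).

Let opU_morph : alg_morphism opU.
Proof. exact: alg_morphism_comp. Qed.
Let opU_in a : opU (uin a) = opa a.
Proof. exact: opT_in. Qed.

Lemma opU_nil u f : opT (TU u) f [::] = f [::] * u.
Proof.
move: u f; apply: U_ind => [c|a|u v Hu Hv|u v Hu Hv] f.
- by rewrite (alg_morS TU_morph) (alg_morS opT_morph) oper_scalE scalC.
- by rewrite opT_in.
- by rewrite (alg_morD TU_morph) (alg_morD opT_morph) mulrDr -Hu -Hv.
- by rewrite (alg_morM TU_morph) (alg_morM opT_morph) oper_mulE Hv Hu mulrA.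
Qed.

Lemma opT_word w f : opT (Tword w) f = shift_word w f.
Proof.
elim: w f => [|i w IH] f; first by rewrite Tword_nil (alg_mor1 opT_morph).
rewrite Tword_cons (alg_morM opT_morph) oper_mulE IH opT_V.
by apply/funext => v; rewrite /shift_word opx_bas.
Qed.

(** Evaluation at the empty word turns [f] into an actual functional on [T]. With [f] concentrated
    on one word it isolates one coefficient in [U], without any knowledge of a basis of [U]. *)
Lemma opT_coef w u f : opT (Tword w * TU u) f [::] = f w * u.
Proof.
by rewrite (alg_morM opT_morph) oper_mulE opU_nil opT_word /shift_word cats0.
Qed.

Lemma opT_V_coef i u f : opT (TV (bas i) * TU u) f [::] = f [:: i] * u.
Proof. by rewrite -opT_coef Tword_cons Tword_nil mulr1. Qed.

(** The filtration of functions dual to word length; each letter of [V] lowers [k] by one and [U]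
    preserves it. *)
Definition low k (f : F) := forall w, (size w < k)%N -> f w = 0.

Lemma low_opU k u f : low k f -> low k (opT (TU u) f).
Proof.
move=> Hf w sw; rewrite -[LHS]/(opU u f w).
rewrite (@opU_local _ _ _ act _ _ opU opU_morph opU_in U_ind u (size w) f 0) ?oper0 //.
by move=> v sv; rewrite Hf ?sv.
Qed.

Lemma low_opx k x f : low k.+1 f -> low k (opx x f).
Proof. by move=> Hf w sw; rewrite opxE big1 // => i _; rewrite Hf ?mulr0. Qed.

Section Kappa.
Variable kappa : V -> V -> U.
Hypothesis kappa_linl : forall y c x x',
  kappa (c *: x + x') y = c%:S * kappa x y + kappa x' y.
Hypothesis kappa_linr : forall x c y y',
  kappa x (c *: y + y') = c%:S * kappa x y + kappa x y'.
Hypothesis kappa_alt : forall x, kappa x x = 0.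
Hypothesis kappa_equiv : forall a x y,
  kappa (act a x) y + kappa x (act a y) = uin a * kappa x y - kappa x y * uin a.

Let linE (W : pzAlgType K) (h : V -> W) :
  (forall c x y, h (c *: x + y) = c%:S * h x + h y) ->
  forall x, h x = \sum_i (x i 0)%:S * h (bas i).
Proof.
move=> hlin x; have h0 : h 0 = 0.
  by have := hlin (-1) 0 0; rewrite scaler0 addr0 scalN scal1 mulN1r addNr.
rewrite {1}[x]basE; elim: (index_enum _) => [|i r IH]; first by rewrite !big_nil.
by rewrite !big_cons hlin IH.
Qed.

Let kap a b := kappa (bas a) (bas b).

Let kap_alt a : kap a a = 0.
Proof. exact: kappa_alt. Qed.

Lemma kappa_anti x y : kappa x y = - kappa y x.
Proof.
have := kappa_alt (1 *: x + y); rewrite kappa_linl !kappa_linr !kappa_alt scal1.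
by rewrite !mul1r add0r addr0 => /eqP; rewrite addr_eq0 => /eqP.
Qed.

Let kap_anti a b : kap a b = - kap b a.
Proof. exact: kappa_anti. Qed.

Let kap_equiv c a b :
  \sum_i (amx c i a)%:S * kap i b + \sum_i (amx c i b)%:S * kap a i
  = uin c * kap a b - kap a b * uin c.
Proof.
rewrite -kappa_equiv; congr (_ + _).
  by rewrite [RHS](linE (kappa_linl (bas b))).
by rewrite [RHS](linE (kappa_linr (bas a))).
Qed.

Definition defect x y := TV x * TV y - TV y * TV x - TU (kappa x y).

Let sub3D (a a' b b' d d' : T) : a + a' - (b + b') - (d + d') = a - b - d + (a' - b' - d').
Proof. by rewrite !opprD (addrACA a) (addrACA (a - b)). Qed.

Lemma defect_linl y c x x' : defect (c *: x + x') y = c%:S * defect x y + defect x' y.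
Proof.
rewrite /defect !TV_lin kappa_linl (alg_morD TU_morph) (alg_morM TU_morph) (alg_morS TU_morph).
by rewrite mulrDl mulrDr sub3D !mulrBr !mulrA (scalC c (TV y)).
Qed.

Lemma defect_linr x c y y' : defect x (c *: y + y') = c%:S * defect x y + defect x y'.
Proof.
rewrite /defect !TV_lin kappa_linr (alg_morD TU_morph) (alg_morM TU_morph) (alg_morS TU_morph).
by rewrite mulrDl mulrDr sub3D !mulrBr !mulrA (scalC c (TV x)).
Qed.

Definition sorts_all f := forall n, sorts_upto (opU := opU) kap n f.

Lemma sorts_all_opT t f : sorts_all f -> sorts_all (opT t f).
Proof.
move: t f; apply: T_ind => [c|u|x|s t Hs Ht|s t Hs Ht] f Hf n.
- by rewrite (alg_morS opT_morph); exact: sorts_uptoZ.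
- by rewrite -[opT _]/(opU u); exact: (sorts_upto_opU opU_morph opU_in U_ind).
- rewrite opT_V; have -> : opx x f = \sum_i scalf (x i 0) (shift_word [:: i] f).
    by apply/funext => v; rewrite fct_sumE opxE.
  apply: big_ind => [|f1 f2|i _].
  + by move=> p a b r _; rewrite [X in opT _ X](_ : _ = 0) // oper0 subrr.
  + exact: sorts_uptoD.
  + by apply/sorts_uptoZ/(@sorts_upto_shift _ _ _ _ _ n.+1).
- by rewrite (alg_morD opT_morph); apply: sorts_uptoD; [exact: Hs|exact: Ht].
- by rewrite (alg_morM opT_morph); exact: (Ht (opT s f) (Hs _ Hf)).
Qed.

Lemma sorts_all_defect x y f : sorts_all f -> opT (defect x y) f = 0.
Proof.
move=> Hf.
have H0 i j : opT (defect (bas i) (bas j)) f = 0.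
  apply/funext => r; have := Hf (size r).+2 [::] i j r (leqnn _).
  rewrite /defect !(alg_morB opT_morph) !(alg_morM opT_morph) !opT_V => H.
  change (opx (bas j) (opx (bas i) f) r - opx (bas i) (opx (bas j) f) r
     - opT (TU (kap i j)) f r = 0).
  by rewrite !opx_bas; apply/eqP; rewrite subr_eq0; apply/eqP.
have ev (G : I -> E) : (\sum_i G i) f = \sum_i G i f.
  by apply: (big_morph (fun e : E => e f)) => [e e'|].
have scal0f c D : opT D f = 0 -> opT (c%:S * D) f = 0.
  move=> D0; rewrite (alg_morM opT_morph) (alg_morS opT_morph) oper_mulE operZ D0.
  by apply/funext => r; exact: mulr0.
rewrite (linE (defect_linl y)) (alg_mor_sum opT_morph) ev big1 // => i _.
apply: (scal0f); rewrite (linE (defect_linr (bas i))) (alg_mor_sum opT_morph) ev.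
by rewrite big1 // => j _; exact: scal0f.
Qed.

Variable HS : T -> Prop.
Hypothesis HSP : forall t, HS t <-> exists x y, t = defect x y.
Local Notation H := (quot_alg HS).
Local Notation pi := (quot_pi HS).
Variable D : nat -> H -> Prop.
Hypothesis DP : forall n h, D n h <->
  (n = 0%N /\ exists u, h = pi (TU u)) \/ (n = 1%N /\ exists x, h = pi (TV x)).
Local Notation fil := (generated_filtration D).
Local Notation grc := (grc fil).

Lemma fil_TU u : fil 0 (pi (TU u)).
Proof. by apply/gen_fil_gen/DP; left; split=> //; exists u. Qed.
Lemma fil_TV x : fil 1 (pi (TV x)).
Proof. by apply/gen_fil_gen/DP; right; split=> //; exists x. Qed.

(** A function compatible with sorting is killed by each relation and stays compatible under all
    operators. The latter handles left multiples, since the left factor of a product acts first. *)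
Lemma defect_ideal t f : gen_ideal HS t -> sorts_all f -> opT t f = 0.
Proof.
move=> Ht; elim: Ht f => {t} [t /HSP[x [y ->]]||s t _ Hs _ Ht|s t _ Ht|s t _ Ht] f Hf.
- exact: sorts_all_defect.
- by rewrite (alg_mor0 opT_morph).
- by rewrite (alg_morD opT_morph) -[LHS]/(opT s f + opT t f) Hs ?Ht ?addr0.
- by rewrite (alg_morM opT_morph) oper_mulE Ht //; exact: sorts_all_opT.
- by rewrite (alg_morM opT_morph) oper_mulE Ht ?oper0.
Qed.

Lemma fil_low n h : fil n h ->
  exists2 t, pi t = h & forall k f, low (k + n) f -> low k (opT t f).
Proof.
have pim := quot_pi_morph HS.
elim=> {n h} [n h /DP[[-> [u ->]]|[-> [x ->]]]|n c a b _ [s <- Hs] _ [t <- Ht]||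
  m n a b _ [s <- Hs] _ [t <- Ht]|n a _ [t <- Ht]].
- by exists (TU u) => // k f; rewrite addn0; exact: low_opU.
- by exists (TV x) => // k f; rewrite addn1 opT_V; exact: low_opx.
- exists (c%:S * s + t); first by rewrite (alg_morD pim) (alg_morM pim) (alg_morS pim).
  move=> k f Hf w sw.
  rewrite (alg_morD opT_morph) (alg_morM opT_morph) (alg_morS opT_morph).
  change (opT s (scalf c f) w + opT t f w = 0).
  by rewrite operZ /scalf (Hs k f) ?(Ht k f) // mulr0 addr0.
- by exists 1; [exact: alg_mor1|move=> k f; rewrite addn0 (alg_mor1 opT_morph)].
- exists (s * t); first by rewrite (alg_morM pim).
  move=> k f Hf; rewrite (alg_morM opT_morph) oper_mulE; apply: Ht; apply: Hs.
  by rewrite -addnA (addnC n).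
- exists t => // k f Hf; apply: Ht => w sw; apply: Hf.
  by rewrite addnS (leq_trans sw).
Qed.

Definition cyclic_comm x y z :=
  TU (kappa x y) * TV z - TV z * TU (kappa x y)
  + (TU (kappa y z) * TV x - TV x * TU (kappa y z))
  + (TU (kappa z x) * TV y - TV y * TU (kappa z x)).

(** In the quotient [kappa] becomes the commutator of vectors, so this is the Jacobi identity for
    commutators in an associative ring. *)
Lemma cyclic_comm_quot x y z : pi (cyclic_comm x y z) = 0.
Proof.
have pim := quot_pi_morph HS.
have E a b : pi (TU (kappa a b)) = pi (TV a) * pi (TV b) - pi (TV b) * pi (TV a).
  apply/esym/eqP; rewrite -subr_eq0 -!(alg_morM pim) -!(alg_morB pim); apply/eqP.
  rewrite -(alg_mor0 pim); apply/quot_piP; rewrite subr0; apply: gen_ideal_gen.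
  by apply/HSP; exists a, b.
rewrite /cyclic_comm !(alg_morD pim) !(alg_morN pim) !(alg_morM pim) !E.
move: (pi _) (pi _) (pi _) => X Y Z; rewrite !mulrBl !mulrBr !mulrA.
have tele (M : zmodType) (a b c : M) : a - b + (c - a) = c - b.
  by rewrite addrC addrA subrK.
have six (M : zmodType) (a b c d e f : M) :
    a - b - (c - d) + (e - d - (a - f)) + (c - f - (e - b)) = 0.
  by rewrite !opprB (addrC (e - d)) (addrACA (a - b)) !tele addrACA !tele subrr.
exact: six.
Qed.

Variable SS : T -> Prop.
Hypothesis SSP : forall t, SS t <-> exists x y, t = TV x * TV y - TV y * TV x.
Local Notation S := (quot_alg SS).
Local Notation sig := (quot_pi SS).

Definition natural (f : S -> gr fil) := [/\ alg_morphism f,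
  forall u, f (sig (TU u)) = grc 0 (pi (TU u)) &
  forall x, f (sig (TV x)) = grc 1 (pi (TV x))].

Lemma cyclic_comm_linear x y z : exists c : I -> U,
  cyclic_comm x y z = \sum_i TV (bas i) * TU (c i).
Proof.
have lin0 u v : exists c : I -> U,
    TU u * TV v - TV v * TU u = \sum_i TV (bas i) * TU (c i).
  have [c Hc] := TU_TV_linear u v; exists (fun i => c i - (v i 0)%:S * u).
  rewrite Hc (TV_E v) mulr_suml -sumrB; apply: eq_bigr => i _.
  rewrite (alg_morB TU_morph) (alg_morM TU_morph) (alg_morS TU_morph) mulrBr.
  by rewrite (scalC (v i 0)) mulrA.
have [c1 H1] := lin0 (kappa x y) z; have [c2 H2] := lin0 (kappa y z) x.
have [c3 H3] := lin0 (kappa z x) y; exists (fun i => c1 i + c2 i + c3 i).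
rewrite /cyclic_comm H1 H2 H3 -!big_split; apply: eq_bigr => i _ /=.
by rewrite !(alg_morD TU_morph) !mulrDr.
Qed.

(* The functional picking the coefficient of a word of length one is invariant
   under sorting letters. *)
Lemma cyclic_comm_sdS x y z : sig (cyclic_comm x y z) = 0 ->
    (forall t f, gen_ideal SS t ->
      (forall p a b r, f (p ++ a :: b :: r) = f (p ++ b :: a :: r)) -> opT t f = 0) ->
  cyclic_comm x y z = 0.
Proof.
move=> J0 SSkill.
have [c Hc] := cyclic_comm_linear x y z.
suff c0 i : c i = 0.
  by rewrite Hc big1 // => i _; rewrite c0 (alg_mor0 TU_morph) mulr0.
pose f : F := fun w => (w == [:: i])%:R.
have <- : opT (cyclic_comm x y z) f [::] = c i.
  rewrite Hc (alg_mor_sum opT_morph).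
  have ev (G : I -> E) : (\sum_i G i) f [::] = \sum_i G i f [::].
    by apply: (big_morph (fun e : E => e f [::])) => [e e'|].
  rewrite ev (bigD1 i) //= big1 => [|j ji].
    by rewrite opT_V_coef /f eqxx mul1r addr0.
  by rewrite opT_V_coef /f eqseq_cons (negPf ji) mul0r.
rewrite (SSkill _ f) //.
  by rewrite -(subr0 (cyclic_comm x y z)); apply/quot_piP; rewrite J0 raddf0.
by move=> [|p0 [|p1 p]] a b r; rewrite /f //= !eqseq_cons /= ?andbF.
Qed.

Lemma fil_Tword w u : fil (size w) (pi (Tword w * TU u)).
Proof.
have pim := quot_pi_morph HS.
rewrite (alg_morM pim) -[size w]addn0; apply: (fil_mul _ (fil_TU u)).
elim: w => [|j w IH]; first by rewrite Tword_nil (alg_mor1 pim); exact: fil_one.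
by rewrite Tword_cons (alg_morM pim); exact: (fil_mul (fil_TV _) IH).
Qed.

Lemma natural_word f w u : natural f ->
  f (sig (Tword w * TU u)) = grc (size w) (pi (Tword w * TU u)).
Proof.
move=> [fm fU fV]; have sm := quot_pi_morph SS; have pim := quot_pi_morph HS.
elim: w => [|i w IH]; first by rewrite Tword_nil !mul1r fU.
rewrite Tword_cons -mulrA (alg_morM sm) (alg_morM fm) IH fV (alg_morM pim (TV _)).
by rewrite grcM //; [exact: fil_TV|exact: fil_Tword].
Qed.

(** By [cyclic_comm_linear] the element is homogeneous of degree 1, so its image in [gr] is the
    class in degree 1 of its image in [H]. That image is 0 by [cyclic_comm_quot]. *)
Lemma natural_cyclic_comm f x y z :
  natural f -> injective f -> sig (cyclic_comm x y z) = 0.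
Proof.
move=> fn finj; have [fm fU fV] := fn.
apply: finj; rewrite (alg_mor0 fm).
have [c Hc] := cyclic_comm_linear x y z.
have sm := quot_pi_morph SS; have pim := quot_pi_morph HS.
have E i : sig (TV (bas i) * TU (c i)) = sig (Tword [:: i] * TU (c i)).
  by rewrite Tword_cons Tword_nil mulr1.
transitivity (grc 1 (pi (cyclic_comm x y z))); last by rewrite cyclic_comm_quot grc0.
rewrite Hc (alg_mor_sum sm) (alg_mor_sum fm) (alg_mor_sum pim) grc_sum => [|i]; last first.
  by have := fil_Tword [:: i] (c i); rewrite Tword_cons Tword_nil mulr1.
apply: eq_bigr => i _; rewrite E natural_word //.
by rewrite Tword_cons Tword_nil mulr1.
Qed.

Lemma sig_perm w w' : perm_eq w w' -> sig (Tword w) = sig (Tword w').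
Proof.
have sm := quot_pi_morph SS.
have comm x y : sig (TV x) * sig (TV y) = sig (TV y) * sig (TV x).
  rewrite -!(alg_morM sm); apply/quot_piP/gen_ideal_gen/SSP; by exists x, y.
have commw i v : sig (Tword v) * sig (TV (bas i)) = sig (TV (bas i)) * sig (Tword v).
  elim: v => [|j v IH]; first by rewrite Tword_nil (alg_mor1 sm) mul1r mulr1.
  by rewrite Tword_cons (alg_morM sm) -mulrA IH mulrA comm -mulrA.
elim: w w' => [|i w IH] w' ww'.
  by have := perm_size ww'; case: w' {ww'}.
have iw' : i \in w' by rewrite -(perm_mem ww') mem_head.
case/splitPr: iw' ww' => p q ww'.
have {}ww' : perm_eq w (p ++ q).
  by rewrite -(perm_cons i) (permPl ww') -[i :: q]/([:: i] ++ q) perm_catCA.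
have TWcat a b : Tword (a ++ b) = Tword a * Tword b by rewrite /Tword big_cat.
rewrite TWcat !Tword_cons !(alg_morM sm) (IH _ ww') TWcat (alg_morM sm).
by rewrite !mulrA commw.
Qed.

Hypothesis T_universal : forall (B : pzAlgType K) (hU : U -> B) (hV : V -> B),
  alg_morphism hU -> (forall c x y, hV (c *: x + y) = c%:S * hV x + hV y) ->
  (forall a x, hU (uin a) * hV x - hV x * hU (uin a) = hV (act a x)) ->
  exists f : T -> B, [/\ alg_morphism f, forall u, f (TU u) = hU u &
    forall x, f (TV x) = hV x].

Lemma natural_ex : exists f, natural f.
Proof.
have sm := quot_pi_morph SS; have pim := quot_pi_morph HS.
pose hU u := grc 0 (pi (TU u)); pose hV x := grc 1 (pi (TV x)).
have [|||f [fm fU fV]] := @T_universal (gr fil) hU hV.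
- split=> [u v||c]; rewrite /hU.
  + by rewrite (alg_morB TU_morph) (alg_morB pim) grcB //; exact: fil_TU.
  + split=> [|u v].
      by rewrite (alg_mor1 TU_morph) (alg_mor1 pim) -(@scal1 K H) grc_scal scal1.
    by rewrite (alg_morM TU_morph) (alg_morM pim) grcM //; exact: fil_TU.
  + by rewrite (alg_morS TU_morph) (alg_morS pim) grc_scal.
- move=> c x y; rewrite /hV TV_lin (alg_morD pim) (alg_morM pim) (alg_morS pim).
  rewrite -(grc_scal fil) grcM ?add0n ?grcD //.
  + exact/fil_scal/fil_TV.
  + exact: fil_TV.
  + exact: fil_scal1.
  + exact: fil_TV.
- move=> a x; rewrite /hU /hV -T_act (alg_morB pim) !(alg_morM pim).
  have Fu := fil_TU (uin a); have Fv := fil_TV x.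
  by rewrite !grcM // grcB //; [exact: (fil_mul Fu Fv)|exact: (fil_mul Fv Fu)].
have [|f' [f'm f'E]] := quot_universal (S := SS) fm.
  move=> _ /SSP[x [y ->]]; rewrite (alg_morB fm) !(alg_morM fm) !fV /hV.
  have Fx := fil_TV x; have Fy := fil_TV y.
  rewrite !grcM // -grcB; [|exact: (fil_mul Fx Fy)|exact: (fil_mul Fy Fx)].
  rewrite -!(alg_morM pim) -(alg_morB pim).
  have -> : pi (TV x * TV y - TV y * TV x) = pi (TU (kappa x y)).
    by apply/quot_piP/gen_ideal_gen/HSP; exists x, y.
  by apply: grc_incr; apply: fil_incr; exact: fil_TU.
by exists f'; split=> // [u|x]; rewrite f'E ?fU ?fV.
Qed.

Lemma natural_surj f y : natural f -> exists s, f s = y.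
Proof.
move=> [fm fU fV].
have cls n h : fil n h -> exists s, f s = grc n h.
  elim=> {n h} [n h /DP[[-> [u ->]]|[-> [x ->]]]|n c a b Fa [s Hs] Fb [t Ht]||
    m n a b Fa [s Hs] Fb [t Ht]|n a Fa _].
  - by exists (sig (TU u)).
  - by exists (sig (TV x)).
  - exists (c%:S * s + t).
    rewrite (alg_morD fm) (alg_morM fm) (alg_morS fm) Hs Ht grcD //; last exact: fil_scal.
    by rewrite -(grc_scal fil) grcM //; exact: fil_scal1.
  - by exists 1; rewrite (alg_mor1 fm) -(@scal1 K H) grc_scal scal1.
  - by exists (s * t); rewrite (alg_morM fm) Hs Ht grcM.
  - by exists 0; rewrite (alg_mor0 fm) grc_incr.
have [d [r ->]] := gr_sum_classes y.
elim: d => [|d [s Hs]]; first by exists 0; rewrite big_ord0 (alg_mor0 fm).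
have [t Ht] := cls d (r d) (rees_fil r d).
by exists (s + t); rewrite big_ord_recr (alg_morD fm) Hs Ht (grcE (rees_fil r d)).
Qed.

(** A kernel element is written with sorted words. For each sorted [w0] the functional of
    [normal_coef_ex] respects the relations of [H] and reads off the coefficient of [w0], because a
    sorted rearrangement of [w0] is [w0] itself. All coefficients turn out to be 0. *)
Lemma natural_inj f : natural f -> (forall x y z, cyclic_comm x y z = 0) -> injective f.
Proof.
move=> fn J0; have [fm _ _] := fn.
have sm := quot_pi_morph SS; have pim := quot_pi_morph HS.
suff ker0 s : f s = 0 -> s = 0.
  move=> s t fst; apply/eqP; rewrite -subr_eq0; apply/eqP/ker0.
  by rewrite (alg_morB fm) fst subrr.
have kap_jacobi a b e : opU (kap a b) * opx (bas e) - opx (bas e) * opU (kap a b)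
  + (opU (kap b e) * opx (bas a) - opx (bas a) * opU (kap b e))
  + (opU (kap e a) * opx (bas b) - opx (bas b) * opU (kap e a)) = 0.
  rewrite -(alg_mor0 opT_morph) -(J0 (bas a) (bas b) (bas e)) /cyclic_comm.
  by rewrite !(alg_morD opT_morph) !(alg_morN opT_morph) !(alg_morM opT_morph) !opT_V.
have [t ->] := quot_pi_surj s.
pose term (z : seq I * U) := Tword z.1 * TU z.2.
have [l [Hl ls]] : exists l : seq (seq I * U),
    sig t = \sum_(z <- l) sig (term z) /\
    all (fun z => sorted (fun i j : I => (i <= j)%N) z.1) l.
  elim: (Tspan_all t) => [|w u r _ [l [Hl ls]]].
    by exists [::]; rewrite big_nil (alg_mor0 sm).
  exists ((sort (fun i j : I => (i <= j)%N) w, u) :: l); split; last first.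
    by rewrite /= ls andbT sort_sorted // => i j; exact: leq_total.
  rewrite big_cons (alg_morD sm) Hl /term /= !(alg_morM sm); congr (_ * _ + _).
  by apply: sig_perm; rewrite perm_sym perm_sort.
move=> fs0; rewrite Hl.
have {}fs0 : \sum_(z <- l) gr_class (fil_Tword z.1 z.2) = 0.
  rewrite -[RHS]fs0 Hl (alg_mor_sum fm); apply: eq_bigr => z _.
  by rewrite /term natural_word // (grcE (fil_Tword z.1 z.2)).
have coef0 w0 : sorted (fun i j : I => (i <= j)%N) w0 ->
    \sum_(z <- l | z.1 == w0) z.2 = 0.
  move=> sw0; have [L [Ls LE]] :=
    normal_coef_ex opU_morph opU_in U_ind kap_alt kap_anti kap_equiv kap_jacobi w0.
  (* Vanishing in [gr] puts the part of length [size w0] one filtration step lower (or makes it 0 in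
     length 0). It therefore has a second representative [t'], too short to be seen by [L]. *)
  have [t' Ht' t'L] : exists2 t', pi t' = \sum_(z <- l | size z.1 == size w0) pi (term z)
       & opT t' L [::] = 0.
    have [E0 En] := gr_class_sum0 fs0.
    case Ew0 : (size w0) E0 En => [|n] E0 En.
      by exists 0; rewrite ?(alg_mor0 opT_morph) // (alg_mor0 pim) E0.
    have [t' Ht' lowt'] := fil_low (En n); exists t'; first by rewrite Ht'.
    apply: (lowt' 1%N) => //; rewrite add1n -Ew0 => w sw.
    by rewrite LE ?(ltnW sw) // ifF // ltn_eqF.
  have : opT (\sum_(z <- l | size z.1 == size w0) term z - t') L = 0.
    apply: defect_ideal Ls; apply/quot_piP.
    by rewrite Ht' (alg_mor_sum pim).
  rewrite (alg_morB opT_morph) (alg_mor_sum opT_morph).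
  move/(congr1 (fun h : F => h [::])) => H0.
  have {}H0 : (\sum_(z <- l | size z.1 == size w0) opT (term z)) L [::] - opT t' L [::] = 0.
    exact: H0.
  rewrite t'L subr0 in H0.
  rewrite -[RHS]H0.
  rewrite (big_morph (fun e : E => e L [::]) (id1 := 0) (op1 := +%R)) //.
  rewrite big_mkcond [RHS]big_mkcond; apply: eq_big_seq => z zl.
  rewrite /term opT_coef; case: (eqVneq (size z.1) (size w0)) => [sz|nsz].
    rewrite LE ?sz // eqxx; have sz1 := allP ls z zl.
    case: eqP => [->|nz]; first by rewrite perm_refl mul1r.
    case pz : (perm_eq z.1 w0); last by rewrite mul0r.
    case: nz; apply: (@sorted_eq _ (fun i j : I => (i <= j)%N)) pz => // [i j k|i j].
      exact: leq_trans.
    by rewrite -eqn_leq => /eqP/ord_inj.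
  by case: eqP => // Ez; rewrite Ez eqxx in nsz.
transitivity (\sum_(w0 <- undup (map fst l)) \sum_(z <- l | z.1 == w0) sig (term z)).
  under [RHS]eq_bigr do rewrite big_mkcond; rewrite exchange_big /=.
  apply: eq_big_seq => z zl; rewrite -big_mkcond.
  rewrite big_mkcond (bigD1_seq z.1) ?undup_uniq ?mem_undup ?map_f //= eqxx.
  by rewrite big1 ?addr0 // => w /negPf; rewrite eq_sym => ->.
rewrite big_seq big1 // => w0; rewrite mem_undup => /mapP[z0 z0l Ew0].
have sw0 : sorted (fun i j : I => (i <= j)%N) w0 by rewrite Ew0; exact: (allP ls).
transitivity (sig (Tword w0) * sig (TU (\sum_(z <- l | z.1 == w0) z.2))).
  rewrite (alg_mor_sum TU_morph) (alg_mor_sum sm) mulr_sumr.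
  by apply: eq_bigr => z /eqP <-; rewrite /term (alg_morM sm).
by rewrite coef0 // (alg_mor0 TU_morph) (alg_mor0 sm) mulr0.
Qed.

End Kappa.

Theorem natural_bijective_iff (kappa : V -> V -> U)
    (kappa_linl : forall y c x x', kappa (c *: x + x') y = c%:S * kappa x y + kappa x' y)
    (kappa_linr : forall x c y y', kappa x (c *: y + y') = c%:S * kappa x y + kappa x y')
    (kappa_alt : forall x, kappa x x = 0)
    (kappa_equiv : forall a x y,
      kappa (act a x) y + kappa x (act a y) = uin a * kappa x y - kappa x y * uin a)
    (HS : T -> Prop) (HSP : forall t, HS t <-> exists x y, t = defect kappa x y)
    (D : nat -> quot_alg HS -> Prop)
    (DP : forall n h, D n h <->
      (n = 0%N /\ exists u, h = quot_pi HS (TU u)) \/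
      (n = 1%N /\ exists x, h = quot_pi HS (TV x)))
    (SS : T -> Prop)
    (SSP : forall t, SS t <-> exists x y, t = TV x * TV y - TV y * TV x)
    (T_universal : forall (B : pzAlgType K) (hU : U -> B) (hV : V -> B),
      alg_morphism hU -> (forall c x y, hV (c *: x + y) = c%:S * hV x + hV y) ->
      (forall a x, hU (uin a) * hV x - hV x * hU (uin a) = hV (act a x)) ->
      exists f : T -> B, [/\ alg_morphism f, forall u, f (TU u) = hU u &
        forall x, f (TV x) = hV x]) :
  (exists f, natural (D := D) (SS := SS) f /\ bijective f) <->
  forall x y z, cyclic_comm kappa x y z = 0.
Proof.
split=> [[f [fn fb]] x y z|J0].
  have sJ := natural_cyclic_comm HSP DP x y z fn (bij_inj fb).
  apply: (cyclic_comm_sdS sJ) => t f' Ht f'P.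
  have lin0 (u : K) : 0 = u%:S * 0 + 0 :> U by rewrite mulr0 addr0.
  have equiv0 (a : g) : 0 + 0 = uin a * 0 - 0 * uin a.
    by rewrite mulr0 mul0r subrr addr0.
  (* The relations of U |x SV are the defects of the zero map, so [defect_ideal] applies to them;
     for the zero map, sorting compatibility is plain symmetry in the letters. *)
  have SSP0 s : SS s <-> exists x y, s = defect (fun _ _ => 0) x y.
    rewrite SSP /defect (alg_mor0 TU_morph).
    by split=> [[x' [y' ->]]|[x' [y' ->]]]; exists x', y'; rewrite subr0.
  refine (@defect_ideal (fun _ _ => 0) _ _ _ SS SSP0 t f' Ht _).
  - by move=> *; exact: lin0.
  - by move=> *; exact: lin0.
  - by move=> *; exact: equiv0.
  - move=> n p a b r _; rewrite f'P subrr.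
    by rewrite -[RHS]/(opU 0 (shift_word p f') r) (alg_mor0 opU_morph).
have [f fn] := natural_ex HSP DP SSP T_universal.
have finj := natural_inj kappa_linl kappa_linr kappa_alt kappa_equiv HSP DP SSP fn J0.
exists f; split=> //.
exists (fun y => sval (cid (natural_surj DP y fn))) => [s|y]; last by case: cid.
by apply: finj; case: cid.
Qed.
End PBWCriterion.

(** * The enveloping algebra, its semidirect product, and the criterion for them *)

Lemma uea_ind (K : comNzRingType) (g : lmodType K) (br : g -> g -> g)
    (P : uea br -> Prop) :
  (forall c, P c%:S) -> (forall a, P (uea_in br a)) ->
  (forall u v, P u -> P v -> P (u + v)) ->
  (forall u v, P u -> P v -> P (u * v)) -> forall u, P u.
Proof. exact: quot_free_ind. Qed.

Section SemidirectProduct.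
Context {K : comNzRingType} {g V : lmodType K} {br : g -> g -> g} {act : g -> V -> V}.
Local Notation U := (uea br).
Local Notation T := (sdT br act).
Local Notation TU := (@sdT_U K g V br act).
Local Notation TV := (sdT_V br act).
Local Notation Trel := (@sdT_rel K g V br act).

Lemma sdT_ind (P : T -> Prop) :
  (forall c, P c%:S) -> (forall u, P (TU u)) -> (forall x, P (TV x)) ->
  (forall s t, P s -> P t -> P (s + t)) ->
  (forall s t, P s -> P t -> P (s * t)) -> forall t, P t.
Proof.
move=> Pc PU PV PD PM; apply: quot_free_ind => // -[u|x]; [exact: PU|exact: PV].
Qed.

Let sdT_relE s t : Trel (s - t) -> quot_pi Trel s = quot_pi Trel t.
Proof. by move=> /gen_ideal_gen/quot_piP. Qed.

Lemma sdT_U_morph : alg_morphism TU.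
Proof.
have pm := quot_pi_morph Trel.
have TUS c : TU c%:S = c%:S.
  by rewrite -(alg_morS pm); apply: sdT_relE; exact: sdT_rel_scalU.
have TUD u v : TU (u + v) = TU u + TU v.
  by rewrite -(alg_morD pm); apply: sdT_relE; exact: sdT_rel_addU.
have TUM u v : TU (u * v) = TU u * TU v.
  by rewrite -(alg_morM pm); apply: sdT_relE; exact: sdT_rel_mulU.
split; [move=> u v| |exact: TUS].
  by apply: (addIr (TU v)); rewrite -TUD !subrK.
by split; [exact: (etrans (congr1 TU (esym (@scal1 K U))) (etrans (TUS 1) (@scal1 K T)))|exact: TUM].
Qed.

Lemma sdT_V_lin c x y : TV (c *: x + y) = c%:S * TV x + TV y.
Proof.
have pm := quot_pi_morph Trel.
rewrite -(alg_morS pm) -(alg_morM pm) -(alg_morD pm); apply: sdT_relE.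
exact: sdT_rel_linV.
Qed.

Lemma sdT_act a x : TU (uea_in br a) * TV x - TV x * TU (uea_in br a) = TV (act a x).
Proof.
have pm := quot_pi_morph Trel.
rewrite -!(alg_morM pm) -(alg_morB pm); apply: sdT_relE.
exact: sdT_rel_act.
Qed.

Lemma sdT_universal (B : pzAlgType K) (hU : U -> B) (hV : V -> B) :
  alg_morphism hU -> (forall c x y, hV (c *: x + y) = c%:S * hV x + hV y) ->
  (forall a x, hU (uea_in br a) * hV x - hV x * hU (uea_in br a) = hV (act a x)) ->
  exists f : T -> B, [/\ alg_morphism f, forall u, f (TU u) = hU u &
    forall x, f (TV x) = hV x].
Proof.
move=> Um hVlin hact.
pose h (z : (U + V)%type) : B := match z with inl u => hU u | inr x => hV x end.
have [f [fm fE]] := free_universal h.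
have [|f' [f'm f'E]] := quot_universal (S := Trel) fm; last first.
  by exists f'; split=> // [u|x]; rewrite /sdT_U /sdT_V f'E fE.
move=> _ [c|u v|u v|c x y|a x].
- by rewrite (alg_morB fm) fE (alg_morS fm) /= (alg_morS Um) subrr.
- rewrite (alg_morB fm) fE (alg_morD fm) /=.
  by rewrite (fE (inl u)) (fE (inl v)) (alg_morD Um) subrr.
- rewrite (alg_morB fm) fE (alg_morM fm) /=.
  by rewrite (fE (inl u)) (fE (inl v)) (alg_morM Um) subrr.
- by rewrite (alg_mor_lin fm) !fE /= hVlin subrr.
- by rewrite (alg_mor_comm fm) !fE /= hact subrr.
Qed.
End SemidirectProduct.

Section PBWJacobi.
Context {K : comNzRingType} {g : lmodType K} {N : nat}.
Local Notation V := 'cV[K]_N.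
Context {br : g -> g -> g} {act : g -> V -> V}.
Hypothesis act_linl : forall c a b x, act (c *: a + b) x = c *: act a x + act b x.
Hypothesis act_linr : forall a c x y, act a (c *: x + y) = c *: act a x + act a y.
Hypothesis act_br : forall a b x,
  act (br a b) x = act a (act b x) - act b (act a x).
Local Notation U := (uea br).
Local Notation TU := (@sdT_U K g V br act).
Local Notation TV := (sdT_V br act).
Local Notation E := (oper U (seq 'I_N)).

Lemma sdT_oper_ex : exists opT : sdT br act -> E, [/\ alg_morphism opT,
  forall a, opT (TU (uea_in br a)) = @opa K g N act U (uea_in br) a &
  forall x, opT (TV x) = @opx K N U x].
Proof.
have [opU [Um UE]] : exists opU : U -> E, alg_morphism opU /\
    forall a, opU (uea_in br a) = @opa K g N act U (uea_in br) a.
  apply: uea_universal => [c a b|a b].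
    by apply: opa_lin => //; exact: uea_in_linear.
  by apply: opa_br => //; exact: uea_in_br.
have [|||opT [Tm TUE TVE]] := @sdT_universal _ _ _ br act _ opU (@opx K N U) => //.
- exact: opx_lin.
- by move=> a x; rewrite UE; exact: opa_opx.
by exists opT; split=> // a; rewrite TUE UE.
Qed.

Variable kappa : V -> V -> U.
Hypotheses (kappa_alt : alternating kappa) (kappa_equiv : equivariant act kappa).

Theorem PBW_jacobi : PBW act kappa <->
  forall x y z, cyclic_comm (TU := TU) (TV := TV) kappa x y z = 0.
Proof.
have [opT [Tm opT_in opT_V]] := sdT_oper_ex.
case: kappa_alt => kappa_linr kappa_linl kappa_alt0.
have HSP t : Hk_rel kappa t <-> exists x y, t = defect (TU := TU) (TV := TV) kappa x y.
  by split=> [[x y]|[x [y ->]]]; [exists x, y|constructor].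
have DP n h : @Hk_deg K g V br act kappa n h <->
  (n = 0%N /\ exists u, h = quot_pi (Hk_rel kappa) (TU u)) \/
  (n = 1%N /\ exists x, h = quot_pi (Hk_rel kappa) (TV x)).
  split=> [h0|[[-> [u ->]]|[-> [v ->]]]]; [|exact: Hk_deg_U|exact: Hk_deg_V].
  by case: h0 => [u|v]; [left; split=> //; exists u|right; split=> //; exists v].
have SSP t : @sdS_rel K g V br act t <-> exists x y, t = TV x * TV y - TV y * TV x.
  by split=> [[x y]|[x [y ->]]]; [exists x, y|constructor].
have kappa_linl' y c x x' : kappa (c *: x + x') y = c%:S * kappa x y + kappa x' y.
  exact: kappa_linl.
have := natural_bijective_iff (@uea_ind K g br) sdT_U_morph sdT_V_lin sdT_act
  (@sdT_ind K g V br act) Tm opT_in opT_V kappa_linl' kappa_linr kappa_alt0 kappa_equiv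
  HSP DP SSP (@sdT_universal K g V br act) => <-.
split=> -[f [[fm fU fV] fb]]; exists f; (split=> //); split=> // [u|x].
- exact: (etrans (fU u) (esym (grcE (Hk_fil_U act kappa u)))).
- exact: (etrans (fV x) (esym (grcE (Hk_fil_V act kappa x)))).
- exact: (etrans (fU u) (grcE (Hk_fil_U act kappa u))).
- exact: (etrans (fV x) (grcE (Hk_fil_V act kappa x))).
Qed.
End PBWJacobi.

(** * Symmetrization *)

Section WordAverage.
Context {K : numFieldType} {A : pzAlgType K} {I : eqType}.
Variable y : I -> A.

Definition word_avg (w : seq I) : A :=
  (((size w)`!)%:R^-1 : K)%:S
  * \sum_(s : 'S_(size w)) \prod_(k < size w) y (tnth (in_tuple w) (s k)).

Lemma word_avg_tuple k (t : k.-tuple I) :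
  word_avg t = ((k`!)%:R^-1 : K)%:S * \sum_(s : 'S_k) \prod_(i < k) y (tnth t (s i)).
Proof.
case: t => w sw; have Ek := eqP sw; subst k.
by have -> : Tuple sw = in_tuple w by exact: val_inj.
Qed.

Lemma word_avg_perm (w w' : seq I) : perm_eq w w' -> word_avg w = word_avg w'.
Proof.
move=> ww'; have [s0 Es0] := tuple_permP (ww' : perm_eq w (in_tuple w')).
rewrite Es0 !word_avg_tuple -[word_avg w']/(word_avg (in_tuple w')) word_avg_tuple.
congr (_ * _); rewrite [RHS](reindex_inj (mulIg s0)).
apply: eq_bigr => s _; apply: eq_bigr => i _.
by rewrite tnth_mktuple permM.
Qed.
End WordAverage.

Section Symmetrization.
Context {K : numFieldType} {N : nat}.
Local Notation so_dim := #|{: so_coord N}|.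
Local Notation so_poly := {mpoly K[so_dim]}.
Context {A : pzAlgType K} (y : 'I_so_dim -> A).

Definition symm (p : so_poly) : A :=
  \sum_(m <- msupp p) (p@_m)%:S * word_avg y (mon_word m).

Lemma symm_bounded (s : seq 'X_{1..so_dim}) p : uniq s -> {subset msupp p <= s} ->
  symm p = \sum_(m <- s) (p@_m)%:S * word_avg y (mon_word m).
Proof.
move=> us ps; rewrite [RHS](bigID (mem (msupp p))) /= [X in _ + X]big1 => [|m].
  rewrite addr0 -big_filter; apply: perm_big; apply: uniq_perm.
  - exact: msupp_uniq.
  - exact: filter_uniq.
  - by move=> m; rewrite mem_filter; case: (boolP (m \in msupp p)) => //= /ps ->.
by move/memN_msupp_eq0 ->; rewrite scal0 mul0r.
Qed.

Lemma symm_lin c p q : symm (c *: p + q) = c%:S * symm p + symm q.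
Proof.
pose s := undup (msupp p ++ msupp q ++ msupp (c *: p + q)).
have us : uniq s by exact: undup_uniq.
rewrite !(@symm_bounded s) //;
  try by move=> m; rewrite mem_undup !mem_cat => ->; rewrite ?orbT.
rewrite mulr_sumr -big_split; apply: eq_bigr => m _ /=.
by rewrite mcoeffD mcoeffZ scalD scalM mulrDl mulrA.
Qed.

Lemma symmD p q : symm (p + q) = symm p + symm q.
Proof. by rewrite -[p]scale1r symm_lin scal1 mul1r scale1r. Qed.
Lemma symm0 : symm 0 = 0.
Proof. by rewrite /symm msupp0 big_nil. Qed.
Lemma symmZ c p : symm (c *: p) = c%:S * symm p.
Proof. by rewrite -[c *: p]addr0 symm_lin symm0 addr0. Qed.
Lemma symmB p q : symm (p - q) = symm p - symm q.
Proof. by rewrite -scaleN1r symmD symmZ scalN scal1 mulN1r. Qed.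
Lemma symm_sum J (r : seq J) (P : pred J) F :
  symm (\sum_(i <- r | P i) F i) = \sum_(i <- r | P i) symm (F i).
Proof. by apply: (big_morph symm) => [p q|]; [exact: symmD|exact: symm0]. Qed.

Lemma symm_monom m : symm 'X_[m] = word_avg y (mon_word m).
Proof. by rewrite /symm msuppX big_seq1 mcoeffX eqxx scal1 mul1r. Qed.

Lemma count_mon_word (m : 'X_{1..so_dim}) k : count_mem k (mon_word m) = m k.
Proof.
rewrite /mon_word count_flatten -map_comp sumnE big_map big_enum /=.
rewrite (bigD1 k) //= big1 ?addn0 => [|j jk].
  by rewrite count_nseq /= eqxx mul1n.
by rewrite count_nseq /= (negPf jk).
Qed.

Lemma mon_wordP (w : seq 'I_so_dim) : perm_eq w (mon_word (\sum_(k <- w) U_(k))%MM).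
Proof.
apply/allP => k _ /=; rewrite count_mon_word mnm_sumE -sum1_count big_mkcond.
by apply/eqP/eq_bigr => j _; rewrite mnm1E /=; case: eqP.
Qed.

Lemma prod_mpolyX (w : seq 'I_so_dim) :
  \prod_(k <- w) 'X_k = 'X_[(\sum_(k <- w) U_(k))%MM] :> so_poly.
Proof.
elim: w => [|k w IH]; first by rewrite !big_nil mpolyX0.
by rewrite !big_cons mpolyXD IH.
Qed.

Lemma sum_mon_word (m : 'X_{1..so_dim}) : (\sum_(k <- mon_word m) U_(k))%MM = m.
Proof.
apply/mnmP => k; rewrite mnm_sumE -[RHS]count_mon_word -sum1_count [RHS]big_mkcond.
by apply: eq_bigr => j _; rewrite mnm1E /=; case: eqP.
Qed.

Lemma size_mon_word (m : 'X_{1..so_dim}) : size (mon_word m) = mdeg m.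
Proof.
rewrite -[in RHS](sum_mon_word m); elim: (mon_word m) => [|k w IH].
  by rewrite big_nil mdeg0.
by rewrite big_cons mdegD mdeg1 /= IH.
Qed.

Lemma symm_word (w : seq 'I_so_dim) : symm (\prod_(k <- w) 'X_k) = word_avg y w.
Proof. by rewrite (word_avg_perm _ (mon_wordP w)) -symm_monom prod_mpolyX. Qed.

(** This frees symmetrization from the coordinates in which it is defined: both sides are expanded
    multilinearly, and the sum over choices [f] of one coordinate per factor is reindexed by the
    permutation [s]. *)
Lemma symm_prod_lin k (l : 'I_k -> 'I_so_dim -> K) :
  symm (\prod_(i < k) \sum_j l i j *: 'X_j)
  = ((k`!)%:R^-1 : K)%:S * \sum_(s : 'S_k) \prod_(i < k) \sum_j (l (s i) j)%:S * y j.
Proof.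
rewrite bigA_distr_bigA /= symm_sum.
have pull (c : 'I_k -> K) (b : 'I_k -> A) :
    \prod_i ((c i)%:S * b i) = (\prod_i c i)%:S * \prod_i b i.
  elim/big_rec3: _ => [|i u v w _ ->]; first by rewrite scal1 mulr1.
  by rewrite scalM -!mulrA; congr (_ * _); rewrite mulrA -scalC mulrA.
transitivity (\sum_(f : {ffun 'I_k -> 'I_so_dim}) (\prod_i l i (f i))%:S *
   (((k`!)%:R^-1 : K)%:S * \sum_(s : 'S_k) \prod_(i < k) y (f (s i)))).
  apply: eq_bigr => f _; rewrite scaler_prod symmZ; congr (_ * _).
  have -> : \prod_i 'X_(f i) = \prod_(j <- [tuple f i | i < k]) 'X_j :> so_poly.
    by rewrite big_tuple; apply: eq_bigr => i _; rewrite tnth_mktuple.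
  rewrite symm_word word_avg_tuple; congr (_ * _); apply: eq_bigr => s _.
  by apply: eq_bigr => i _; rewrite tnth_mktuple.
under eq_bigr do rewrite mulrA scalC -mulrA.
rewrite -mulr_sumr; congr (_ * _).
under eq_bigr do rewrite mulr_sumr.
rewrite exchange_big /=; apply: eq_bigr => s _.
rewrite bigA_distr_bigA /=.
rewrite [RHS](reindex_inj (h := fun f : {ffun 'I_k -> 'I_so_dim} => [ffun i => f (s i)])).
  apply: eq_bigr => f _; rewrite pull; congr (_%:S * _).
    rewrite (reindex_inj (@perm_inj _ s)).
    by apply: eq_bigr => i _; rewrite ffunE.
  by apply: eq_bigr => i _; rewrite ffunE.
move=> f h /ffunP fh; apply/ffunP => i.
by have := fh (s^-1%g i); rewrite !ffunE permKV.
Qed.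

End Symmetrization.

(** * Linear forms on so_N and polarization *)

Section LinearForms.
Context {K : numFieldType} {N : nat}.
Local Notation so_dim := #|{: so_coord N}|.
Local Notation so_poly := {mpoly K[so_dim]}.
Local Notation so := (so K N).

Definition so_index (k : 'I_so_dim) : 'I_N * 'I_N := val (enum_val k).

Lemma so_index_lt k : ((so_index k).1 < (so_index k).2)%N.
Proof. exact: (valP (enum_val k)). Qed.

Lemma so_index_inj : injective so_index.
Proof. by move=> k l /val_inj/enum_val_inj. Qed.

Lemma so_index_surj (i j : 'I_N) : (i < j)%N -> {k | so_index k = (i, j)}.
Proof.
move=> lt_ij; exists (enum_rank (exist _ (i, j) lt_ij : so_coord N)).
by rewrite /so_index enum_rankK.
Qed.

Definition so_basis k : so := so_dual K (so_index k).1 (so_index k).2.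

(** For i < j the matrix [so_dual K i j] has entry - 1/2 at (i, j), which the factor - 2
    compensates. *)
Definition so_coef (b : 'M[K]_N) k : K := - 2 * b (so_index k).1 (so_index k).2.

Lemma so_mx_skew (b : so) i j : so_mx b i j = - so_mx b j i.
Proof. by have /matrixP/(_ j i) := so_tr b; rewrite !mxE. Qed.

Lemma so_dual_mxE (i j k l : 'I_N) : so_mx (so_dual K i j) k l =
  2^-1 * (((k == j) && (l == i))%:R - ((k == i) && (l == j))%:R).
Proof. by rewrite /= !mxE. Qed.

Lemma so_basis_coef b i j : \sum_k so_coef (so_mx b) k * so_mx (so_basis k) i j = so_mx b i j.
Proof.
have lt_case (l m : 'I_N) : (l < m)%N ->
    \sum_k so_coef (so_mx b) k * so_mx (so_basis k) l m = so_mx b l m.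
  move=> lm; have [k0 Ek0] := so_index_surj lm.
  rewrite (bigD1 k0) //= big1 => [|k kk0].
    rewrite so_dual_mxE /so_coef Ek0 /= !eqxx.
    have -> : (l == m) = false by apply/negbTE; rewrite neq_ltn lm.
    by rewrite /=; field.
  rewrite so_dual_mxE; have -> : (l == (so_index k).1) && (m == (so_index k).2) = false.
    apply/negP => /andP[/eqP El /eqP Em]; move/eqP: kk0; apply; apply: so_index_inj.
    by rewrite Ek0 El Em -surjective_pairing.
  case: andP => [[/eqP El /eqP Em]|_]; last by rewrite subrr !mulr0.
  by have := so_index_lt k; rewrite -El -Em ltnNge ltnW.
case: (ltngtP i j) => [/lt_case //|ji|/ord_inj ->].
  rewrite so_mx_skew -lt_case // -sumrN; apply: eq_bigr => k _.
  by rewrite so_mx_skew mulrN.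
have -> : so_mx b j j = 0.
  apply/eqP; have := so_mx_skew b j j => /eqP; rewrite -addr_eq0 -mulr2n.
  by rewrite mulrn_eq0.
apply: big1 => k _; have -> : so_mx (so_basis k) j j = 0; last by rewrite mulr0.
by rewrite so_dual_mxE andbC subrr mulr0.
Qed.

Lemma so_basisE (b : so) : b = \sum_k so_coef (so_mx b) k *: so_basis k.
Proof.
apply/val_inj/matrixP => i j /=.
rewrite -so_basis_coef.
have -> : so_mx (\sum_k so_coef (so_mx b) k *: so_basis k)
    = \sum_k so_coef (so_mx b) k *: so_mx (so_basis k).
  by rewrite -[so_mx _]/(val _) raddf_sum.
by rewrite summxE; apply: eq_bigr => k _; rewrite [RHS]mxE.
Qed.

(** The element [b] inside S(so_N); as a function on so_N it is A |-> tr(A b), see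
    [lin_form_eval]. *)
Definition lin_form (b : so) : so_poly := \sum_k so_coef (so_mx b) k *: 'X_k.

Lemma so_coef_lin c (a b : 'M[K]_N) k :
  so_coef (c *: a + b) k = c * so_coef a k + so_coef b k.
Proof. by rewrite /so_coef !mxE mulrDr mulrCA. Qed.

Lemma lin_form_lin c a b : lin_form (c *: a + b) = c *: lin_form a + lin_form b.
Proof.
rewrite /lin_form scaler_sumr -big_split; apply: eq_bigr => k _.
by rewrite -[so_mx _]/(c *: so_mx a + so_mx b) so_coef_lin scalerDl scalerA.
Qed.

Lemma so_coef_basis k l : so_coef (so_mx (so_basis k)) l = (k == l)%:R.
Proof.
rewrite /so_coef so_dual_mxE; case: (eqVneq k l) => [->|kl].
  rewrite !eqxx.
  have -> : ((so_index l).1 == (so_index l).2) = false by apply/negbTE; rewrite neq_ltn so_index_lt.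
  by rewrite /=; field.
have -> : ((so_index l).1 == (so_index k).1) && ((so_index l).2 == (so_index k).2) = false.
  apply/negP => /andP[/eqP El /eqP Em]; move/eqP: kl; apply; apply: so_index_inj.
  by rewrite [LHS]surjective_pairing -El -Em -surjective_pairing.
case: andP => [[/eqP El /eqP Em]|_]; last by rewrite subrr !mulr0.
by have := so_index_lt k; rewrite -El -Em ltnNge ltnW ?so_index_lt.
Qed.

Lemma lin_form_basis k : lin_form (so_basis k) = 'X_k.
Proof.
rewrite /lin_form (bigD1 k) //= so_coef_basis eqxx scale1r big1 ?addr0 // => l lk.
by rewrite so_coef_basis eq_sym (negPf lk) scale0r.
Qed.

Definition lin_closed (P : so_poly -> Prop) :=
  P 0 /\ forall c p q, P p -> P q -> P (c *: p + q).

Lemma lin_closed_sum P J (r : seq J) (Q : pred J) (c : J -> K) (F : J -> so_poly) :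
  lin_closed P -> (forall j, Q j -> P (F j)) -> P (\sum_(j <- r | Q j) c j *: F j).
Proof.
move=> [P0 PD] PF; elim: r => [|j r IH]; first by rewrite big_nil.
by rewrite big_cons; case: ifP => // Qj; apply: PD => //; exact: PF.
Qed.

(** Replacing t by 2 t and subtracting 2^n times the original curve removes the top coefficient and
    multiplies the others by the nonzero numbers 2^i - 2^n. Induction then gives the lower
    coefficients, and t = 1 the top one. *)
Lemma curve_coef P n (v : nat -> so_poly) : lin_closed P ->
  (forall t : K, P (\sum_(i < n) t ^+ i *: v i)) -> forall i, (i < n)%N -> P (v i).
Proof.
move=> [P0 PD]; elim: n v => [//|n IH] v Pv.
have PZ c p : P p -> P (c *: p) by move=> Pp; rewrite -[_ *: p]addr0; exact: PD.
have Plow i : (i < n)%N -> P (v i).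
  move=> lt_in; have nz : (2 : K) ^+ i - 2 ^+ n != 0.
    by rewrite subr_eq0 -!natrX eqr_nat eqn_exp2l // neq_ltn lt_in.
  rewrite -[v i](scalerK nz); apply/PZ.
  apply: (IH (fun i => ((2 : K) ^+ i - 2 ^+ n) *: v i)) => // t.
  have -> : \sum_(i < n) t ^+ i *: (((2 : K) ^+ i - 2 ^+ n) *: v i) =
     (- 2 ^+ n) *: \sum_(i < n.+1) t ^+ i *: v i + \sum_(i < n.+1) (2 * t) ^+ i *: v i.
    rewrite scaler_sumr -big_split big_ord_recr /= exprMn !scalerA -scalerDl.
    rewrite mulNr addNr scale0r addr0; apply: eq_bigr => k _.
    by rewrite !scalerA -scalerDl exprMn -mulrDl mulrC (addrC (- _)).
  exact: PD.
move=> i; rewrite ltnS leq_eqVlt => /orP[/eqP->|]; last exact: Plow.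
have := Pv 1; rewrite big_ord_recr /= expr1n scale1r => Pn.
rewrite -[v n](addKr (\sum_(i < n) 1 ^+ i *: v i)) -scaleN1r.
apply: (PD) => //; apply: lin_closed_sum => [|k _]; first by split.
exact: Plow.
Qed.

(* Polarization: products of linear forms are combinations of powers of them. *)
Lemma lin_form_prod P k : lin_closed P -> (forall b, P (lin_form b ^+ k)) ->
  forall b : 'I_k -> so, P (\prod_(i < k) lin_form (b i)).
Proof.
elim: k P => [|k IH] P PC Pk b; first by rewrite big_ord0 -(expr0 (lin_form 0)).
rewrite big_ord_recl; set a := b ord0.
apply: (IH (fun p => P (lin_form a * p))) => [|c].
  case: PC => P0 PD; split=> [|c p q Pp Pq]; first by rewrite mulr0.
  by rewrite mulrDr -scalerAr; exact: PD.
(* The coefficient of t in (t a + c)^(k+1) is (k+1) a c^k, hence the use of [curve_coef] at index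
   1. *)
have /(_ 1%N isT) : forall i, (i < k.+2)%N ->
    P ('C(k.+1, i)%:R *: (lin_form c ^+ (k.+1 - i) * lin_form a ^+ i)).
  apply: curve_coef => // t.
  have := Pk (t *: a + c); rewrite lin_form_lin addrC exprDn.
  congr P; apply: eq_bigr => i _.
  by rewrite exprZn -scalerAr scaler_nat scalerMnr.
rewrite bin1 subn1 /= expr1 => Pka; case: PC => P0 PD.
have nz : (k.+1%:R : K) != 0 by rewrite pnatr_eq0.
rewrite mulrC -[_ * _](scalerK nz) -[_ *: _]addr0; exact: PD.
Qed.

Lemma lin_form_ind P m : lin_closed P ->
  (forall b k, (k < m)%N -> P (lin_form b ^+ k)) ->
  forall p, (msize p <= m)%N -> P p.
Proof.
move=> PC Pk p pm; rewrite [p]mpolyE big_seq.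
apply: lin_closed_sum => // mn mnp.
have mnm : (mdeg mn < m)%N := leq_trans (msize_mdeg_lt mnp) pm.
rewrite -(sum_mon_word mn) -prod_mpolyX big_tnth.
under eq_bigr do rewrite -lin_form_basis.
apply: lin_form_prod => // b; apply: Pk; by rewrite size_mon_word.
Qed.
End LinearForms.

(** * Derivations of S(so_N) and commutation with V *)

Section DirectionalDerivative.
Context {R : comNzRingType} {n : nat}.
Implicit Types (v : 'I_n -> mpoly n R) (p q : mpoly n R).

(** The values [v k] are polynomials, so that this covers both derivatives in a constant direction
    and the adjoint action [ad_deriv]. *)
Definition dirderiv v p : mpoly n R := \sum_k v k * p^`M(k).

Lemma dirderiv_lin v c p q : dirderiv v (c *: p + q) = c *: dirderiv v p + dirderiv v q.
Proof.
rewrite /dirderiv scaler_sumr -big_split; apply: eq_bigr => k _ /=.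
by rewrite mderivD mderivZ mulrDr -scalerAr.
Qed.

Lemma dirderivD v p q : dirderiv v (p + q) = dirderiv v p + dirderiv v q.
Proof. by rewrite -[p]scale1r dirderiv_lin !scale1r. Qed.
Lemma dirderivC v c : dirderiv v c%:MP = 0.
Proof. by apply: big1 => k _; rewrite mderivC mulr0. Qed.
Lemma dirderiv0 v : dirderiv v 0 = 0.
Proof. by rewrite -mpolyC0 dirderivC. Qed.
Lemma dirderivZ v c p : dirderiv v (c *: p) = c *: dirderiv v p.
Proof. by rewrite -[c *: p]addr0 dirderiv_lin dirderiv0 addr0. Qed.
Lemma dirderivM v p q : dirderiv v (p * q) = dirderiv v p * q + p * dirderiv v q.
Proof.
rewrite /dirderiv mulr_suml mulr_sumr -big_split; apply: eq_bigr => k _ /=.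
by rewrite mderivM mulrDr !mulrA (mulrC p).
Qed.
Lemma dirderiv_sum v J (r : seq J) (P : pred J) F :
  dirderiv v (\sum_(i <- r | P i) F i) = \sum_(i <- r | P i) dirderiv v (F i).
Proof. by apply: (big_morph (dirderiv v)) => [p q|]; [exact: dirderivD|exact: dirderiv0]. Qed.
Lemma dirderivX v k : dirderiv v 'X_k = v k.
Proof.
rewrite /dirderiv (bigD1 k) //= big1 => [|l lk].
  rewrite mderivX mnm1E eqxx scale1r addr0.
  by have -> : (U_(k) - U_(k))%MM = 0%MM :> 'X_{1..n}; [apply/mnmP => l; rewrite mnmE mnm0E subnn|rewrite mpolyX0 mulr1].
by rewrite mderivX mnm1E eq_sym (negPf lk) scale0r mulr0.
Qed.
Lemma dirderiv_exp v p k : dirderiv v (p ^+ k) = (p ^+ k.-1 * dirderiv v p) *+ k.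
Proof.
elim: k => [|k IH]; first by rewrite expr0 -mpolyC1 dirderivC.
rewrite exprS dirderivM IH mulrC mulrS; congr (_ + _).
case: k {IH} => [|k]; first by rewrite !mulr0n mulr0.
by rewrite mulrnAr mulrA -exprS.
Qed.
End DirectionalDerivative.

Section ExponentialDerivation.
Context {K : numFieldType} {N : nat}.
Local Notation so_dim := #|{: so_coord N}|.
Local Notation so_poly := {mpoly K[so_dim]}.
Local Notation so := (so K N).
Implicit Types (p q : so_poly) (b : so) (P : 'I_N -> so_poly).

(** The derivation that sends the linear form of [b] to the matrix entry [b i j], see
    [so_deriv_pow]. *)
Definition so_deriv i j p : so_poly :=
  dirderiv (fun k => (so_mx (so_basis k : so) i j)%:MP) p.

Lemma so_deriv_lin i j c p q : so_deriv i j (c *: p + q) = c *: so_deriv i j p + so_deriv i j q.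
Proof. exact: dirderiv_lin. Qed.
Lemma so_derivZ i j c p : so_deriv i j (c *: p) = c *: so_deriv i j p.
Proof. exact: dirderivZ. Qed.

Lemma so_deriv_pow i j b k :
  so_deriv i j (lin_form b ^+ k) = (k%:R * so_mx b i j) *: lin_form b ^+ k.-1.
Proof.
rewrite /so_deriv dirderiv_exp -mul_mpolyC.
have -> : dirderiv (fun k => (so_mx (so_basis k : so) i j)%:MP) (lin_form b) = (so_mx b i j)%:MP.
  rewrite /lin_form dirderiv_sum -so_basis_coef raddf_sum; apply: eq_bigr => l _ /=.
  by rewrite dirderivZ dirderivX -mul_mpolyC -mpolyCM.
by rewrite mulrC -mulrnAl; congr (_ * _); rewrite mpolyCM mpolyC_nat mulr_natl.
Qed.

(** On the polynomial vector b^n z it gives n b^(n-1) b(z): one factor b is spent by acting on z.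
    Its exponential therefore describes how b^n is moved past z in the semidirect product. *)
Definition vec_deriv P : 'I_N -> so_poly := fun i => \sum_j so_deriv i j (P j).

Definition exp_deriv m P : 'I_N -> so_poly := fun i =>
  \sum_(k < m) ((k`!)%:R^-1 : K) *: iter k vec_deriv P i.

Lemma vec_deriv_lin c P Q i :
  vec_deriv (fun j => c *: P j + Q j) i = c *: vec_deriv P i + vec_deriv Q i.
Proof.
rewrite /vec_deriv scaler_sumr -big_split; apply: eq_bigr => j _.
exact: so_deriv_lin.
Qed.

Lemma eq_vec_deriv P Q : P =1 Q -> vec_deriv P =1 vec_deriv Q.
Proof. by move=> PQ i; apply: eq_bigr => j _; rewrite PQ. Qed.

Lemma iter_vec_deriv_lin k c P Q i :
  iter k vec_deriv (fun j => c *: P j + Q j) i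
  = c *: iter k vec_deriv P i + iter k vec_deriv Q i.
Proof.
elim: k i => [//|k IH] i; rewrite !iterS -vec_deriv_lin.
exact: eq_vec_deriv.
Qed.

Lemma eq_iter_vec_deriv k P Q : P =1 Q -> iter k vec_deriv P =1 iter k vec_deriv Q.
Proof. by move=> /funext ->. Qed.

Lemma exp_deriv_lin m c P Q i :
  exp_deriv m (fun j => c *: P j + Q j) i = c *: exp_deriv m P i + exp_deriv m Q i.
Proof.
rewrite /exp_deriv scaler_sumr -big_split; apply: eq_bigr => k _ /=.
by rewrite iter_vec_deriv_lin scalerDr !scalerA mulrC.
Qed.

Lemma iter_vec_deriv_pow k n b (z : 'cV[K]_N) i :
  iter k vec_deriv (fun j => z j 0 *: lin_form b ^+ n) i
  = ((n ^_ k)%:R * iter k (so_act b) z i 0) *: lin_form b ^+ (n - k).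
Proof.
elim: k i => [|k IH] i; first by rewrite /= ffactn0 mul1r subn0.
rewrite !iterS.
rewrite (eq_vec_deriv (Q := fun j => ((n ^_ k)%:R * iter k (so_act b) z j 0) *: lin_form b ^+ (n - k))) //.
rewrite {1}/so_act mxE mulr_sumr scaler_suml; apply: eq_bigr => j _.
rewrite so_derivZ so_deriv_pow scalerA -subnS; congr (_ *: _).
by rewrite ffactnSr natrM; ring.
Qed.

Lemma msize_mderiv p k : (msize p^`M(k) <= (msize p).-1)%N.
Proof.
rewrite msizeE; apply/bigmax_leqP_seq => m mp _.
have : (m + U_(k))%MM \in msupp p.
  move: mp; rewrite !mcoeff_msupp mcoeff_deriv; apply: contraNN => /eqP ->.
  by rewrite mul0rn.
by move/msize_mdeg_lt; rewrite mdegD mdeg1 addn1; case: (msize p).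
Qed.

Lemma msize_sum_le J (r : seq J) (Q : pred J) (F : J -> so_poly) s :
  (forall j, Q j -> (msize (F j) <= s)%N) -> (msize (\sum_(j <- r | Q j) F j)%R <= s)%N.
Proof.
move=> Fs; elim/big_ind: _ => [|p q ps qs|//]; first by rewrite msize0.
by rewrite (leq_trans (msizeD_le _ _)) // geq_max ps.
Qed.

Lemma msize_so_deriv i j p : (msize (so_deriv i j p) <= (msize p).-1)%N.
Proof.
apply: msize_sum_le => k _; rewrite mul_mpolyC.
exact: leq_trans (msizeZ_le _ _) (msize_mderiv _ _).
Qed.

Lemma msize_vec_deriv P s : (forall i, (msize (P i) <= s)%N) ->
  forall i, (msize (vec_deriv P i) <= s.-1)%N.
Proof.
move=> Ps i; apply: msize_sum_le => j _; apply: leq_trans (msize_so_deriv _ _ _) _.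
by have := Ps j; case: (msize _) => [|n]; case: (s).
Qed.

Lemma msize_iter_vec_deriv k P s : (forall i, (msize (P i) <= s)%N) ->
  forall i, (msize (iter k vec_deriv P i) <= s - k)%N.
Proof.
move=> Ps; elim: k => [|k IH] i; first by rewrite subn0.
by rewrite iterS subnS; apply: msize_vec_deriv.
Qed.

(* exp(D) - 1 = (1 + D/2 + ..) D, and 1 + D/2 + .. is injective since D lowers degrees. *)
Lemma exp_deriv_fix m P : (1 < m)%N ->
  (exp_deriv m P =1 P) <-> (vec_deriv P =1 fun=> 0).
Proof.
case: m => [|[|m]] // _.
have E i : exp_deriv m.+2 P i = P i + (vec_deriv P i +
    \sum_(k < m) ((k.+2`!)%:R^-1 : K) *: iter k.+1 vec_deriv (vec_deriv P) i).
  rewrite /exp_deriv 2!big_ord_recl /= invr1 !scale1r; congr (_ + (_ + _)).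
  by apply: eq_bigr => k _; rewrite /bump /= !add1n -iterSr.
have iter0 k : iter k vec_deriv (fun=> 0) =1 fun=> 0.
  elim: k => [//|k IH] i; rewrite iterS (eq_vec_deriv IH).
  by apply: big1 => j _; exact: dirderiv0.
split=> [Efix|D0 i]; last first.
  rewrite E D0 add0r big1 ?addr0 // => k _.
  by rewrite (eq_iter_vec_deriv _ D0) iter0 scaler0.
have X0 i : vec_deriv P i = - \sum_(k < m) ((k.+2`!)%:R^-1 : K) *: iter k.+1 vec_deriv (vec_deriv P) i.
  apply/eqP; rewrite -addr_eq0; apply/eqP; apply: (addrI (P i)).
  by rewrite addr0 -E.
have [s Ps] : exists s, forall i, (msize (vec_deriv P i) <= s)%N.
  by exists (\max_i msize (vec_deriv P i)) => i; exact: leq_bigmax.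
suff: forall i, (msize (vec_deriv P i) <= 0)%N.
  by move=> H i; apply/eqP; rewrite -msize_poly_eq0 -leqn0.
elim: s Ps => [//|s IH] Ps; apply: IH => i.
rewrite X0 msizeN; apply: msize_sum_le => k _; apply: leq_trans (msizeZ_le _ _) _.
apply: leq_trans (msize_iter_vec_deriv _ Ps _) _.
by rewrite subSS leq_subr.
Qed.
End ExponentialDerivation.

Section SymmetrizationAction.
Context {K : numFieldType} {N : nat}.
Local Notation so_dim := #|{: so_coord N}|.
Local Notation so_poly := (mpoly so_dim K).
Local Notation so := (so K N).
Local Notation V := 'cV[K]_N.
Context {U : pzAlgType K} {uin : so -> U}.
Hypothesis uin_lin : forall c a b, uin (c *: a + b) = c%:S * uin a + uin b.
Local Notation symU := (symm (fun k => uin (so_basis k))).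

Lemma uin_sum J (r : seq J) (c : J -> K) (b : J -> so) :
  uin (\sum_(j <- r) c j *: b j) = \sum_(j <- r) (c j)%:S * uin (b j).
Proof.
elim: r => [|j r IH]; last by rewrite !big_cons uin_lin IH.
rewrite !big_nil; have := uin_lin (-1) 0 0.
by rewrite scaler0 addr0 scalN scal1 mulN1r addNr.
Qed.

Lemma symm_lin_form_prod k (b : 'I_k -> so) :
  symU (\prod_(i < k) lin_form (b i))
  = ((k`!)%:R^-1 : K)%:S * \sum_(s : 'S_k) \prod_(i < k) uin (b (s i)).
Proof.
rewrite /lin_form symm_prod_lin; congr (_ * _); apply: eq_bigr => s _.
by apply: eq_bigr => i _; rewrite [in RHS](so_basisE (b (s i))) uin_sum.
Qed.

Lemma symm_pow b k : symU (lin_form b ^+ k) = uin b ^+ k.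
Proof.
have -> : lin_form b ^+ k = \prod_(i < k) lin_form b.
  by rewrite prodr_const card_ord.
rewrite symm_lin_form_prod.
under eq_bigr do rewrite prodr_const card_ord.
rewrite sumr_const; have -> : #|{: 'S_k}| = k`! by rewrite -card_Sn; apply: eq_card => s; rewrite inE.
rewrite -[uin b ^+ k *+ _]mulr_natl mulrA -scal_nat -scalM mulVf ?scal1 ?mul1r //.
by rewrite pnatr_eq0 -lt0n fact_gt0.
Qed.

Context {T : pzAlgType K} {TU : U -> T} {TV : V -> T}.
Hypothesis TU_morph : alg_morphism TU.
Hypothesis TV_lin : forall c x y, TV (c *: x + y) = c%:S * TV x + TV y.
Hypothesis T_act : forall a x,
  TU (uin a) * TV x - TV x * TU (uin a) = TV (so_act a x).

(** Left multiplication by b is the sum of two commuting operations, the action of b on the vector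
    and multiplication by b behind the vector, so the binomial theorem holds; the proof is Pascal's
    rule. *)
Lemma TU_pow_TV b n z : TU (uin b) ^+ n * TV z =
  \sum_(k < n.+1) (TV (iter k (so_act b) z) * TU (uin b) ^+ (n - k)) *+ 'C(n, k).
Proof.
elim: n => [|n IH]; first by rewrite big_ord1 /= !expr0 mul1r mulr1.
rewrite exprS -mulrA IH mulr_sumr.
pose G k := TV (iter k (so_act b) z) * TU (uin b) ^+ (n.+1 - k).
transitivity (\sum_(k < n.+1) G k *+ 'C(n, k) + \sum_(k < n.+1) G k.+1 *+ 'C(n, k)).
  rewrite -big_split; apply: eq_bigr => k _ /=; rewrite -mulrnDl mulrnAr; congr (_ *+ _).
  rewrite /G mulrA -(subrK (TV (iter k (so_act b) z) * TU (uin b)) (TU _ * _)) T_act.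
  have kn : (k <= n)%N by rewrite -ltnS.
  by rewrite mulrDl addrC -mulrA -exprS subSS subSn.
rewrite [RHS]big_ord_recl bin0 -/(G 0%N).
transitivity (G 0%N + \sum_(k < n.+1) G k.+1 *+ ('C(n, k.+1) + 'C(n, k))); last first.
  by congr (_ + _); apply: eq_bigr => k _; rewrite /bump /= add1n binS.
under [X in _ = _ + X]eq_bigr do rewrite mulrnDr.
rewrite big_split /= addrA; congr (_ + _).
by rewrite big_ord_recl bin0 [in RHS]big_ord_recr /= bin_small // mulr0n addr0.
Qed.

Definition vec_elt (P : 'I_N -> so_poly) : T := \sum_i TV (bas i) * TU (symU (P i)).

Lemma vec_elt_lin c P Q : vec_elt (fun i => c *: P i + Q i) = c%:S * vec_elt P + vec_elt Q.
Proof.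
rewrite /vec_elt mulr_sumr -big_split; apply: eq_bigr => i _ /=.
rewrite symm_lin (alg_morD TU_morph) (alg_morM TU_morph) (alg_morS TU_morph).
by rewrite mulrDr mulrA -scalC mulrA.
Qed.

Lemma vec_elt_vec (z : V) p : vec_elt (fun i => z i 0 *: p) = TV z * TU (symU p).
Proof.
rewrite /vec_elt (TV_E TV_lin z) mulr_suml; apply: eq_bigr => i _.
rewrite symmZ (alg_morM TU_morph) (alg_morS TU_morph).
by rewrite mulrA -scalC.
Qed.

Lemma vec_elt0 : vec_elt (fun=> 0) = 0.
Proof.
by rewrite /vec_elt big1 // => i _; rewrite symm0 (alg_mor0 TU_morph) mulr0.
Qed.

Lemma vec_elt_sum m (F : 'I_m -> 'I_N -> so_poly) :
  vec_elt (fun i => \sum_(k < m) F k i) = \sum_(k < m) vec_elt (F k).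
Proof.
rewrite /vec_elt exchange_big; apply: eq_bigr => i _ /=.
by rewrite symm_sum (alg_mor_sum TU_morph) mulr_sumr.
Qed.

(* For p = b^n this is b^n z = sum_k C(n, k) b^k(z) b^(n - k), since the
   polynomial vector b^n z satisfies D^k (b^n z) = n!/(n - k)! b^(n - k) b^k(z). *)
Lemma symm_TV m p (z : V) : (msize p <= m)%N ->
  TU (symU p) * TV z = vec_elt (exp_deriv m (fun j => z j 0 *: p)).
Proof.
move: p; apply: lin_form_ind => [|b n lt_nm].
  split=> [|c p q Hp Hq].
    rewrite symm0 (alg_mor0 TU_morph) mul0r.
    rewrite (_ : exp_deriv _ _ = fun=> 0) ?vec_elt0 //; apply/funext => i.
    have -> : (fun j : 'I_N => z j 0 *: 0) = (fun j => (-1) *: 0 + 0 :> so_poly).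
      by apply/funext => j; rewrite !scaler0 add0r.
    by rewrite exp_deriv_lin scaleN1r addNr.
  rewrite symm_lin (alg_morD TU_morph) (alg_morM TU_morph) (alg_morS TU_morph) mulrDl -mulrA.
  rewrite Hp Hq -vec_elt_lin; congr vec_elt; apply/funext => i.
  rewrite -exp_deriv_lin; congr exp_deriv; apply/funext => j.
  by rewrite scalerDr !scalerA mulrC.
rewrite symm_pow; have -> : TU (uin b ^+ n) = TU (uin b) ^+ n.
  elim: n {lt_nm} => [|n IH]; first by rewrite !expr0 (alg_mor1 TU_morph).
  by rewrite !exprS (alg_morM TU_morph) IH.
rewrite TU_pow_TV.
transitivity (\sum_(k < m) vec_elt (fun i => (('C(n, k))%:R * iter k (so_act b) z i 0) *: lin_form b ^+ (n - k))).
  rewrite (big_ord_widen m (fun k => (TV (iter k (so_act b) z) * TU (uin b) ^+ (n - k)) *+ 'C(n, k))) //.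
  rewrite big_mkcond; apply: eq_bigr => k _; case: ltnP => nk.
    rewrite (_ : (fun i => _) = fun i => ('C(n, k)%:R *: iter k (so_act b) z) i 0 *: lin_form b ^+ (n - k)).
      rewrite vec_elt_vec symm_pow; set x := iter _ _ _.
      rewrite -[_ *: x]addr0 TV_lin.
      have -> : TV 0 = 0 by have := TV_lin (-1) 0 0; rewrite scaler0 addr0 scalN scal1 mulN1r addNr.
      rewrite addr0 scal_nat -mulrA mulr_natl; congr (_ * _ *+ _).
      elim: (n - k)%N => [|l IH]; first by rewrite !expr0 (alg_mor1 TU_morph).
      by rewrite !exprS (alg_morM TU_morph) IH.
    by apply/funext => i; rewrite mxE.
  rewrite bin_small // (_ : (fun i => _) = fun=> 0) ?vec_elt0 //.
  by apply/funext => i; rewrite mul0r scale0r.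
rewrite -vec_elt_sum; congr vec_elt; apply/funext => i; apply: eq_bigr => k _.
rewrite iter_vec_deriv_pow scalerA mulrA; congr ((_ * _) *: _).
rewrite -bin_ffact natrM mulrC -mulrA mulfV ?mulr1 //.
by rewrite pnatr_eq0 -lt0n fact_gt0.
Qed.
End SymmetrizationAction.

(** * Equivariance and surjectivity of symmetrization *)

Lemma derivation_prod (A : pzRingType) (d : A -> A) k (x : 'I_k -> A) :
  d 1 = 0 -> (forall u v, d (u * v) = d u * v + u * d v) ->
  d (\prod_i x i) = \sum_j \prod_i (if i == j then d (x i) else x i).
Proof.
move=> d1 dM; elim: k x => [|k IH] x; first by rewrite !big_ord0 d1.
rewrite big_ord_recl dM IH [RHS]big_ord_recl big_ord_recl /=; congr (_ + _).
rewrite mulr_sumr; apply: eq_bigr => j _; rewrite big_ord_recl /=; congr (_ * _).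
Qed.

Section SymmetrizationInjective.
Context {K : numFieldType} {N : nat}.
Local Notation so_dim := #|{: so_coord N}|.
Local Notation so_poly := (mpoly so_dim K).
Local Notation so := (so K N).
Local Notation V := 'cV[K]_N.
Context {U : pzAlgType K} {uin : so -> U}.
Hypothesis uin_lin : forall c a b, uin (c *: a + b) = c%:S * uin a + uin b.
Hypothesis uin_br : forall a b, uin a * uin b - uin b * uin a = uin (so_br a b).
Hypothesis U_ind : forall P : U -> Prop,
  (forall c, P c%:S) -> (forall x, P (uin x)) ->
  (forall a b, P a -> P b -> P (a + b)) ->
  (forall a b, P a -> P b -> P (a * b)) -> forall a, P a.
Local Notation symU := (symm (fun k => uin (so_basis k))).

Lemma so_br_linr a c b b' : so_br a (c *: b + b') = c *: so_br a b + so_br a b' :> so.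
Proof.
apply/val_inj.
change (so_mx a *m (c *: so_mx b + so_mx b') - (c *: so_mx b + so_mx b') *m so_mx a
  = c *: (so_mx a *m so_mx b - so_mx b *m so_mx a)
    + (so_mx a *m so_mx b' - so_mx b' *m so_mx a)).
by rewrite mulmxDr mulmxDl -scalemxAr -scalemxAl scalerBr opprD addrACA.
Qed.

Definition ad_deriv (a : so) : so_poly -> so_poly :=
  dirderiv (fun k => lin_form (so_br a (so_basis k))).

Lemma lin_form_sum J (r : seq J) (c : J -> K) (b : J -> so) :
  lin_form (\sum_(j <- r) c j *: b j) = \sum_(j <- r) c j *: lin_form (b j).
Proof.
elim: r => [|j r IH]; last by rewrite !big_cons lin_form_lin IH.
rewrite !big_nil; have := lin_form_lin (-1) (0 : so) 0.
by rewrite scaler0 addr0 scaleN1r addNr.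
Qed.

Lemma so_br_sumr a J (r : seq J) (c : J -> K) (b : J -> so) :
  so_br a (\sum_(j <- r) c j *: b j) = \sum_(j <- r) c j *: so_br a (b j).
Proof.
elim: r => [|j r IH]; last by rewrite !big_cons so_br_linr IH.
rewrite !big_nil; have := so_br_linr a (-1) 0 0.
by rewrite scaler0 addr0 scaleN1r addNr.
Qed.

Lemma ad_deriv_lin_form a b : ad_deriv a (lin_form b) = lin_form (so_br a b).
Proof.
rewrite [in RHS](so_basisE b) so_br_sumr lin_form_sum /ad_deriv {1}/lin_form dirderiv_sum.
by apply: eq_bigr => k _; rewrite dirderivZ dirderivX.
Qed.

(** The commutator with [uin a] and [ad_deriv a] are both derivations and agree on linear forms. On
    a symmetrized product of linear forms each replaces one factor at a time, and averaging over
    permutations is compatible with that. *)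
Lemma symm_ad a p : uin a * symU p - symU p * uin a = symU (ad_deriv a p).
Proof.
elim/mpolyind: p => [|c m p _ _ IH].
  by rewrite /ad_deriv dirderiv0 symm0 mulr0 mul0r subrr.
have Hb k (b : 'I_k -> so) (q := \prod_i lin_form (b i)) :
    uin a * symU q - symU q * uin a = symU (ad_deriv a q).
  rewrite /q (@derivation_prod _ (ad_deriv a)); first last.
  - by move=> u v; exact: dirderivM.
  - by rewrite -mpolyC1; exact: dirderivC.
  rewrite symm_sum (symm_lin_form_prod uin_lin) mulrA -scalC -!mulrA -mulrBr.
  transitivity (\sum_j symU (\prod_i lin_form (if i == j then so_br a (b i) else b i))).
    under [RHS]eq_bigr do rewrite (symm_lin_form_prod uin_lin).
    rewrite -mulr_sumr; congr (_ * _).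
    rewrite mulr_sumr mulr_suml -sumrB exchange_big /=; apply: eq_bigr => s _.
    pose d (u : U) := uin a * u - u * uin a.
    rewrite -[LHS]/(d _) (@derivation_prod _ d); first last.
    - by move=> u v; rewrite /d mulrBl mulrBr !mulrA addrA subrK.
    - by rewrite /d mulr1 mul1r subrr.
    rewrite [RHS](reindex_inj (@perm_inj _ s)); apply: eq_bigr => j _.
    apply: eq_bigr => i _; rewrite (inj_eq perm_inj).
    by case: eqP => // _; rewrite /d uin_br.
  apply: eq_bigr => j _; congr symU; apply: eq_bigr => i _.
  by case: eqP => // _; rewrite ad_deriv_lin_form.
have Hm : uin a * symU 'X_[m] - symU 'X_[m] * uin a = symU (ad_deriv a 'X_[m]).
  have -> : 'X_[m] = \prod_i lin_form (so_basis (tnth (in_tuple (mon_word m)) i) : so).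
    rewrite -[m in LHS](sum_mon_word m) -prod_mpolyX big_tnth.
    by apply: eq_bigr => i _; rewrite lin_form_basis.
  exact: Hb.
have -> : ad_deriv a (c *: 'X_[m] + p) = c *: ad_deriv a 'X_[m] + ad_deriv a p.
  exact: dirderiv_lin.
rewrite !symm_lin mulrDr mulrDl opprD addrACA IH -Hm mulrBr !mulrA.
by rewrite (scalC c (uin a)).
Qed.

Inductive uspan (n : nat) : U -> Prop :=
| uspan0 : uspan n 0
| uspanD c (w : seq so) u : (size w <= n)%N -> uspan n u ->
    uspan n (c%:S * \prod_(b <- w) uin b + u).

Lemma uspan_add n u v : uspan n u -> uspan n v -> uspan n (u + v).
Proof.
by elim=> [|c w u' sw _ IH] Hv; [rewrite add0r|rewrite -addrA; apply: uspanD sw (IH Hv)].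
Qed.

Lemma uspan_word n (w : seq so) : (size w <= n)%N -> uspan n (\prod_(b <- w) uin b).
Proof.
move=> sw; have := uspanD 1 sw (uspan0 n); by rewrite scal1 mul1r addr0.
Qed.

Lemma uspan_scal n c u : uspan n u -> uspan n (c%:S * u).
Proof.
elim=> [|d w v sw _ IH]; first by rewrite mulr0; exact: uspan0.
by rewrite mulrDr mulrA -scalM; apply: uspanD sw IH.
Qed.

Lemma uspan_opp n u : uspan n u -> uspan n (- u).
Proof. by rewrite -mulN1r -scal1 -scalN; exact: uspan_scal. Qed.

Lemma uspan_sum n J (r : seq J) (F : J -> U) :
  (forall j, uspan n (F j)) -> uspan n (\sum_(j <- r) F j).
Proof.
move=> H; elim: r => [|j r IH]; rewrite ?big_nil ?big_cons; first exact: uspan0.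
exact: uspan_add.
Qed.

Lemma uspan_leq m n u : (m <= n)%N -> uspan m u -> uspan n u.
Proof.
move=> mn; elim=> [|c w v sw _ IH]; first exact: uspan0.
by apply: uspanD IH; exact: leq_trans mn.
Qed.

Lemma uspan_mull n a u : uspan n u -> uspan n.+1 (uin a * u).
Proof.
elim=> [|d w v sw _ IH]; first by rewrite mulr0; exact: uspan0.
rewrite mulrDr mulrA -scalC -mulrA; have := @uspanD n.+1 d (a :: w) _ sw IH.
by rewrite big_cons.
Qed.

Lemma uspan_all u : exists n, uspan n u.
Proof.
suff H : exists n, forall m v, uspan m v -> uspan (m + n) (u * v).
  have [n Hn] := H; exists (0 + n)%N; rewrite -[u]mulr1; apply: Hn.
  by have := @uspan_word 0 [::] isT; rewrite big_nil.
move: u; apply: U_ind => [c|a|u v [n Hn] [n' Hn']|u v [n Hn] [n' Hn']].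
- by exists 0%N => m v; rewrite addn0; exact: uspan_scal.
- by exists 1%N => m v; rewrite addn1; exact: uspan_mull.
- exists (n + n')%N => m w Hw; rewrite mulrDl; apply: uspan_add.
    by apply: uspan_leq (Hn _ _ Hw); rewrite leq_add2l leq_addr.
  by apply: uspan_leq (Hn' _ _ Hw); rewrite leq_add2l leq_addl.
- exists (n' + n)%N => m w Hw; rewrite -mulrA addnA.
  exact/Hn/Hn'.
Qed.

Lemma uspan_insert a (p q : seq so) :
  uspan (size (p ++ q)) (\prod_(b <- p ++ a :: q) uin b - \prod_(b <- a :: p ++ q) uin b).
Proof.
elim: p => [|c p IH]; first by rewrite subrr; exact: uspan0.
rewrite !cat_cons !big_cons /=; set P := \prod_(b <- p ++ a :: q) _.
have -> : uin c * P - uin a * (uin c * \prod_(b <- p ++ q) uin b) =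
   uin c * (P - \prod_(b <- a :: p ++ q) uin b) + \prod_(b <- so_br c a :: p ++ q) uin b.
  by rewrite !big_cons -uin_br mulrBr mulrBl !mulrA addrA subrK.
by apply: uspan_add; [exact: uspan_mull|exact: uspan_word].
Qed.

(** Exchanging two neighbouring factors costs a product in which they are replaced by their bracket,
    hence one factor fewer. *)
Lemma uspan_perm (w w' : seq so) : perm_eq w w' ->
  uspan (size w).-1 (\prod_(b <- w) uin b - \prod_(b <- w') uin b).
Proof.
elim: w w' => [|a w IH] w' ww'.
  have := perm_size ww'; case: w' {ww'} => // _; rewrite subrr; exact: uspan0.
have aw' : a \in w' by rewrite -(perm_mem ww') mem_head.
case/splitPr: aw' ww' => p q ww'.
have {}ww' : perm_eq w (p ++ q).
  by rewrite -(perm_cons a) (permPl ww') -[a :: q]/([:: a] ++ q) perm_catCA.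
have -> : \prod_(b <- a :: w) uin b - \prod_(b <- p ++ a :: q) uin b =
  uin a * (\prod_(b <- w) uin b - \prod_(b <- p ++ q) uin b)
  + - (\prod_(b <- p ++ a :: q) uin b - \prod_(b <- a :: p ++ q) uin b).
  by rewrite !big_cons mulrBr opprB addrA subrK.
apply: uspan_add; last first.
  by apply: uspan_opp; rewrite /= (perm_size ww'); exact: uspan_insert.
case: w IH ww' => [|c w] IH ww'.
  have := perm_size ww'; case: (p ++ q) => // _; rewrite subrr mulr0; exact: uspan0.
exact: (uspan_mull _ (IH _ ww')).
Qed.

(** A product in [U] differs from the average of its reorderings by shorter products. The average is
    the symmetrization of the product of the linear forms, and the induction takes care of the rest
    [r]. *)
Lemma symm_surj u : exists p, symU p = u.
Proof.
have [n Hn] := uspan_all u; elim: n u Hn => [|n IH] u.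
  elim=> [|c w v]; first by exists 0; rewrite symm0.
  rewrite leqn0 => /nilP -> _ [p <-]; exists (c *: lin_form (0 : so) ^+ 0 + p).
  by rewrite symm_lin (symm_pow uin_lin) expr0 big_nil.
elim=> [|c w v sw _ [p <-]]; first by exists 0; rewrite symm0.
suff [q Hq] : exists q, symU q = \prod_(b <- w) uin b.
  by exists (c *: q + p); rewrite symm_lin Hq.
pose k := size w; pose b (i : 'I_k) := tnth (in_tuple w) i.
pose r := ((k`!)%:R^-1 : K)%:S * \sum_(s : 'S_k) (\prod_(b <- w) uin b - \prod_(i < k) uin (b (s i))).
have [q Hq] : exists q, symU q = r.
  apply: IH; apply: uspan_scal; apply: uspan_sum => s.
  have -> : \prod_(i < k) uin (b (s i)) = \prod_(b <- [tuple b (s i) | i < k]) uin b.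
    by rewrite big_tuple; apply: eq_bigr => i _; rewrite tnth_mktuple.
  apply: (@uspan_leq (size w).-1); first by case: (size w) sw.
  apply: uspan_perm; rewrite perm_sym; apply/(tuple_permP (t := in_tuple w)).
  by exists s.
exists (q + \prod_(i < k) lin_form (b i)).
rewrite symmD Hq (symm_lin_form_prod uin_lin) /r -mulrDr -big_split /=.
under eq_bigr do rewrite subrK.
rewrite sumr_const; have -> : #|{: 'S_k}| = k`! by rewrite -card_Sn; apply: eq_card => s; rewrite inE.
rewrite -[X in _ * X = _]mulr_natl mulrA -scal_nat -scalM mulVf ?scal1 ?mul1r //.
by rewrite pnatr_eq0 -lt0n fact_gt0.
Qed.
End SymmetrizationInjective.

(** * Injectivity of symmetrization and the Jacobi identity for polynomials *)

Section SymmetrizationJacobi.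
Context {K : numFieldType} {N : nat}.
Local Notation so_dim := #|{: so_coord N}|.
Local Notation so_poly := (mpoly so_dim K).
Local Notation so := (so K N).
Local Notation V := 'cV[K]_N.

Lemma so_deriv_coord k (p : so_poly) :
  so_deriv (so_index k).1 (so_index k).2 p = (- 2^-1) *: p^`M(k).
Proof.
rewrite /so_deriv /dirderiv (bigD1 k) //= big1 => [|l lk].
  rewrite so_dual_mxE !eqxx mul_mpolyC addr0; congr (_ *: _).
  have -> : ((so_index k).1 == (so_index k).2) = false by apply/negbTE; rewrite neq_ltn so_index_lt.
  by rewrite sub0r mulrN1.
suff -> : so_mx (so_basis l : so) (so_index k).1 (so_index k).2 = 0 by rewrite mpolyC0 mul0r.
rewrite so_dual_mxE.
have -> : ((so_index k).1 == (so_index l).1) && ((so_index k).2 == (so_index l).2) = false.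
  apply/negP => /andP[/eqP El /eqP Em]; move/eqP: lk; apply; apply: so_index_inj.
  by rewrite [LHS]surjective_pairing -El -Em -surjective_pairing.
case: andP => [[/eqP El /eqP Em]|_]; last by rewrite subrr mulr0.
by have := so_index_lt k; rewrite El Em ltnNge ltnW ?so_index_lt.
Qed.

(** In characteristic 0 a monomial of positive degree survives differentiation by any variable that
    it contains. *)
Lemma msize_from_deriv s (p : so_poly) :
  (forall k, (msize p^`M(k) <= s)%N) -> (msize p <= s.+1)%N.
Proof.
move=> Hs; rewrite msizeE; apply/bigmax_leqP_seq => m mp _.
case: (posnP (mdeg m)) => [->//|mpos].
have [k mk] : exists k, (0 < m k)%N.
  apply/existsP; move: mpos; apply: contraTT; rewrite negb_exists => /forallP H.
  by rewrite -eqn0Ngt mdegE big1 // => k _; apply/eqP; rewrite eqn0Ngt; exact: H.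
have Em : (m - U_(k) + U_(k))%MM = m.
  by rewrite submK //; apply/mnm_lepP => l; rewrite mnm1E; case: eqP => [<-|].
have : (m - U_(k))%MM \in msupp p^`M(k).
  rewrite mcoeff_msupp mcoeff_deriv Em mulrn_eq0 negb_or /=.
  by rewrite -mcoeff_msupp.
move/msize_mdeg_lt => H; rewrite -[m]Em mdegD mdeg1 addn1 ltnS.
exact: leq_trans H (Hs k).
Qed.

Context {U : pzAlgType K} {uin : so -> U}.
Hypothesis uin_lin : forall c a b, uin (c *: a + b) = c%:S * uin a + uin b.
Hypothesis scal_inj : forall c : K, c%:S = 0 :> U -> c = 0.
Local Notation symU := (symm (fun k => uin (so_basis k))).

Context {T : pzAlgType K} {TU : U -> T} {TV : V -> T}.
Hypothesis TU_morph : alg_morphism TU.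
Hypothesis TV_lin : forall c x y, TV (c *: x + y) = c%:S * TV x + TV y.
Hypothesis T_act : forall a x,
  TU (uin a) * TV x - TV x * TU (uin a) = TV (so_act a x).
Hypothesis T_free : forall c : 'I_N -> U,
  \sum_i TV (bas i) * TU (c i) = 0 -> forall i, c i = 0.

(** Off the diagonal the term of order 0 disappears, so in the coefficient of e_i in sym(p) e_j the
    leading term is a first derivative of [p]. *)
Lemma exp_deriv_offdiag m p (i j : 'I_N) : i != j ->
  exp_deriv m.+2 (fun l => bas (K := K) j l 0 *: p) i
  = so_deriv i j p + \sum_(k < m) ((k.+2`!)%:R^-1 : K) *:
      iter k.+2 vec_deriv (fun l => bas (K := K) j l 0 *: p) i.
Proof.
move=> ij; rewrite /exp_deriv 2!big_ord_recl /= invr1 !scale1r.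
rewrite {1}/bas mxE (negPf ij) scale0r add0r; congr (_ + _).
  rewrite /vec_deriv (bigD1 j) //= big1 => [|l lj].
    by rewrite mxE !eqxx scale1r addr0.
  by rewrite mxE (negPf lj) scale0r /so_deriv dirderiv0.
Qed.

(** If sym(p) = 0, then sym(p) e_j = 0, and by freeness each coefficient in it vanishes. These are
    symmetrizations of polynomials of lower degree, so by induction the polynomials vanish too. By
    [exp_deriv_offdiag] the first derivatives of [p] then have smaller degree than they should,
    which contradicts the degree of [p]. *)
Lemma symm_eq0 p : symU p = 0 -> p = 0.
Proof.
have [n] := ubnP (msize p); elim: n p => [//|n IH] p; rewrite ltnS => pn sp0.
have [p1|p2] := leqP (msize p) 1.
  have Ep := msize1_polyC p1; move: sp0.
  have -> : p = p@_0 *: lin_form (0 : so) ^+ 0 + 0.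
    by rewrite {1}Ep expr0 addr0 -mul_mpolyC mulr1.
  rewrite symm_lin (symm_pow uin_lin) symm0 expr0 mulr1 addr0 => /scal_inj ->.
  by rewrite scale0r addr0.
case Es : (msize p) p2 pn => [|[|s]] // _ sn.
have E0 (i j : 'I_N) : symU (exp_deriv s.+2 (fun l => bas (K := K) j l 0 *: p) i) = 0.
  move: i; apply: T_free.
  have := symm_TV uin_lin TU_morph TV_lin T_act (bas (K := K) j) (eq_leq Es).
  by rewrite sp0 (alg_mor0 TU_morph) mul0r => /esym.
have small (i j : 'I_N) : i != j -> (msize (so_deriv i j p) <= s)%N.
  move=> ij; pose rest := \sum_(k < s) ((k.+2`!)%:R^-1 : K) *:
      iter k.+2 vec_deriv (fun l => bas (K := K) j l 0 *: p) i.
  have sv (l : 'I_N) : (msize (bas (K := K) j l 0 *: p)%R <= s.+2)%N.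
    by rewrite -Es; exact: msizeZ_le.
  have srest : (msize rest <= s)%N.
    apply: msize_sum_le => k _; apply: leq_trans (msizeZ_le _ _) _.
    apply: leq_trans (msize_iter_vec_deriv _ sv _) _.
    by rewrite !subSS leq_subr.
  have := E0 i j; rewrite exp_deriv_offdiag // -/rest => /IH.
  have -> : (msize (so_deriv i j p + rest)%R < n)%N.
    apply: leq_ltn_trans sn; apply: leq_trans (msizeD_le _ _) _.
    rewrite geq_max (leq_trans srest) ?leqnSn // andbT.
    by apply: leq_trans (msize_so_deriv _ _ _) _; rewrite Es.
  move=> /(_ isT)/eqP; rewrite addr_eq0 => /eqP ->.
  by rewrite msizeN.
have : (msize p <= s.+1)%N.
  apply: msize_from_deriv => k.
  have nz : (- 2^-1 : K) != 0 by rewrite oppr_eq0 invr_eq0 pnatr_eq0.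
  rewrite -(msizeZ _ nz) -so_deriv_coord; apply: small.
  by rewrite neq_ltn so_index_lt.
by rewrite Es ltnn.
Qed.

(** By [symm_TV] the commutator of sym(k) with w is the vector (exp(D) - 1)(k w), where D is
    [vec_deriv]. The three terms add up to (exp(D) - 1) Q; freeness and [symm_eq0] bring the
    equation to polynomials, and [exp_deriv_fix] reduces it to D Q = 0. *)
Lemma cyclic_comm_symm (k : V -> V -> so_poly) x y z :
  cyclic_comm (TU := TU) (TV := TV) (fun v w => symU (k v w)) x y z = 0 <->
  vec_deriv (fun i => z i 0 *: k x y + (x i 0 *: k y z + y i 0 *: k z x)) =1 fun=> 0.
Proof.
(* One truncation order exact for all three polynomials; the 2 ensures that the linear term of the
   exponential is present. *)
pose m := (maxn 2 (maxn (msize (k x y)) (maxn (msize (k y z)) (msize (k z x))))).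
pose Q i : so_poly := z i 0 *: k x y + (x i 0 *: k y z + y i 0 *: k z x).
have tri (u v w : V) : (msize (k u v) <= m)%N ->
    TU (symU (k u v)) * TV w - TV w * TU (symU (k u v)) =
    vec_elt (uin := uin) (TU := TU) (TV := TV) (exp_deriv m (fun j => w j 0 *: k u v))
    - vec_elt (uin := uin) (TU := TU) (TV := TV) (fun j => w j 0 *: k u v).
  move=> km; rewrite (symm_TV uin_lin TU_morph TV_lin T_act _ km).
  by rewrite (vec_elt_vec TU_morph TV_lin).
have add P P' : vec_elt (uin := uin) (TU := TU) (TV := TV) (fun i => P i + P' i) =
    vec_elt (uin := uin) (TU := TU) (TV := TV) P + vec_elt (uin := uin) (TU := TU) (TV := TV) P'.
  have := vec_elt_lin (uin := uin) TU_morph (TV := TV) 1 P P'; rewrite scal1 mul1r => <-.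
  by congr vec_elt; apply/funext => i; rewrite scale1r.
have eadd P P' : exp_deriv m (fun i => P i + P' i : so_poly) =
    (fun i => exp_deriv m P i + exp_deriv m P' i).
  apply/funext => i; rewrite -[in RHS](scale1r (exp_deriv m P i)) -exp_deriv_lin.
  by congr (exp_deriv _ _ i); apply/funext => j; rewrite scale1r.
have -> : cyclic_comm (TU := TU) (TV := TV) (fun v w => symU (k v w)) x y z =
   vec_elt (uin := uin) (TU := TU) (TV := TV) (fun i => exp_deriv m Q i - Q i).
  rewrite /cyclic_comm !tri ?leq_max ?leqnn ?orbT //.
  have := vec_elt_lin (uin := uin) TU_morph (TV := TV) (-1) Q (exp_deriv m Q).
  rewrite scalN scal1 mulN1r.
  rewrite (_ : (fun i => -1 *: Q i + _) = fun i => exp_deriv m Q i - Q i); last first.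
    by apply/funext => i; rewrite scaleN1r addrC.
  move=> ->; rewrite [RHS]addrC /Q !eadd !add -addrA.
  have arr (M : zmodType) (u v w u' v' w' : M) :
    u - u' + (v - v' + (w - w')) = u + (v + w) - (u' + (v' + w')).
    by rewrite (addrACA v) (addrACA u) !opprD.
  exact: arr.
have mgt1 : (1 < m)%N by rewrite leq_max leqnn.
rewrite -(exp_deriv_fix Q mgt1); split=> [E0 i|Efix].
  have E0i : symU (exp_deriv m Q i - Q i) = 0 by move: i; exact: T_free.
  by apply/eqP; rewrite -subr_eq0; apply/eqP/symm_eq0.
rewrite /vec_elt big1 // => i _.
by rewrite Efix subrr symm0 (alg_mor0 TU_morph) mulr0.
Qed.
End SymmetrizationJacobi.

(** The augmentation sends the Lie algebra to 0 and fixes scalars. The free algebra on [nat] serves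
    as target because a scalar there is recovered as the coefficient of the empty monomial. *)
Lemma uea_scal_inj (K : comNzRingType) (g : lmodType K) (br : g -> g -> g) (c : K) :
  c%:S = 0 :> uea br -> c = 0.
Proof.
move=> c0; have [|a b|f [fm _]] := @uea_universal K g br (free_alg K nat) (fun=> 0).
- by move=> *; rewrite mulr0 addr0.
- by rewrite mulr0 subrr.
have := alg_morS fm c; rewrite c0 (alg_mor0 fm) => /(congr1 (monalg.mcoeff mone)).
by rewrite -[(_%:S : free_alg _ _)]/(free_scal nat c) /free_scal mcoeffUU monalg.mcoeff0.
Qed.

Section SoReduction.
Context {K : numFieldType} {N : nat}.
Local Notation so_dim := #|{: so_coord N}|.
Local Notation so_poly := (mpoly so_dim K).
Local Notation so := (so K N).
Local Notation V := 'cV[K]_N.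
Local Notation U := (uea (@so_br K N)).
Local Notation uin := (uea_in (@so_br K N)).
Local Notation act := (@so_act K N).
Local Notation TU := (@sdT_U K so V (@so_br K N) act).
Local Notation TV := (@sdT_V K so V (@so_br K N) act).

Lemma so_act_linl c (a b : so) x : act (c *: a + b) x = c *: act a x + act b x.
Proof.
change ((c *: so_mx a + so_mx b) *m x = c *: (so_mx a *m x) + so_mx b *m x).
by rewrite mulmxDl scalemxAl.
Qed.

Lemma so_act_linr (a : so) c x y : act a (c *: x + y) = c *: act a x + act a y.
Proof. by rewrite /so_act mulmxDr scalemxAr. Qed.

Lemma so_act_br (a b : so) x : act (so_br a b) x = act a (act b x) - act b (act a x).
Proof. by rewrite /so_act /= mulmxBl !mulmxA. Qed.

Lemma symmetrizationE (p : so_poly) :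
  symmetrization p = symm (fun k => uin (so_basis k)) p.
Proof.
rewrite /symmetrization /symm; apply: eq_bigr => m _; apply: (congr1 (GRing.mul _)).
rewrite /sym_mon /word_avg; apply: (congr1 (GRing.mul _)); apply: eq_bigr => s _.
by apply: eq_bigr.
Qed.
Local Notation symU := (symm (fun k => uin (so_basis k))).

Lemma sdT_free (c : 'I_N -> U) :
  \sum_i TV (bas i) * TU (c i) = 0 -> forall i, c i = 0.
Proof.
have [opT [Tm opT_in opT_V]] := sdT_oper_ex so_act_linl so_act_linr so_act_br.
move=> c0 i; pose f (w : seq 'I_N) : U := (w == [:: i])%:R.
have := congr1 (fun t => opT t f [::]) c0; rewrite (alg_mor_sum Tm) (alg_mor0 Tm).
have ev (G : 'I_N -> oper U (seq 'I_N)) : (\sum_j G j) f [::] = \sum_j G j f [::].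
  by apply: (big_morph (fun e : oper U (seq 'I_N) => e f [::])) => [e e'|].
have Tc j := @opT_V_coef K so N act U uin (@uea_ind K so _) _ TU TV sdT_U_morph
  opT Tm opT_in opT_V j.
rewrite ev (bigD1 i) //= big1 => [|j ji].
  by rewrite Tc /f eqxx mul1r addr0.
by rewrite Tc /f eqseq_cons (negPf ji) mul0r.
Qed.

Lemma symm_so_inj (p q : so_poly) : symU p = symU q -> p = q.
Proof.
move=> pq; apply/eqP; rewrite -subr_eq0; apply/eqP.
apply: (symm_eq0 (@uea_in_linear _ _ _) (@uea_scal_inj _ _ _) sdT_U_morph
  sdT_V_lin sdT_act sdT_free).
by rewrite symmB pq subrr.
Qed.

Definition cyclic_vec (k : V -> V -> so_poly) (x y z : V) : 'I_N -> so_poly :=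
  fun i => z i 0 *: k x y + (x i 0 *: k y z + y i 0 *: k z x).

Record so_pairing (k : V -> V -> so_poly) : Prop := SoPairing {
  pairing_linl : forall c x x' y, k (c *: x + x') y = c *: k x y + k x' y;
  pairing_linr : forall x c y y', k x (c *: y + y') = c *: k x y + k x y';
  pairing_alt : forall x, k x x = 0;
  pairing_ad : forall a x y, k (act a x) y + k x (act a y) = ad_deriv a (k x y)
}.

Lemma pairing_anti k x y : so_pairing k -> k x y = - k y x.
Proof.
case=> linl linr alt _; have := alt (1 *: x + y); rewrite linl !linr !alt !scale1r.
by rewrite add0r addr0 => /eqP; rewrite addr_eq0 => /eqP.
Qed.

Variable kappa : V -> V -> U.
Hypotheses (kappa_alt : alternating kappa) (kappa_equiv : equivariant act kappa).

Lemma so_PBW_poly : exists k : V -> V -> so_poly,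
  [/\ forall x y, kappa x y = symU (k x y), so_pairing k &
      PBW act kappa <-> forall x y z, vec_deriv (cyclic_vec k x y z) =1 fun=> 0].
Proof.
have [kappa_linr kappa_linl kappa_alt0] := kappa_alt.
have lin := @uea_in_linear K so (@so_br K N).
have br := @uea_in_br K so (@so_br K N).
have ind := @uea_ind K so (@so_br K N).
pose k x y := sval (cid (symm_surj lin br ind (kappa x y))).
have kE x y : kappa x y = symU (k x y) by rewrite /k; case: cid.
exists k; split=> //.
  split=> [c x x' y|x c y y'|x|a x y]; apply: symm_so_inj.
  - by rewrite symm_lin -!kE; exact: kappa_linl.
  - by rewrite symm_lin -!kE; exact: kappa_linr.
  - by rewrite -kE kappa_alt0 symm0.
  - by rewrite -(symm_ad lin br) symmD -!kE kappa_equiv.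
have kappaE : kappa = fun x y => symU (k x y).
  by apply/funext => x; apply/funext => y; exact: kE.
apply: (iff_trans (PBW_jacobi so_act_linl so_act_linr so_act_br kappa_alt kappa_equiv)).
have HJ x y z := cyclic_comm_symm lin (@uea_scal_inj _ _ _) sdT_U_morph
    sdT_V_lin sdT_act sdT_free k x y z.
split=> H x y z.
  by apply/(HJ x y z); rewrite -kappaE.
by rewrite kappaE; exact/(HJ x y z)/H.
Qed.
End SoReduction.

(** * Polynomial solutions of the Jacobi identity *)

Lemma mpoly_ring_ind (R : comNzRingType) n (P : mpoly n R -> Prop) :
  (forall c, P c%:MP) -> (forall k, P 'X_k) ->
  (forall p q, P p -> P q -> P (p + q)) ->
  (forall p q, P p -> P q -> P (p * q)) -> forall p, P p.
Proof.
move=> Pc PX PD PM p; elim/mpolyind: p => [|c m p _ _ Pp].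
  by rewrite -mpolyC0.
apply: PD => //; rewrite -mul_mpolyC; apply: (PM) => //.
rewrite mpolyXE_id; elim/big_ind: _ => //; first by rewrite -mpolyC1.
move=> i _; elim: (m i) => [|k IH]; first by rewrite expr0 -mpolyC1.
by rewrite exprS; exact: PM.
Qed.

Lemma poly_eq0_numField (K : numFieldType) (q : {poly K}) :
  (forall t, q.[t] = 0) -> q = 0.
Proof.
move=> q0; apply/eqP; apply: contraT => nz.
have := max_poly_roots nz (rs := [seq i%:R | i <- iota 0 (size q)]).
rewrite size_map size_iota ltnn => -> //; first by apply/allP => t _; rewrite rootE q0.
by rewrite map_inj_in_uniq ?iota_uniq // => i j _ _ /eqP; rewrite eqr_nat => /eqP.
Qed.

Section PolynomialLines.
Context {K : numFieldType} {n : nat}.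
Local Notation R := (mpoly n K).
Implicit Types (p q : R) (a b : 'I_n -> K).

Definition vderiv b : R -> R := dirderiv (fun k => (b k)%:MP).

Lemma vderiv_lin b c p q : vderiv b (c *: p + q) = c *: vderiv b p + vderiv b q.
Proof. exact: dirderiv_lin. Qed.
Lemma vderivE b p : vderiv b p = \sum_k b k *: p^`M(k).
Proof. by apply: eq_bigr => k _; rewrite mul_mpolyC. Qed.
Lemma vderiv_dirlin c b b' p :
  vderiv (fun k => c * b k + b' k) p = c *: vderiv b p + vderiv b' p.
Proof.
rewrite !vderivE scaler_sumr -big_split; apply: eq_bigr => k _ /=.
by rewrite scalerDl scalerA.
Qed.
Lemma vderivC b b' p : vderiv b (vderiv b' p) = vderiv b' (vderiv b p).
Proof.
have E c c' : vderiv c (vderiv c' p) = \sum_k \sum_l (c k * c' l) *: p^`M(l)^`M(k).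
  rewrite !vderivE; apply: eq_bigr => k _.
  rewrite (raddf_sum (mderiv k)) scaler_sumr; apply: eq_bigr => l _ /=.
  by rewrite mderivZ scalerA.
rewrite !E exchange_big; apply: eq_bigr => k _; apply: eq_bigr => l _.
by rewrite mderiv_comm mulrC.
Qed.

Definition line a b p : {poly K} := mmap polyC (fun k => (a k)%:P + (b k)%:P * 'X) p.

Lemma lineC a b c : line a b c%:MP = c%:P.
Proof. exact: mmapC. Qed.
Lemma lineX a b k : line a b 'X_k = (a k)%:P + (b k)%:P * 'X.
Proof. by rewrite /line mmapX mmap1U. Qed.
Lemma lineD a b p q : line a b (p + q) = line a b p + line a b q.
Proof. exact: mmapD. Qed.
Lemma lineM a b p q : line a b (p * q) = line a b p * line a b q.
Proof. exact: rmorphM. Qed.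
Lemma line_deriv a b p : (line a b p)^`() = line a b (vderiv b p).
Proof.
elim/mpoly_ring_ind: p => [c|k|p q Hp Hq|p q Hp Hq].
- by rewrite lineC derivC /vderiv dirderivC -mpolyC0 lineC.
- rewrite lineX derivD derivC derivM derivC derivX mul0r mulr1 !add0r.
  by rewrite /vderiv dirderivX lineC.
- by rewrite lineD derivD Hp Hq /vderiv dirderivD lineD.
- by rewrite lineM derivM Hp Hq /vderiv dirderivM lineD !lineM.
Qed.

Lemma line_horner a b p t : (line a b p).[t] = p.@[fun k => a k + t * b k].
Proof.
elim/mpoly_ring_ind: p => [c|k|p q Hp Hq|p q Hp Hq].
- by rewrite lineC hornerC mevalC.
- by rewrite lineX !hornerE mevalXU mulrC.
- by rewrite lineD hornerD Hp Hq mevalD.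
- by rewrite lineM hornerM Hp Hq mevalM.
Qed.

Lemma line_horner0 a b p : (line a b p).[0] = p.@[a].
Proof. by rewrite line_horner; apply: meval_eq => k; rewrite mul0r addr0. Qed.

Lemma euler_homog d p : p \is d.-homog -> \sum_k 'X_k * p^`M(k) = d%:R *: p.
Proof.
move=> /dhomogP hp; rewrite [in RHS](mpolyE p) scaler_sumr.
under eq_bigr => k _ do rewrite {1}(mpolyE p) (raddf_sum (mderiv k)) mulr_sumr.
rewrite exchange_big; apply: eq_big_seq => m /hp Em /=.
transitivity (\sum_k (m k)%:R *: (p@_m *: 'X_[m] : R)).
  apply: eq_bigr => k _; rewrite mderivZ mderivX -!scalerAr [LHS]scalerA [RHS]scalerA.
  rewrite (mulrC p@_m); case: (posnP (m k)) => [->|mk]; first by rewrite mul0r !scale0r.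
  by rewrite -mpolyXD addmC submK //; apply/mnm_lepP => l; rewrite mnm1E; case: eqP => [<-|].
by rewrite -scaler_suml -natr_sum -mdegE Em.
Qed.

Lemma vderiv_euler d p a : p \is d.-homog -> (vderiv a p).@[a] = d%:R * p.@[a].
Proof.
move=> /euler_homog/(congr1 (meval a)); rewrite mevalZ => <-.
rewrite vderivE !raddf_sum; apply: eq_bigr => k _ /=.
by rewrite mevalZ mevalM mevalXU.
Qed.

Lemma mderiv_homog d p k : p \is d.-homog -> p^`M(k) \is d.-1.-homog.
Proof.
move=> /dhomogP hp; apply/dhomogP => m mp.
have : (m + U_(k))%MM \in msupp p.
  move: mp; rewrite !mcoeff_msupp mcoeff_deriv; apply: contraNN => /eqP ->.
  by rewrite mul0rn.
by move/hp => /= <-; rewrite mdegD mdeg1 addn1.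
Qed.

Lemma vderiv_homog d b p : p \is d.-homog -> vderiv b p \is d.-1.-homog.
Proof.
by move=> hp; rewrite vderivE rpred_sum // => k _; apply/dhomogZ/mderiv_homog.
Qed.

Lemma meval_homog d p a c : p \is d.-homog -> p.@[fun k => c * a k] = c ^+ d * p.@[a].
Proof.
move=> /dhomogP hp; rewrite !mevalE mulr_sumr; apply: eq_big_seq => m /hp /= <-.
rewrite mulrCA; congr (_ * _); rewrite mdegE -prodrXr -big_split /=.
by apply: eq_bigr => k _; rewrite exprMn.
Qed.

End PolynomialLines.

(** Formally q is a constant times g^(d/a), and the constant is fixed at 0. Coefficient [m] of the
    equation has g_0 (m+1) q_(m+1) as its only term not yet known to vanish. *)
Lemma poly_log_deriv_eq0 (K : numFieldType) (g q : {poly K}) (a d : K) :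
  a != 0 -> a *: (g * q^`()) = d *: (g^`() * q) -> q.[0] = 0 -> g.[0] != 0 -> q = 0.
Proof.
move=> a0 E; rewrite !horner_coef0 => q0 g0.
suff H m : forall k, (k <= m)%N -> q`_k = 0.
  by apply/polyP => k; rewrite coef0; exact: (H k).
elim: m => [k|m IH k]; first by rewrite leqn0 => /eqP ->.
rewrite leq_eqVlt => /orP[/eqP ->|]; last by rewrite ltnS; exact: IH.
have := congr1 (fun r : {poly K} => r`_m) E; rewrite !coefZ !coefM.
rewrite big_ord_recl big1 => [|i _]; last first.
  rewrite coef_deriv IH ?mul0rn ?mulr0 // lift0.
  by have := ltn_ord i; lia.
rewrite addr0 [X in _ = _ * X]big1 => [|i _]; last by rewrite IH ?leq_subr // mulr0.
rewrite mulr0 subn0 coef_deriv => /eqP.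
by rewrite !(mulf_eq0, mulrn_eq0) (negPf a0) (negPf g0) /= => /eqP.
Qed.

Section GenericMatrix.
Context {K : numFieldType} {N : nat}.
Local Notation so_dim := #|{: so_coord N}|.
Local Notation so_poly := (mpoly so_dim K).

Lemma skew_ext (M : lmodType K) (f g : 'I_N -> 'I_N -> M) :
  (forall i j, f j i = - f i j) -> (forall i j, g j i = - g i j) ->
  (forall k, f (so_index k).1 (so_index k).2 = g (so_index k).1 (so_index k).2) ->
  forall i j, f i j = g i j.
Proof.
move=> fs gs fg; have lt_case (i j : 'I_N) : (i < j)%N -> f i j = g i j.
  by move=> /so_index_surj[k Ek]; have := fg k; rewrite Ek.
have diag0 (h : 'I_N -> 'I_N -> M) i : (forall i j, h j i = - h i j) -> h i i = 0.
  move=> hs; have /eqP := hs i i; rewrite -addr_eq0 -mulr2n -scaler_nat scaler_eq0.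
  by rewrite pnatr_eq0 /= => /eqP.
move=> i j; case: (ltngtP i j) => [/lt_case //|/lt_case ji|/ord_inj ->].
  by rewrite fs gs ji.
by rewrite !diag0.
Qed.

Lemma vderivN n b (p : mpoly n K) : vderiv b (- p) = - vderiv b p.
Proof. by rewrite -scaleN1r /vderiv dirderivZ scaleN1r. Qed.

Lemma generic_skew i j : generic_mx K N j i = - generic_mx K N i j.
Proof. by rewrite !mxE opprB. Qed.

Lemma generic_index k : generic_mx K N (so_index k).1 (so_index k).2 = 'X_k.
Proof.
rewrite mxE /coord_fun; have lt_k := so_index_lt k.
rewrite (insubF (so_coord N) (x := ((so_index k).2, (so_index k).1))) ?subr0; last first.
  by apply/negbTE; rewrite -leqNgt ltnW.
rewrite -surjective_pairing (_ : so_index k = val (enum_val k)) //.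
by rewrite valK enum_valK.
Qed.

Definition mxdir (B : 'M[K]_N) : 'I_so_dim -> K :=
  fun k => B (so_index k).1 (so_index k).2.

Definition skewmx (B : 'M[K]_N) := forall i j, B j i = - B i j.

Lemma vderiv_generic B i j : skewmx B ->
  vderiv (mxdir B) (generic_mx K N i j) = (B i j)%:MP.
Proof.
move=> Bs; move: i j; apply: skew_ext => [i j|i j|k].
- by rewrite generic_skew vderivN.
- by rewrite Bs rmorphN.
- by rewrite generic_index /vderiv dirderivX.
Qed.

Lemma meval_generic B i j : skewmx B -> (generic_mx K N i j).@[mxdir B] = B i j.
Proof.
move=> Bs; move: i j.
apply: (@skew_ext (K^o) (fun i j => (generic_mx K N i j).@[mxdir B]) B) => [i j|//|k].
- by rewrite generic_skew mevalN.
- by rewrite generic_index mevalXU.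
Qed.
End GenericMatrix.

(** * Derivatives and values along decomposable bivectors *)

Section Wedge.
Context {K : numFieldType} {N : nat}.
Local Notation so_dim := #|{: so_coord N}|.
Local Notation so_poly := (mpoly so_dim K).
Local Notation V := 'cV[K]_N.
Implicit Types (u v w x y z : V) (p q : so_poly).

Definition wedge u v : 'M[K]_N := u *m v^T - v *m u^T.

Lemma wedgeE u v i j : wedge u v i j = u i 0 * v j 0 - v i 0 * u j 0.
Proof. by rewrite !mxE !big_ord1 !mxE. Qed.

Lemma wedge_tr u v : (wedge u v)^T = - wedge u v.
Proof. by rewrite /wedge linearB /= !trmx_mul !trmxK opprB. Qed.

Lemma wedge_skew u v : skewmx (wedge u v).
Proof. by move=> i j; rewrite !wedgeE opprB mulrC (mulrC (v j 0)). Qed.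

Definition wdir u v : 'I_so_dim -> K := mxdir (wedge u v).

Lemma wdir_linl c u u' v k : wdir (c *: u + u') v k = c * wdir u v k + wdir u' v k.
Proof. by rewrite /wdir /mxdir !wedgeE !mxE; ring. Qed.

Lemma wdir_anti u v k : wdir v u k = - wdir u v k.
Proof. by rewrite /wdir /mxdir !wedgeE; ring. Qed.

Definition wderiv u v p := vderiv (wdir u v) p.

Lemma wderiv_lin u v c p q : wderiv u v (c *: p + q) = c *: wderiv u v p + wderiv u v q.
Proof. exact: vderiv_lin. Qed.
Lemma wderivD u v p q : wderiv u v (p + q) = wderiv u v p + wderiv u v q.
Proof. exact: dirderivD. Qed.
Lemma wderiv_linl c u u' v p :
  wderiv (c *: u + u') v p = c *: wderiv u v p + wderiv u' v p.
Proof.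
rewrite /wderiv -vderiv_dirlin; congr vderiv; apply/funext => k.
exact: wdir_linl.
Qed.
Lemma wderiv_anti u v p : wderiv v u p = - wderiv u v p.
Proof.
rewrite /wderiv !vderivE -sumrN; apply: eq_bigr => k _.
by rewrite wdir_anti scaleNr.
Qed.
Lemma wderiv_linr u c v v' p :
  wderiv u (c *: v + v') p = c *: wderiv u v p + wderiv u v' p.
Proof. by rewrite !(wderiv_anti _ u) wderiv_linl opprD scalerN. Qed.
Lemma wderivC u v x y p : wderiv u v (wderiv x y p) = wderiv x y (wderiv u v p).
Proof. exact: vderivC. Qed.
Lemma wderivN u v p : wderiv u v (- p) = - wderiv u v p.
Proof. exact: vderivN. Qed.

Lemma linear_basE (M : lmodType K) (f : V -> M) :
  (forall c u v, f (c *: u + v) = c *: f u + f v) ->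
  forall u, f u = \sum_i u i 0 *: f (bas i).
Proof.
move=> flin u; have f0 : f 0 = 0.
  by have := flin (-1) 0 0; rewrite scaler0 addr0 scaleN1r addNr.
rewrite {1}[u]basE; elim: (index_enum _) => [|i r IH]; first by rewrite !big_nil.
by rewrite !big_cons flin IH.
Qed.

Lemma so_deriv_wderiv i j p : so_deriv i j p = 2^-1 *: wderiv (bas j) (bas i) p.
Proof.
rewrite /wderiv vderivE scaler_sumr; apply: eq_bigr => k _.
rewrite so_dual_mxE mul_mpolyC scalerA; congr ((_ * _) *: _).
rewrite /wdir /mxdir wedgeE !mxE !andbT -!natrM !mulnb.
by rewrite ![_ == (so_index k).2]eq_sym ![_ == (so_index k).1]eq_sym andbC.
Qed.

(* The Jacobi identity of H_kappa, moved to polynomials by symmetrization. *)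
Definition plucker_closed (k : V -> V -> so_poly) := forall x y z w,
  wderiv z w (k x y) + (wderiv x w (k y z) + wderiv y w (k z x)) = 0.

Lemma vec_deriv_wderiv (k : V -> V -> so_poly) x y z i :
  vec_deriv (cyclic_vec k x y z) i = 2^-1 *: (wderiv z (bas i) (k x y)
    + (wderiv x (bas i) (k y z) + wderiv y (bas i) (k z x))).
Proof.
have H u p : \sum_j so_deriv i j (u j 0 *: p) = 2^-1 *: wderiv u (bas i) p.
  rewrite (linear_basE (f := fun u => wderiv u (bas i) p)) => [|*]; last exact: wderiv_linl.
  rewrite scaler_sumr; apply: eq_bigr => j _.
  by rewrite so_derivZ so_deriv_wderiv !scalerA mulrC.
rewrite /vec_deriv /cyclic_vec.
have soD j p q : so_deriv i j (p + q) = so_deriv i j p + so_deriv i j q.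
  exact: dirderivD.
under eq_bigr do rewrite !soD.
by rewrite !big_split /= !H !scalerDr.
Qed.

Lemma plucker_closedP (k : V -> V -> so_poly) :
  (forall x y z, vec_deriv (cyclic_vec k x y z) =1 fun=> 0) <-> plucker_closed k.
Proof.
have nz2 : (2^-1 : K) != 0 by rewrite invr_eq0 pnatr_eq0.
split=> [H x y z w|H x y z i]; last by rewrite vec_deriv_wderiv H scaler0.
rewrite (linear_basE (f := fun w => wderiv z w (k x y)
   + (wderiv x w (k y z) + wderiv y w (k z x)))) => [|c u v].
  apply: big1 => i _; have := H x y z i; rewrite vec_deriv_wderiv => /eqP.
  by rewrite scaler_eq0 (negPf nz2) /= => /eqP ->; rewrite scaler0.
rewrite !wderiv_linr !scalerDr.
by rewrite [X in _ + X = _]addrACA [LHS]addrACA.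
Qed.

Section Closed.
Variable k : V -> V -> so_poly.
Hypothesis k_pairing : so_pairing k.
Hypothesis k_closed : plucker_closed k.
Let k_anti x y : k y x = - k x y.
Proof. exact: pairing_anti. Qed.

(** The expression is antisymmetric in x, y and in z, w, and [k_closed] is its cyclic identity.
    These are the symmetries of a curvature tensor, where the first Bianchi identity implies pair
    symmetry; as there, four instances are combined and 2 is cancelled. *)
Lemma wderiv_sym x y z w : wderiv z w (k x y) = wderiv x y (k z w).
Proof.
have e1 := k_closed x y z w; have e2 := k_closed x y w z.
have e3 := k_closed x z w y; have e4 := k_closed y z w x.
move: e1 e2 e3 e4.
rewrite (k_anti z x) (k_anti x w) (k_anti y w) !wderivN.
rewrite !(wderiv_anti z w, wderiv_anti z x, wderiv_anti y z, wderiv_anti y w).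
rewrite !(wderiv_anti x w, wderiv_anti x y) !opprK.
set a := wderiv z w _; set a' := wderiv x y _.
move=> e1 e2 e3 e4; have nz2 : (2 : K) != 0 by rewrite pnatr_eq0.
apply: (scalerI nz2); rewrite !scaler_nat !mulr2n; apply/eqP; rewrite -subr_eq0; apply/eqP.
move: (wderiv x w _) (wderiv y w _) (wderiv z x _) (wderiv y z _) e1 e2 e3 e4 => b1 c1 c2 b2 e1 e2 e3 e4.
transitivity (a + (b1 + c1) - (- a + (- c2 - b2)) - (c1 + (a' + b2)) + (- b1 + (- a' - c2))).
  by ring.
by rewrite e1 e2 e3 e4 !subr0 addr0.
Qed.
End Closed.
End Wedge.

Section WedgeEvaluation.
Context {K : numFieldType} {N : nat}.
Local Notation so_dim := #|{: so_coord N}|.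
Local Notation so_poly := (mpoly so_dim K).
Local Notation so := (so K N).
Local Notation act := (@so_act K N).
Local Notation V := 'cV[K]_N.
Implicit Types (u v w x y z c : V) (p q : so_poly) (t : K).

Lemma lin_form_eval (b A : so) : (lin_form b).@[mxdir A] = \tr (A *m b).
Proof.
have nz2 : (2 : K) != 0 by rewrite pnatr_eq0.
rewrite /lin_form raddf_sum [in RHS](so_basisE b).
have -> : so_mx (\sum_k so_coef b k *: so_basis k)
    = \sum_k so_coef b k *: so_mx (so_basis k).
  by rewrite -[so_mx _]/(val _) raddf_sum.
rewrite mulmx_sumr raddf_sum; apply: eq_bigr => k _ /=.
by rewrite mevalZ mevalXU -scalemxAr mxtraceZ so_dualE.
Qed.

(** On linear forms this is the invariance of the trace form, tr(A [a, b]) = tr([A, a] b). *)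
Lemma ad_deriv_eval (a A : so) p :
  (ad_deriv a p).@[mxdir A] = (vderiv (mxdir (so_br A a)) p).@[mxdir A].
Proof.
have nz2 : (2 : K) != 0 by rewrite pnatr_eq0.
rewrite vderivE /ad_deriv /dirderiv !raddf_sum; apply: eq_bigr => k _ /=.
rewrite mevalM mevalZ lin_form_eval; congr (_ * _).
rewrite /mxdir -(so_dualE (so_br A a)) // -[so_dual _ _ _]/(so_basis k).
move: (so_basis k) => b; rewrite /so_br [so_mx (So _)]/= [so_mx (So _)]/=.
by rewrite mulmxBl mulmxBr !linearB /= !mulmxA [X in _ - X = _]mxtrace_mulC !mulmxA.
Qed.

Definition so_wedge u v : so := So (introT eqP (wedge_tr u v)).

Definition wev u v p : K := p.@[wdir u v].

Lemma wevD u v p q : wev u v (p + q) = wev u v p + wev u v q.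
Proof. exact: mevalD. Qed.
Lemma wevZ u v t p : wev u v (t *: p) = t * wev u v p.
Proof. exact: mevalZ. Qed.
Lemma wevN u v p : wev u v (- p) = - wev u v p.
Proof. exact: mevalN. Qed.

Lemma wevB u v p q : wev u v (p - q) = wev u v p - wev u v q.
Proof. exact: mevalB. Qed.

Definition dot u v : K := \sum_i u i 0 * v i 0.

Lemma dotC u v : dot u v = dot v u.
Proof. by apply: eq_bigr => i _; rewrite mulrC. Qed.
Lemma dot_linl t u u' v : dot (t *: u + u') v = t * dot u v + dot u' v.
Proof.
rewrite /dot mulr_sumr -big_split; apply: eq_bigr => i _ /=.
by rewrite !mxE mulrDl mulrA.
Qed.
Lemma dot_linr t u v v' : dot u (t *: v + v') = t * dot u v + dot u v'.
Proof. by rewrite dotC dot_linl !(dotC u). Qed.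

Definition gram u v : K := dot u u * dot v v - dot u v ^+ 2.

Lemma wedge_act u v w : wedge u v *m w = dot v w *: u - dot u w *: v.
Proof.
have dotE (y : V) : (y^T *m w) 0 0 = dot y w.
  by rewrite mxE; apply: eq_bigr => j _; rewrite mxE.
apply/colP => i; rewrite mulmxBl -!mulmxA !(mxE, big_ord1) -!dotE !mxE.
by rewrite mulrC [in X in _ - X = _]mulrC.
Qed.

Lemma so_br_wedge (a : so) u v :
  so_br (so_wedge u v) a = - (wedge (act a u) v + wedge u (act a v)) :> 'M_N.
Proof.
rewrite /= /wedge /so_act !trmx_mul so_tr !mulmxBl !mulmxBr !mulmxN !mulmxA.
by rewrite !opprD !opprK [LHS]addrACA [RHS]addrACA [X in X + _]addrC.
Qed.

Section Diagonal.
Variables (k : V -> V -> so_poly) (n : nat).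
Hypothesis k_linl : forall t x x' y, k (t *: x + x') y = t *: k x y + k x' y.
Hypothesis k_linr : forall x t y y', k x (t *: y + y') = t *: k x y + k x y'.
Hypothesis k_anti : forall x y, k y x = - k x y.
Hypothesis k_sym : forall x y z w, wderiv z w (k x y) = wderiv x y (k z w).
Hypothesis k_closed : plucker_closed k.
Hypothesis k_homog : forall x y, k x y \is n.-homog.

Definition wdiag u v : K := wev u v (k u v).

Lemma wev_add u v c t p :
  p.@[fun i => wdir u v i + t * wdir u c i] = wev u (t *: c + v) p.
Proof.
apply: meval_eq => i; rewrite [in RHS]wdir_anti wdir_linl opprD -mulrN -!wdir_anti.
exact: addrC.
Qed.

Lemma wev_euler u v p d : p \is d.-homog -> wev u v (wderiv u v p) = d%:R * wev u v p.
Proof. exact: vderiv_euler. Qed.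

Lemma wev_swap u v p d : p \is d.-homog -> wev v u p = (-1) ^+ d * wev u v p.
Proof.
move=> hp; rewrite -(meval_homog _ _ hp); apply: meval_eq => i.
by rewrite wdir_anti mulN1r.
Qed.

(** The function q(u, v + t c) as a polynomial in t: the bivector u ^ (v + t c) and the polynomial
    k(u, v + t c) are both affine in t. *)
Definition wline u v c : {poly K} :=
  line (wdir u v) (wdir u c) (k u v) + 'X * line (wdir u v) (wdir u c) (k u c).

Lemma wline_horner u v c t : (wline u v c).[t] = wdiag u (t *: c + v).
Proof.
by rewrite !hornerE !line_horner !wev_add /wdiag k_linr wevD wevZ addrC.
Qed.

(** The product rule gives k(u, c) once. Pair symmetry turns D_{u^c} k(u, v + t c) into the radial
    derivative of k(u, c) at u ^ (v + t c), which is n times the value by Euler's formula. *)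
Lemma wline_deriv u v c t :
  (wline u v c)^`().[t] = n.+1%:R * wev u (t *: c + v) (k u c).
Proof.
rewrite derivD derivM derivX mul1r !line_deriv !hornerD hornerM hornerX !line_horner.
rewrite -!/(wderiv _ _ _) !wev_add -[in RHS]natr1 mulrDl mul1r -(wev_euler _ _ (k_homog u c)).
by rewrite wderiv_linr wevD wevZ (k_sym u v); ring.
Qed.

(** Differentiating q = 0 gives k(u, c) = 0 at u ^ v, and polarizing this in u gives [Exy]. Inserted
    in the closedness relation for x, v, u, y, where pair symmetry and Euler's formula treat the
    middle term, it leaves (n + 2) k(x, y) = 0 at u ^ v. *)
Lemma wedge_eq0 : (forall u v, wdiag u v = 0) -> forall u v x y, wev u v (k x y) = 0.
Proof.
move=> k0; have kuc u v c : wev u v (k u c) = 0.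
  have /(congr1 (fun q : {poly K} => q^`().[0])) : wline u v c = 0.
    by apply: poly_eq0_numField => t; rewrite wline_horner.
  rewrite wline_deriv scale0r add0r deriv0 horner0 => /eqP.
  by rewrite mulf_eq0 pnatr_eq0 => /eqP.
have Exy u v x y : wev u v (wderiv x v (k u y)) = - wev u v (k x y).
  have kl t : wev (t *: x + u) v (k (t *: x + u) y) = 0 by exact: kuc.
  pose q := line (wdir u v) (wdir x v) (k u y) + 'X * line (wdir u v) (wdir x v) (k x y).
  have /(congr1 (fun q : {poly K} => q^`().[0])) : q = 0.
    apply: poly_eq0_numField => t; rewrite -(kl t) hornerD hornerM hornerX !line_horner.
    rewrite k_linl addrC wevD wevZ; congr (_ * _ + _); apply: meval_eq => i;
    by rewrite wdir_linl addrC.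
  rewrite derivD derivM derivX mul1r !line_deriv !hornerD hornerM hornerX !line_horner0.
  rewrite deriv0 horner0 mul0r addr0 => /eqP; rewrite addr_eq0 => /eqP.
  exact.
move=> u v x y; have := congr1 (wev u v) (k_closed x v u y).
rewrite !wevD {4}/wev meval0 (k_sym x v) (k_sym v u) !(wderiv_anti u v, wderiv_anti y v) !wevN.
rewrite !Exy (wev_euler _ _ (k_homog x y)) (k_anti x y) wevN => E.
have : n.+2%:R * wev u v (k x y) = 0.
  by rewrite -[RHS]oppr0 -E -[n.+2]addn2 natrD; ring.
by move/eqP; rewrite mulf_eq0 pnatr_eq0 => /eqP.
Qed.
End Diagonal.
End WedgeEvaluation.

(** * Uniqueness of homogeneous solutions *)

Section WedgeVanishing.
Context {K : numFieldType} {N : nat}.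
Local Notation so_dim := #|{: so_coord N}|.
Local Notation so_poly := (mpoly so_dim K).
Local Notation so := (so K N).
Local Notation act := (@so_act K N).
Local Notation V := 'cV[K]_N.
Implicit Types (u v w x y z c : V) (p q : so_poly) (t : K).

Lemma mderiv_wderiv i p : p^`M(i) = wderiv (bas (so_index i).1) (bas (so_index i).2) p.
Proof.
have nz2 : (2^-1 : K) != 0 by rewrite invr_eq0 pnatr_eq0.
apply: (scalerI nz2); rewrite wderiv_anti scalerN -so_deriv_wderiv so_deriv_coord.
by rewrite scaleNr opprK.
Qed.

Lemma homog_deriv_eq0 n p : p \is n.+1.-homog -> (forall x y, wderiv x y p = 0) -> p = 0.
Proof.
move=> /euler_homog E p0; apply/eqP.
have -> : (p == 0) = (n.+1%:R *: p == 0) by rewrite scaler_eq0 pnatr_eq0.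
by rewrite -E big1 // => i _; rewrite mderiv_wderiv p0 mulr0.
Qed.

Lemma homog0_const p : p \is 0.-homog -> p = (p@_0)%:MP.
Proof.
move=> hp; apply/mpolyP => m; rewrite mcoeffC.
case: eqVneq => [->|m0]; first by rewrite mulr1.
by rewrite (dhomog_nemf_coeff hp) ?mulr0 //= mdeg_eq0.
Qed.

(** Vanishing on decomposable bivectors puts [p] in the ideal of the Grassmannian, while closedness
    says that the Pluecker quadrics, read as differential operators, kill [p]. The induction passes
    to the derivatives of [p], which vanish on decomposable bivectors by [wedge_eq0]. *)
Lemma plucker_harmonic_eq0 n p : p \is n.-homog ->
  plucker_closed (fun x y => wderiv x y p) -> (forall u v, wev u v p = 0) -> p = 0.
Proof.
elim: n p => [|n IH] p hp pc p0.
  by move: (p0 0 0); rewrite [p]homog0_const // /wev mevalC => ->.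
have dhomog x y : wderiv x y p \is n.-homog by exact: (vderiv_homog _ hp).
apply: (homog_deriv_eq0 hp) => x y; apply: IH; first exact: dhomog.
  move=> z1 z2 z3 z4; have := congr1 (wderiv x y) (pc z1 z2 z3 z4).
  by rewrite !wderivD !(wderivC x y) !(wderivC _ _ x y) => ->; rewrite /wderiv /vderiv dirderiv0.
move=> u v; apply: (@wedge_eq0 _ _ (fun x y => wderiv x y p) n) => //.
- by move=> *; exact: wderiv_linl.
- by move=> *; exact: wderiv_linr.
- by move=> *; exact: wderiv_anti.
- by move=> *; exact: wderivC.
- by move=> {}u {}v; rewrite /wdiag (wev_euler _ _ hp) p0 mulr0.
Qed.

Section Diagonal.
Variables (k : V -> V -> so_poly) (n : nat).
Hypothesis k_pairing : so_pairing k.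
Hypothesis k_closed : plucker_closed k.
Hypothesis k_homog : forall x y, k x y \is n.-homog.
Let k_linl := pairing_linl k_pairing.
Let k_linr := pairing_linr k_pairing.
Let k_anti x y : k y x = - k x y.
Proof. exact: pairing_anti. Qed.
Let k_sym := wderiv_sym k_pairing k_closed.
Let wline_horner := wline_horner k_linr.
Let wline_deriv := wline_deriv k_sym k_homog.

(** By pair symmetry the Pluecker operators applied to k(x, y) give D_{x^y} of the closedness
    relation, which is 0. So each k(x, y) meets the conditions of [plucker_harmonic_eq0]. *)
Lemma wdiag_eq0 : (forall u v, wdiag k u v = 0) -> forall x y, k x y = 0.
Proof.
move=> k0 x y; apply: (plucker_harmonic_eq0 (k_homog x y)) => [z1 z2 z3 z4|u v].
  rewrite !(k_sym x y) !(wderivC _ _ x y) -!wderivD.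
  by rewrite k_closed /wderiv /vderiv dirderiv0.
exact: (wedge_eq0 k_linl k_linr k_anti k_sym k_closed k_homog k0).
Qed.

Lemma wdiag_swap u v : wdiag k v u = (-1) ^+ n.+1 * wdiag k u v.
Proof. by rewrite /wdiag k_anti wevN (wev_swap _ _ (k_homog u v)) exprS !mulN1r mulNr. Qed.

Lemma wdiagN u v : wdiag k u (- v) = (-1) ^+ n.+1 * wdiag k u v.
Proof.
have -> : - v = (-1) *: v + 0 by rewrite scaleN1r addr0.
have k0 : k u 0 = 0 by have := k_linr u (-1) 0 0; rewrite scaler0 addr0 scaleN1r addNr.
rewrite /wdiag k_linr k0 !addr0 wevZ exprS -mulrA -(meval_homog _ _ (k_homog u v)).
congr (_ * _); apply: meval_eq => i; rewrite /wdir /mxdir !wedgeE !mxE; ring.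
Qed.

(** At the point u ^ v the adjoint action of [a] is minus the derivative along au ^ v + u ^ av. Pair
    symmetry and Euler's formula make that derivative n times the left-hand side X, so X = - n X. *)
Lemma wdiag_invariant (a : so) u v : wev u v (k (act a u) v + k u (act a v)) = 0.
Proof.
have Dbr p : vderiv (mxdir (so_br (so_wedge u v) a)) p =
    - (wderiv (act a u) v p + wderiv u (act a v) p).
  rewrite /wderiv !vderivE -big_split -sumrN; apply: eq_bigr => i _ /=.
  rewrite -scalerDl -scaleNr; congr (_ *: _).
  have /matrixP/(_ (so_index i).1 (so_index i).2) E := so_br_wedge a u v.
  by apply: etrans E _; rewrite 2!mxE.
set X := wev _ _ _; have EX : X = - (n%:R * X).
  rewrite {1}/X (pairing_ad k_pairing) /wev -[wdir u v]/(mxdir (so_wedge u v)).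
  rewrite ad_deriv_eval Dbr mevalN; congr (- _).
  rewrite /X -(wev_euler _ _ (dhomogD (k_homog _ _) (k_homog _ _))) wderivD /wev !mevalD; congr (_ + _).
    by rewrite (k_sym u v).
  by rewrite (k_sym u v).
have : n.+1%:R * X = 0 by rewrite -natr1 mulrDl mul1r {2}EX addrN.
by move/eqP; rewrite mulf_eq0 pnatr_eq0 => /eqP.
Qed.

(** Cramer's rule for the system [E1], [E2] in the values of k(c, v) and k(u, c), whose determinant
    is the Gram determinant up to sign. *)
Lemma gram_wev u v c : gram u v * wev u v (k u c) =
  (dot u u * dot c v - dot u v * dot u c) * wdiag k u v.
Proof.
have act_wedge x w : act (so_wedge c x) w = dot x w *: c - dot c w *: x.
  exact: wedge_act.
have kBl t s x y z : k (t *: x - s *: y) z = t *: k x z - s *: k y z.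
  have k0 : k 0 z = 0 by have := k_linl (-1) 0 0 z; rewrite scaler0 addr0 scaleN1r addNr.
  by rewrite k_linl -scaleNr -[_ *: y]addr0 k_linl k0 addr0 scaleNr.
have kBr t s x y z : k z (t *: x - s *: y) = t *: k z x - s *: k z y.
  by rewrite k_anti kBl !(k_anti _ z) !scalerN opprB opprK addrC.
have kd x : k x x = 0 := pairing_alt k_pairing x.
(* invariance under the rotations c ^ v and c ^ u *)
have E1 : dot u v * wev u v (k c v) + dot v v * wev u v (k u c) = dot c v * wdiag k u v.
  have := wdiag_invariant (so_wedge c v) u v; rewrite !act_wedge kBl kBr kd.
  rewrite scaler0 subr0 wevD wevZ wevB !wevZ (dotC v u) addrA => /eqP.
  by rewrite subr_eq0 => /eqP.
have E2 : dot u u * wev u v (k c v) + dot u v * wev u v (k u c) = dot u c * wdiag k u v.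
  have := wdiag_invariant (so_wedge c u) u v; rewrite !act_wedge kBl kBr kd.
  rewrite scaler0 subr0 wevD wevB !wevZ (dotC c u) addrAC => /eqP.
  by rewrite subr_eq0 => /eqP.
transitivity (dot u u * (dot c v * wdiag k u v) - dot u v * (dot u c * wdiag k u v)).
  by rewrite -E1 -E2 /gram; ring.
by ring.
Qed.

Definition gline u v c : {poly K} := (gram u v)%:P
  + ((dot u u * dot c v - dot u v * dot u c) *+ 2) *: 'X + (gram u c) *: 'X^2.

Lemma gline_horner u v c t : (gline u v c).[t] = gram u (t *: c + v).
Proof.
rewrite !(hornerD, hornerZ, hornerC, hornerX, hornerXn) /gram !dot_linr !dot_linl.
by rewrite (dotC v c); ring.
Qed.

(** Combine [wline_deriv] with [gram_wev] at v + t c, where the coefficient on the right of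
    [gram_wev] is half the derivative of [gline]. *)
Lemma wline_ode u v c : 2 *: (gline u v c * (wline k u v c)^`())
  = n.+1%:R *: ((gline u v c)^`() * wline k u v c).
Proof.
apply/eqP; rewrite -subr_eq0; apply/eqP/poly_eq0_numField => t.
rewrite hornerD hornerN !hornerZ !hornerM wline_deriv gline_horner wline_horner.
rewrite [gram _ _ * _]mulrCA gram_wev derivD derivD derivC !derivZ derivX derivXn.
rewrite !(hornerD, hornerZ, hornerC, hornerMn, hornerXn) expr1 !dot_linr.
rewrite /gram; ring.
Qed.

Lemma wdiag_move u v c t : wdiag k u v = 0 -> gram u v != 0 -> wdiag k u (t *: c + v) = 0.
Proof.
move=> k0 g0; rewrite -wline_horner.
rewrite (poly_log_deriv_eq0 _ (wline_ode u v c)) ?horner0 ?pnatr_eq0 //.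
  by rewrite wline_horner scale0r add0r.
by rewrite gline_horner scale0r add0r.
Qed.

Lemma wdiag_move_eq0 u v w : wdiag k u v = 0 -> gram u v != 0 -> wdiag k u w = 0.
Proof.
by move=> k0 g0; have := wdiag_move (w - v) 1 k0 g0; rewrite scale1r subrK.
Qed.

(** The hypothesis removes the linear term of [gline], so that [c] and [- c] lead to the same
    equation. The two solutions agree at t = 0, hence everywhere. *)
Lemma wdiag_even u v c t : dot u u * dot c v = dot u v * dot u c ->
  gram u v != 0 -> wdiag k u (t *: c + v) = wdiag k u (t *: (- c) + v).
Proof.
move=> cv g0; rewrite -!wline_horner; apply/eqP; rewrite -subr_eq0 -hornerN -hornerD.
have gE : gline u v (- c) = gline u v c.
  have dotNr x : dot x (- c) = - dot x c.
    by rewrite /dot -sumrN; apply: eq_bigr => i _; rewrite mxE mulrN.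
  rewrite /gline /gram (dotC (- c) v) !dotNr (dotC (- c) c) dotNr (dotC v c).
  congr (_ + _ *+ 2 *: _ + _ *: _); last by ring.
  by rewrite mulrN cv; ring.
rewrite (poly_log_deriv_eq0 (a := 2) (d := n.+1%:R)
  (g := gline u v c) (q := wline k u v c - wline k u v (- c))) ?horner0 ?pnatr_eq0 //.
- have := wline_ode u v (- c); rewrite gE => E.
  by rewrite derivB !mulrBr !scalerBr E wline_ode.
- by rewrite hornerD hornerN !wline_horner !scale0r subrr.
- by rewrite gline_horner scale0r add0r.
Qed.

Lemma dot_bas (i j : 'I_N) : dot (bas i) (bas j) = (i == j)%:R :> K.
Proof.
rewrite /dot (bigD1 i) //= big1 => [|l li]; last by rewrite !mxE (negPf li) mul0r.
by rewrite !mxE !eqxx !andbT mul1r addr0.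
Qed.

Lemma gram_bas (i j : 'I_N) : i != j -> gram (bas i) (bas j) = 1 :> K.
Proof. by move=> ij; rewrite /gram !dot_bas !eqxx (negPf ij) expr0n subr0 mulr1. Qed.

(** Moving one vector at a time carries the zero from (e_i, e_j) to every pair, as long as Gram
    determinants stay nonzero. The exceptional pairs are reached by density: along w + t e_j the
    Gram determinant with e_i is a polynomial in t with leading coefficient 1. *)
Lemma wdiag_bas_eq0 (i j : 'I_N) : i != j -> wdiag k (bas i) (bas j) = 0 ->
  forall u v, wdiag k u v = 0.
Proof.
move=> ij k0 z w; have g1 := gram_bas ij.
have gramC u v : gram u v = gram v u by rewrite /gram (dotC v u) mulrC.
have swap0 u v : wdiag k u v = 0 -> wdiag k v u = 0 by rewrite (wdiag_swap u v) => ->; rewrite mulr0.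
have k_bas v : wdiag k (bas i) v = 0 by apply: wdiag_move_eq0 k0 _; rewrite g1 oner_eq0.
have : wline k z w (bas j) * gline (bas i) w (bas j) = 0.
  apply: poly_eq0_numField => t; rewrite hornerM wline_horner gline_horner.
  have [->|g0] := eqVneq (gram (bas i) (t *: bas j + w)) 0; first by rewrite mulr0.
  rewrite gramC in g0; rewrite swap0 ?mul0r //.
  by apply: wdiag_move_eq0 g0; apply: swap0.
move/eqP; rewrite mulf_eq0 => /orP[/eqP q0|/eqP/(congr1 (fun q : {poly K} => q`_2))].
  by have := wline_horner z w (bas j) 0; rewrite q0 horner0 scale0r add0r.
rewrite /= !(coefD, coefZ, coefC, coefX, coefXn) g1 mulr0 !add0r mulr1 => /eqP.
by rewrite oner_eq0.
Qed.

(* The Gram determinant, hence also k, is even in t along the two lines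
   e_i ^ (e_j + t e_l) and e_i ^ (e_l + t e_j); for n even, k is odd under
   a sign change of the wedge. *)
Lemma wdiag_odd (i j l : 'I_N) : i != j -> i != l -> j != l -> ~~ odd n ->
  wdiag k (bas i) (bas j) = 0.
Proof.
move=> ij il jl n_even; have n1 : (-1) ^+ n.+1 = -1 :> K by rewrite -signr_odd /= n_even expr1.
have lj : l != j by rewrite eq_sym.
have oppdiag u v : wdiag k u (- v) = - wdiag k u v by rewrite wdiagN n1 mulN1r.
have flip a b : i != a -> i != b -> a != b ->
    wdiag k (bas i) (bas b + bas a) = wdiag k (bas i) (- bas b + bas a).
  move=> ia ib ab; have := @wdiag_even (bas i) (bas a) (bas b) 1.
  rewrite !scale1r; apply; last by rewrite gram_bas ?oner_eq0.
  by rewrite !dot_bas (eq_sym b) (negPf ab) (negPf ia) (negPf ib) mul0r mulr0.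
have s0 : wdiag k (bas i) (bas l + bas j) = 0.
  have E : wdiag k (bas i) (bas l + bas j) = - wdiag k (bas i) (bas l + bas j).
    have jlE : - bas l + bas j = - (- bas j + bas l) :> V by rewrite opprD opprK addrC.
    by rewrite {1}(flip j l ij il jl) jlE oppdiag -(flip l j il ij lj) [in RHS]addrC.
  by move/eqP: E; rewrite -addr_eq0 -mulr2n mulrn_eq0 => /eqP.
apply: (wdiag_move_eq0 (bas j) s0).
rewrite -[bas l]scale1r.
rewrite /gram !dot_linr !dot_linl !dot_bas !eqxx (eq_sym l) (negPf ij) (negPf il) (negPf jl).
by rewrite !(mulr0, mul1r, addr0, add0r) expr0n subr0 -natrD pnatr_eq0.
Qed.

Lemma pairing_odd_eq0 : (2 < N)%N -> ~~ odd n -> forall x y, k x y = 0.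
Proof.
move=> N3; pose o m (lt_m : (m < 3)%N) : 'I_N := Ordinal (leq_trans lt_m N3).
move=> n_even; apply: wdiag_eq0; apply: (@wdiag_bas_eq0 (@o 0 isT) (@o 1 isT)) => //.
exact: (@wdiag_odd _ _ (@o 2 isT)).
Qed.

End Diagonal.
End WedgeVanishing.

(** * Homogeneous components and the classification *)

Section HomogeneousComponents.
Context {K : numFieldType} {N : nat}.
Local Notation so_dim := #|{: so_coord N}|.
Local Notation so_poly := (mpoly so_dim K).
Local Notation so := (so K N).
Local Notation act := (@so_act K N).
Local Notation V := 'cV[K]_N.
Implicit Types (u v w x y z c : V) (p q : so_poly) (t : K) (k : V -> V -> so_poly).

Lemma pihomog_comm (D : so_poly -> so_poly) (e f : nat) :
  (forall t p q, D (t *: p + q) = t *: D p + D q) ->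
  (forall d p, p \is d.-homog -> pihomog mdeg f (D p) = if d == e then D p else 0) ->
  forall p, pihomog mdeg f (D p) = D (pihomog mdeg e p).
Proof.
move=> Dlin Dhom; have D0 : D 0 = 0.
  by have := Dlin (-1) 0 0; rewrite scaler0 addr0 scaleN1r addNr.
elim/mpolyind => [|t m p _ _ IH]; first by rewrite !(D0, pihomog0).
rewrite Dlin !linearP /= IH Dlin pihomogX (Dhom (mdeg m)) ?dhomogX //.
by case: eqP; rewrite ?D0.
Qed.

Lemma pihomog_wderiv n x y p :
  pihomog mdeg n (wderiv x y p) = wderiv x y (pihomog mdeg n.+1 p).
Proof.
apply: pihomog_comm => {p} [*|[|d] p hp]; first exact: wderiv_lin.
  by rewrite [p]homog0_const // /wderiv /vderiv dirderivC pihomog0.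
have := vderiv_homog (wdir x y) hp; rewrite eqSS /= => dp.
by case: eqP => [<-|/eqP ne]; [exact: pihomog_dE | exact: pihomog_ne0 ne dp].
Qed.

Lemma pihomog_ad_deriv n a p :
  pihomog mdeg n (ad_deriv a p) = ad_deriv a (pihomog mdeg n p).
Proof.
apply: pihomog_comm => {p} [*|d p hp]; first exact: dirderiv_lin.
have dp : ad_deriv a p \is d.-homog.
  case: d hp => [|d] hp.
    by rewrite [p]homog0_const // /ad_deriv dirderivC dhomog0.
  apply: rpred_sum => k _; rewrite -[d.+1]add1n; apply: dhomogM.
    by apply: rpred_sum => l _; apply: dhomogZ; rewrite dhomogX /= mdeg1.
  exact: mderiv_homog hp.
by case: eqP => [<-|/eqP ne]; [exact: pihomog_dE | exact: pihomog_ne0 ne dp].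
Qed.

Lemma so_pairing_pihomog n k : so_pairing k -> so_pairing (fun x y => pihomog mdeg n (k x y)).
Proof.
case=> linl linr alt ad; split=> [*|*|*|a x y].
- by rewrite linl linearP.
- by rewrite linr linearP.
- by rewrite alt pihomog0.
- by rewrite -pihomog_ad_deriv -ad pihomogD.
Qed.

Lemma plucker_closed_pihomog n k :
  plucker_closed k -> plucker_closed (fun x y => pihomog mdeg n (k x y)).
Proof.
case: n => [|n] kc x y z w; last by rewrite -!pihomog_wderiv -!pihomogD kc pihomog0.
have w0 u v p : wderiv u v (pihomog mdeg 0 p) = 0.
  by rewrite (homog0_const (pihomogP mdeg 0 p)) /wderiv /vderiv dirderivC.
by rewrite !w0 !addr0.
Qed.

Lemma so_pairing_lin t k k' : so_pairing k -> so_pairing k' ->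
  so_pairing (fun x y => t *: k x y + k' x y).
Proof.
case=> linl linr alt ad [linl' linr' alt' ad']; split=> [s x x' y|x s y y'|x|a x y].
- by rewrite linl linl' !scalerDr !scalerA mulrC addrACA.
- by rewrite linr linr' !scalerDr !scalerA mulrC addrACA.
- by rewrite alt alt' scaler0 addr0.
- rewrite addrACA -scalerDr ad ad'; exact/esym/dirderiv_lin.
Qed.

Lemma plucker_closed_lin t k k' : plucker_closed k -> plucker_closed k' ->
  plucker_closed (fun x y => t *: k x y + k' x y).
Proof.
move=> kc kc' x y z w; rewrite !wderiv_lin [X in _ + X = _]addrACA [LHS]addrACA -!scalerDr.
by rewrite kc kc' scaler0 addr0.
Qed.

Lemma plucker_closed_sum m (z : 'I_m -> K) (G : nat -> V -> V -> so_poly) :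
  (forall j, plucker_closed (G j)) ->
  plucker_closed (fun x y => \sum_(j < m) z j *: G j x y).
Proof.
elim: m z G => [|m IH] z G Gc.
  move=> x y u v; rewrite !big_ord0 /wderiv /vderiv !dirderiv0 !addr0 //.
have Gc' := IH (fun j => z (lift ord0 j)) (fun j => G j.+1) (fun j => Gc j.+1).
by move=> x y u v; rewrite !big_ord_recl; exact: (plucker_closed_lin (z ord0) (Gc 0%N) Gc').
Qed.

Lemma so_pairing_msize k : so_pairing k ->
  exists M, forall x y, (msize (k x y)%R <= M)%N.
Proof.
case=> linl linr _ _.
exists (\max_(ij : 'I_N * 'I_N) msize (k (bas ij.1) (bas ij.2)))%N => x y.
rewrite (linear_basE (f := fun x => k x y)); last by move=> *; exact: linl.
apply: msize_sum_le => i _; rewrite (leq_trans (msizeZ_le _ _)) //.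
rewrite (linear_basE (f := k (bas i))); last by move=> *; exact: linr.
apply: msize_sum_le => j _; rewrite (leq_trans (msizeZ_le _ _)) //.
exact: (leq_bigmax (i, j)).
Qed.

Lemma sum_parity (M : zmodType) m (F : nat -> M) :
  \sum_(n < m.*2) F n = \sum_(j < m) (F j.*2 + F j.*2.+1).
Proof.
elim: m => [|m IH]; first by rewrite !big_ord0.
by rewrite doubleS !big_ord_recr /= IH addrA.
Qed.

Lemma classification (G : nat -> V -> V -> so_poly) (i0 i1 : 'I_N) k :
  (2 < N)%N -> i0 != i1 ->
  (forall j, so_pairing (G j)) -> (forall j, plucker_closed (G j)) ->
  (forall j x y, G j x y \is j.*2.+1.-homog) ->
  (forall j, wdiag (G j) (bas i0) (bas i1) != 0) ->
  so_pairing k ->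
  plucker_closed k <->
  exists m (z : 'I_m.+1 -> K), forall x y, k x y = \sum_(j < m.+1) z j *: G j x y.
Proof.
move=> N3 i01 Gp Gc Gh G0 kp; split=> [kc|[m [z kE]] x y u v]; last first.
  have := plucker_closed_sum z Gc x y u v.
  by rewrite !kE.
have [M leM] := so_pairing_msize kp.
pose kn n x y := pihomog mdeg n (k x y).
have knp n : so_pairing (kn n) := so_pairing_pihomog n kp.
have knc n : plucker_closed (kn n) := plucker_closed_pihomog n kc.
have knh n x y : kn n x y \is n.-homog := pihomogP _ _ _.
(* The ratio for which the difference [h] vanishes at the single value that determines a homogeneous
   solution. *)
pose z j := wdiag (kn j.*2.+1) (bas i0) (bas i1) / wdiag (G j) (bas i0) (bas i1).
have knE j x y : kn j.*2.+1 x y = z j *: G j x y.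
  pose h x y := (- z j) *: G j x y + kn j.*2.+1 x y.
  have hp : so_pairing h := so_pairing_lin _ (Gp j) (knp _).
  have hc : plucker_closed h := plucker_closed_lin _ (Gc j) (knc _).
  have hh x' y' : h x' y' \is j.*2.+1.-homog by rewrite rpredD ?rpredZ ?Gh ?knh.
  have : h x y = 0.
    apply: (wdiag_eq0 hp hc hh); apply: (wdiag_bas_eq0 hp hc hh i01).
    by rewrite /wdiag /h wevD wevZ -!/(wdiag _ _ _) mulNr divfK ?addNr.
  by move/eqP; rewrite /h scaleNr addrC subr_eq0 => /eqP.
(* [M] bounds [msize], so the components of degree below [M.+1.*2] exhaust [k x y]. Paired by parity
   they give [M.+1] terms, of which the even halves vanish. *)
exists M, (fun j => z j) => x y.
rewrite [LHS](pihomog_partitionE (mf := mdeg) (k := M.+1.*2)); last first.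
  by rewrite (leq_trans (leM x y)) // -addnn addSn leqW // leq_addr.
rewrite (sum_parity _ (fun n => kn n x y)); apply: eq_bigr => j _.
rewrite knE (pairing_odd_eq0 (knp _) (knc _) (knh _) N3) ?add0r //.
by rewrite odd_double.
Qed.

End HomogeneousComponents.

(** * The polynomials gamma *)

Section Derivation.
Context {P : comNzRingType}.
Variable D : P -> P.
Hypothesis D_add : forall p q, D (p + q) = D p + D q.
Hypothesis D_mul : forall p q, D (p * q) = D p * q + p * D q.

Lemma derivation0 : D 0 = 0.
Proof. by apply: (addrI (D 0)); rewrite -D_add !addr0. Qed.
Lemma derivation1 : D 1 = 0.
Proof.
by apply: (addrI (D 1)); rewrite addr0 -{3}[1]mulr1 D_mul mulr1 mul1r.
Qed.
Lemma derivationN p : D (- p) = - D p.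
Proof. by apply: (addrI (D p)); rewrite -D_add !subrr derivation0. Qed.
Lemma derivation_sum J (r : seq J) (Q : pred J) F :
  D (\sum_(i <- r | Q i) F i) = \sum_(i <- r | Q i) D (F i).
Proof. exact: (big_morph D D_add derivation0). Qed.
Lemma derivation_exp p n : D (p ^+ n) = (p ^+ n.-1 * D p) *+ n.
Proof.
elim: n => [|[|n] IH]; first by rewrite derivation1.
  by rewrite expr1 mul1r.
by rewrite exprS D_mul IH /= mulrnAr mulrA -exprS (mulrC (D p)) -mulrS.
Qed.
Lemma derivation_bigprod (I : finType) (F : I -> P) :
  D (\prod_i F i) = \sum_i \prod_j (if j == i then D (F j) else F j).
Proof.
suff H (r : seq I) : uniq r -> D (\prod_(i <- r) F i) =
    \sum_(i <- r) \prod_(j <- r) (if j == i then D (F j) else F j).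
  by rewrite H // index_enum_uniq.
elim: r => [_|i r IH /= /andP[ir /IH{}IH]]; first by rewrite !big_nil derivation1.
rewrite !big_cons D_mul IH eqxx mulr_sumr; congr (_ * _ + _).
  by apply: eq_big_seq => j jr; case: eqP => // ji; move: ir; rewrite -ji jr.
apply: eq_big_seq => j jr; rewrite big_cons; case: eqP => // ij.
by move: ir; rewrite ij jr.
Qed.

(** Jacobi's formula: the determinant is differentiated row by row, and each [A' i] is expanded
    along its differentiated row. *)
Lemma derivation_det n (A : 'M[P]_n) : D (\det A) = \tr (\adj A *m map_mx D A).
Proof.
pose A' i : 'M[P]_n := \matrix_(r, c) (if r == i then D (A r c) else A r c).
have DA' i : \det (A' i) = \sum_j D (A i j) * cofactor A i j.
  rewrite (expand_det_row _ i); apply: eq_bigr => j _; rewrite mxE eqxx.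
  congr (_ * (_ * \det _)); apply/matrixP => r c; rewrite !mxE.
  by rewrite eq_sym (negPf (neq_lift _ _)).
transitivity (\sum_i \det (A' i)).
  rewrite /determinant derivation_sum exchange_big; apply: eq_bigr => s _ /=.
  rewrite D_mul derivation_bigprod mulr_sumr.
  have -> : D ((-1) ^+ s) = 0.
    by case: (s : bool); rewrite ?expr1 ?derivationN derivation1 ?oppr0.
  rewrite mul0r add0r; apply: eq_bigr => i _; congr (_ * _).
  by apply: eq_bigr => j _; rewrite mxE.
under eq_bigr do rewrite DA'.
rewrite exchange_big /mxtrace; apply: eq_bigr => j _; rewrite mxE.
by apply: eq_bigr => i _; rewrite !mxE mulrC.
Qed.

Lemma derivation_mulmx l m n (A : 'M[P]_(l, m)) (B : 'M[P]_(m, n)) :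
  map_mx D (A *m B) = map_mx D A *m B + A *m map_mx D B.
Proof.
apply/matrixP => i j; rewrite !mxE derivation_sum -big_split.
by apply: eq_bigr => k _; rewrite !mxE D_mul.
Qed.

(** The series (1 + s)^(-1/2) satisfies (1 + s) S' = - s' S / 2. Truncation leaves a multiple of s^m
    s', by the recurrence (m + 1/2) b_m = - (m + 1) b_(m+1) of the binomial coefficients. *)
Lemma derivation_binom (K : numFieldType) (f : {rmorphism K -> P}) m (s : P) :
  (forall c, D (f c) = 0) ->
  let S := \sum_(n < m.+1) f (gen_binom (- 2^-1) n) * s ^+ n in
  (1 + s) * D S = f (- 2^-1) * D s * S
    + f ((m%:R + 2^-1) * gen_binom (- 2^-1) m) * s ^+ m * D s.
Proof.
move=> Df; elim: m => [|m IH] /=; set b := gen_binom _.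
  have b0 : b 0%N = 1 by rewrite /b /gen_binom big_ord0 fact0 divr1.
  rewrite !big_ord1 !expr0 !mulr1 Df b0 mulr0 rmorphN rmorph1 add0r !mulr1 mulNr.
  by rewrite addNr.
rewrite big_ord_recr /= D_add mulrDr {}IH D_mul Df mul0r add0r derivation_exp /= -/b.
set S := \sum_(n < m.+1) _.
have bE : (m%:R + 2^-1) * b m = - (m.+1%:R * b m.+1).
  rewrite /b /gen_binom big_ord_recr /= factS natrM; field.
  by rewrite !nat1r !pnatr_eq0 -lt0n fact_gt0.
have -> : f ((m%:R + 2^-1) * b m) = - (m.+1%:R * f (b m.+1)).
  by rewrite bE rmorphN rmorphM rmorph_nat.
have -> : f ((m.+1%:R + 2^-1) * b m.+1) = (m.+1%:R - f (- 2^-1)) * f (b m.+1).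
  by rewrite rmorphM rmorphD rmorph_nat rmorphN opprK.
by rewrite exprS -mulr_natr; ring.
Qed.
End Derivation.

Lemma in_qpolyXn_eq0 (S : comNzRingType) M (p : {poly S}) :
  in_qpoly 'X^(M.+1) p = 0 <-> exists q, p = q * 'X^(M.+1).
Proof.
have hm : mk_monic 'X^(M.+1) = 'X^(M.+1) :> {poly S} by rewrite mk_monic_Xn.
split=> [/(congr1 val) /= E|[q ->]].
  exists (Pdiv.CommonRing.rdivp p 'X^(M.+1)).
  by rewrite {1}(Pdiv.RingMonic.rdivp_eq (monicXn S M.+1) p) -[in X in _ + X]hm E addr0.
by apply: val_inj; rewrite /= hm Pdiv.RingMonic.rmodp_mull ?monicXn.
Qed.

Lemma trace_commutator (Q : comNzRingType) N (G a b : 'M[Q]_N) :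
  \tr (G *m (a *m b - b *m a)) = \tr ((G *m a - a *m G) *m b).
Proof.
rewrite mulmxBr mulmxBl !linearB /= !mulmxA; congr (_ - _).
by rewrite mxtrace_mulC mulmxA.
Qed.

(** * Identities for the resolvent of a skew matrix *)

Section ResolventAlgebra.
Context {Q : comNzRingType} {N : nat}.
Variables (A R : 'M[Q]_N) (t : Q).
Hypothesis A_skew : A^T = - A.
Hypothesis AR : (1%:M + t *: (A *m A)) *m R = 1%:M.
Local Notation E := (A *m R).

Lemma commutator_tr (a : 'M[Q]_N) : a^T = - a -> (A *m a - a *m A)^T = - (A *m a - a *m A).
Proof.
by move=> a_skew; rewrite linearB /= !trmx_mul a_skew A_skew !mulmxN !mulNmx !opprK opprB.
Qed.

Lemma resolvent_l : R *m (1%:M + t *: (A *m A)) = 1%:M.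
Proof. exact: mulmx1C AR. Qed.

Lemma resolventC : R *m A = A *m R.
Proof.
have cA : (1%:M + t *: (A *m A)) *m A = A *m (1%:M + t *: (A *m A)).
  by rewrite mulmxDl mulmxDr mul1mx mulmx1 -scalemxAl -scalemxAr mulmxA.
by rewrite -[LHS]mulmx1 -AR mulmxA -(mulmxA R) -cA !mulmxA resolvent_l mul1mx.
Qed.

Lemma resolvent_tr : R^T = R.
Proof.
have E1 : R^T *m (1%:M + t *: (A *m A)) = 1%:M.
  have := congr1 trmx AR; rewrite trmx_mul trmx1 linearD /= trmx1 linearZ /=.
  by rewrite trmx_mul A_skew mulmxN mulNmx opprK.
by rewrite -[LHS]mulmx1 -AR mulmxA E1 mul1mx.
Qed.

Lemma resolventE : R = 1%:M - t *: (A *m R *m A).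
Proof.
apply/eqP; rewrite eq_sym subr_eq -{1}AR mulmxDl mul1mx -scalemxAl -mulmxA -resolventC.
by rewrite mulmxA -resolventC.
Qed.

(** The hypothesis is the derivative of (1 + t A^2) R = 1, with [B] the derivative of A. It is
    solved for [DR], and the surplus term is absorbed by R = 1 - t A R A. *)
Lemma resolvent_deriv (B DR : 'M[Q]_N) :
  t *: (B *m A + A *m B) *m R + (1%:M + t *: (A *m A)) *m DR = 0 ->
  B *m R + A *m DR = R *m B *m R - t *: (E *m B *m E).
Proof.
move=> /eqP; rewrite addrC addr_eq0 => /eqP DRE.
have {DRE} -> : DR = - t *: (R *m B *m A *m R + R *m A *m B *m R).
  rewrite -[DR]mul1mx -resolvent_l -mulmxA DRE mulmxN -scalemxAl -scalemxAr scaleNr.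
  by rewrite mulmxDl mulmxDr !mulmxA.
rewrite [X in _ = X *m B *m R - _]resolventE !mulmxBl mul1mx -!scalemxAl.
rewrite -scalemxAr mulmxDr scaleNr scalerDr opprD addrA addrAC !mulmxA; congr (_ - _ - _).
Qed.

(** E is built from A alone, so its derivative in the direction [A, a] has to be [E, a]. The
    identities [E1] and [E2] insert 1 = R + t A^2 R next to [a], on the side where a factor R is
    missing. *)
Lemma resolvent_ad (a B : 'M[Q]_N) : B = A *m a - a *m A ->
  R *m B *m R - t *: (E *m B *m E) = E *m a - a *m E.
Proof.
move=> ->; have E1 : R + t *: (A *m A *m R) = 1%:M.
  by rewrite -AR mulmxDl mul1mx -scalemxAl.
have E2 : R + t *: (R *m A *m A) = 1%:M.
  by rewrite -resolvent_l mulmxDr mulmx1 -scalemxAr mulmxA.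
have -> : E *m a = A *m R *m a *m R + t *: (A *m R *m a *m A *m A *m R).
  by rewrite -[LHS]mulmx1 -E1 mulmxDr -scalemxAr !mulmxA.
have -> : a *m E = R *m a *m A *m R + t *: (R *m A *m A *m a *m A *m R).
  by rewrite -[LHS]mul1mx -E2 mulmxDl -scalemxAl !mulmxA.
rewrite !(mulmxBr, mulmxBl) !mulmxA resolventC scalerBr opprB opprD.
by rewrite [LHS]addrACA.
Qed.

Lemma resolvent_trace_ad (a : 'M[Q]_N) : \tr (E *m (A *m a - a *m A)) = 0.
Proof.
rewrite mulmxBr linearB /= !mulmxA [X in _ - X]mxtrace_mulC !mulmxA.
by rewrite -(mulmxA A R) resolventC !mulmxA subrr.
Qed.

Lemma det_resolvent_trace (B : 'M[Q]_N) :
  \tr (\adj (1%:M + t *: (A *m A)) *m (t *: (B *m A + A *m B))) =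
  \det (1%:M + t *: (A *m A)) * (t * \tr (E *m B) *+ 2).
Proof.
have adjE : \adj (1%:M + t *: (A *m A)) = \det (1%:M + t *: (A *m A)) *: R.
  by rewrite -[LHS]mulmx1 -[X in _ *m X]AR mulmxA mul_adj_mx mul_scalar_mx.
rewrite adjE -scalemxAl -scalemxAr mulmxDr !linearZ /= linearD /= mulmxA mxtrace_mulC.
by rewrite mulmxA (mulmxA R) resolventC -mulr2n mulrnAr.
Qed.

Definition bil (M : 'M[Q]_N) (x y : 'cV[Q]_N) : Q := (x^T *m M *m y) 0 0.

Lemma bilD M M' x y : bil (M + M') x y = bil M x y + bil M' x y.
Proof. by rewrite /bil mulmxDr mulmxDl mxE. Qed.
Lemma bilN M x y : bil (- M) x y = - bil M x y.
Proof. by rewrite /bil mulmxN mulNmx mxE. Qed.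
Lemma bilZ c M x y : bil (c *: M) x y = c * bil M x y.
Proof. by rewrite /bil -scalemxAr -scalemxAl mxE. Qed.

Lemma bil_tr M x y : bil M^T x y = bil M y x.
Proof.
rewrite /bil (_ : _ *m y = (y^T *m M *m x)^T); first by rewrite [LHS]mxE.
by rewrite !trmx_mul trmxK mulmxA.
Qed.

Lemma bil_wedge M M' x y z w :
  bil (M *m (z *m w^T - w *m z^T) *m M') x y =
  bil M x z * bil M' w y - bil M x w * bil M' z y.
Proof.
have H (u v : 'cV[Q]_N) : bil (M *m (u *m v^T) *m M') x y = bil M x u * bil M' v y.
  rewrite /bil (_ : _ *m y = (x^T *m M *m u) *m (v^T *m M' *m y)); last by rewrite !mulmxA.
  by rewrite mxE big_ord1.
by rewrite mulmxBr mulmxBl bilD bilN !H.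
Qed.

Lemma bil_resolvent_sym x y : bil R y x = bil R x y.
Proof. by rewrite -bil_tr resolvent_tr. Qed.

Lemma bil_resolvent_anti x y : bil E y x = - bil E x y.
Proof. by rewrite -bil_tr trmx_mul resolvent_tr A_skew mulmxN resolventC bilN. Qed.

Lemma trace_wedge M z w : \tr (M *m (z *m w^T - w *m z^T)) = bil M w z - bil M z w.
Proof.
have H (u v : 'cV[Q]_N) : \tr (M *m (u *m v^T)) = bil M v u.
  by rewrite mulmxA mxtrace_mulC /bil -mulmxA /mxtrace big_ord1.
by rewrite mulmxBr linearB /= !H.
Qed.

(** R is symmetric, so its terms cancel in the cyclic sum. E is skew, and its terms in F are t d (2
    P1 - P2 - P3), where P1 = E(x,y) E(z,w), P2 = E(y,z) E(x,w) and P3 = E(z,x) E(y,w). The 2 comes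
    from tr(E (z^w)) = - 2 E(z,w); cyclic permutation of x, y, z permutes the three products. *)
Lemma resolvent_plucker (d : Q) x y z w :
  let F x y z w := (bil (R *m (z *m w^T - w *m z^T) *m R
      - t *: (E *m (z *m w^T - w *m z^T) *m E)) x y) * d
    + bil E x y * (- (t * \tr (E *m (z *m w^T - w *m z^T))) * d) in
  F x y z w + (F y z x w + F z x y w) = 0.
Proof.
rewrite /= !(bilD, bilN, bilZ) !bil_wedge !trace_wedge.
rewrite ?(bil_resolvent_anti x z) ?(bil_resolvent_anti x y) ?(bil_resolvent_anti y z).
rewrite ?(bil_resolvent_anti x w) ?(bil_resolvent_anti y w) ?(bil_resolvent_anti z w).
rewrite ?(bil_resolvent_sym x z) ?(bil_resolvent_sym x y) ?(bil_resolvent_sym y z).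
rewrite ?(bil_resolvent_sym x w) ?(bil_resolvent_sym y w) ?(bil_resolvent_sym z w).
ring.
Qed.

Lemma resolvent_equivariant (a B : 'M[Q]_N) (d : Q) x y : a^T = - a -> B = A *m a - a *m A ->
  bil E (a *m x) y * d + bil E x (a *m y) * d =
  bil (R *m B *m R - t *: (E *m B *m E)) x y * d
    + bil E x y * (- (t * \tr (E *m B)) * d).
Proof.
move=> a_skew BE; rewrite (resolvent_ad BE) BE resolvent_trace_ad.
rewrite mulr0 oppr0 mul0r mulr0 addr0 -mulrDl bilD bilN addrC; congr ((_ + _) * _).
  by rewrite /bil !mulmxA.
by rewrite -bilN /bil trmx_mul a_skew !mulmxN !mulNmx !mulmxA.
Qed.
End ResolventAlgebra.

Lemma exprmxZ (S : comNzRingType) n (c : S) (A : 'M[S]_n) k :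
  (c *: A) ^+ k = c ^+ k *: A ^+ k.
Proof.
elim: k => [|k IH]; first by rewrite !expr0 scale1r.
by rewrite !exprS IH -!mulmxE -scalemxAl -scalemxAr scalerA.
Qed.

Section CoefficientDerivation.
Context {S : comNzRingType}.
Variable d : S -> S.
Hypothesis d_add : forall p q, d (p + q) = d p + d q.
Hypothesis d_mul : forall p q, d (p * q) = d p * q + p * d q.
Let d0 : d 0 = 0. Proof. exact: derivation0. Qed.

Definition coefwise (p : {poly S}) : {poly S} := \poly_(i < size p) d p`_i.

Lemma coef_coefwise p i : (coefwise p)`_i = d p`_i.
Proof. by rewrite coef_poly; case: ltnP => // le_pi; rewrite nth_default. Qed.

Lemma coefwiseD p q : coefwise (p + q) = coefwise p + coefwise q.
Proof. by apply/polyP => i; rewrite coefD !coef_coefwise coefD d_add. Qed.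

Lemma coefwiseM p q : coefwise (p * q) = coefwise p * q + p * coefwise q.
Proof.
apply/polyP => i; rewrite coefD !coef_coefwise !coefM (derivation_sum d_add).
by rewrite -big_split; apply: eq_bigr => j _; rewrite d_mul !coef_coefwise.
Qed.

Lemma coefwiseC c : coefwise c%:P = (d c)%:P.
Proof. by apply/polyP => i; rewrite coef_coefwise !coefC; case: eqP. Qed.

Lemma coefwiseX n : coefwise 'X^n = 0.
Proof.
apply/polyP => i; rewrite coef_coefwise coefXn coef0.
by case: eqP => // _; exact: derivation1.
Qed.
End CoefficientDerivation.

(** * Differentiating the generating series of gamma *)

Section GammaDerivation.
Context {K : numFieldType} {N : nat}.
Variable m : nat.
Local Notation so_dim := #|{: so_coord N}|.
Local Notation so_poly := (mpoly so_dim K).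
Local Notation P := {poly so_poly}.
Local Notation cst := (@const_poly K N).
Local Notation A := (map_mx polyC (generic_mx K N) : 'M[P]_N).
Local Notation T := ('X ^+ 2 *: (A *m A) : 'M[P]_N).
Local Notation R := (resolvent_series K N m).
Local Notation delta := (det_series K N m).
Local Notation M := (2 * m).+1.
Local Notation V := 'cV[K]_N.

Lemma gen_binomN1 n : gen_binom (-1 : K) n = (-1) ^+ n.
Proof.
rewrite /gen_binom; elim: n => [|n IH]; first by rewrite big_ord0 divr1.
rewrite exprSr -IH big_ord_recr /= factS natrM; field.
by rewrite !nat1r !pnatr_eq0 -lt0n fact_gt0.
Qed.

Lemma generic_tr : (generic_mx K N)^T = - generic_mx K N.
Proof. by apply/matrixP => i j; rewrite mxE generic_skew [RHS]mxE. Qed.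

(** The binomial coefficients of exponent -1 are signs, so the product telescopes and leaves a
    multiple of T^(m+1), which carries tau^(2m+2). *)
Lemma resolvent_seriesE :
  exists X, (1%:M + T) *m R = 1%:M + 'X^(M.+1) *: X.
Proof.
have gE n : cst (gen_binom (-1) n) = (-1) ^+ n.
  by rewrite gen_binomN1 /const_poly !(rmorphXn, rmorphN, rmorph1).
exists ((-1) ^+ m *: (A *m A) ^+ m.+1).
have -> : 'X^(M.+1) *: ((-1) ^+ m *: (A *m A) ^+ m.+1) = (-1) ^+ m *: T ^+ m.+1.
  rewrite exprmxZ -exprM [LHS]scalerA [RHS]scalerA [in RHS]mulrC.
  by congr (_ ^+ _ * _ *: _); rewrite mulnS.
rewrite /resolvent_series; move: T => U; elim: m => [|n IH].
  by rewrite big_ord1 gE !expr0 !scale1r expr1 mulmx1.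
rewrite big_ord_recr /= mulmxDr {}IH mulmxDl mul1mx gE -addrA; congr (_ + _).
have sgnS : (-1) ^+ n.+1 = - (-1) ^+ n :> P by rewrite exprS mulN1r.
rewrite -scalemxAr mulmxE -[U * U ^+ _]exprS addrA -scalerDl sgnS subrr.
by rewrite scale0r add0r.
Qed.
End GammaDerivation.

Section GammaDerivation.
Context {K : numFieldType} {N : nat}.
Variable m : nat.
Local Notation so_dim := #|{: so_coord N}|.
Local Notation so_poly := (mpoly so_dim K).
Local Notation P := {poly so_poly}.
Local Notation cst := (@const_poly K N).
Local Notation A := (map_mx polyC (generic_mx K N) : 'M[P]_N).
Local Notation T := ('X ^+ 2 *: (A *m A) : 'M[P]_N).
Local Notation R := (resolvent_series K N m).
Local Notation delta := (det_series K N m).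
Local Notation M := (2 * m).+1.
Local Notation V := 'cV[K]_N.

Lemma det_seriesE : exists s, \det (1%:M + T) = 1 + s * 'X^2.
Proof.
have : in_qpoly 'X^2 (\det (1%:M + T) - 1) = 0.
  rewrite rmorphB -det_map_mx map_mxD map_mx1 map_mxZ /=.
  have -> : in_qpoly 'X^2 ('X^2 : P) = 0.
    by apply/in_qpolyXn_eq0; exists 1; rewrite mul1r.
  by rewrite scale0r addr0 det1 in_qpoly1 subrr.
by case/in_qpolyXn_eq0 => s Es; exists s; rewrite -Es [RHS]addrC subrK.
Qed.

(* [pi] is reduction modulo tau^(2m+2), after which the truncated series are
   exact. With E = A R and B = d A the claim is
   d E = R B R - tau^2 E B E and d delta = - tau^2 tr(E B) delta. *)
Section Derivation.
Variable d : so_poly -> so_poly.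
Hypothesis d_add : forall p q, d (p + q) = d p + d q.
Hypothesis d_mul : forall p q, d (p * q) = d p * q + p * d q.
Hypothesis d_const : forall c, d c%:MP = 0.
Variables (Q : comNzRingType) (pi : {rmorphism P -> Q}).
Hypothesis pi_trunc : pi 'X^(M.+1) = 0.
Local Notation D := (coefwise d).
Local Notation bar := (map_mx pi).
Local Notation t := (pi ('X ^+ 2)).
Local Notation B := (bar (map_mx polyC (map_mx d (generic_mx K N)))).
Let D_add := coefwiseD d_add.
Let D_mul := coefwiseM d_add d_mul.

Lemma coefwise_mxZ n (Y : 'M[P]_N) : map_mx D ('X^n *: Y) = 'X^n *: map_mx D Y.
Proof.
by apply/matrixP => i j; rewrite !mxE D_mul coefwiseX // mul0r add0r.
Qed.

Lemma coefwise_const c : D (cst c) = 0.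
Proof. by rewrite /const_poly coefwiseC // d_const. Qed.

Lemma coefwise_mx1 (Y : 'M[P]_N) : map_mx D (1%:M + Y) = map_mx D Y.
Proof.
apply/matrixP => i j; rewrite !mxE D_add.
have -> : D (i == j)%:R = 0 by case: eqP => _; rewrite ?(derivation0 D_add) ?(derivation1 D_mul).
by rewrite add0r.
Qed.

Lemma coefwise_generic :
  map_mx D (1%:M + T) = 'X^2 *: (map_mx D A *m A + A *m map_mx D A).
Proof. by rewrite coefwise_mx1 coefwise_mxZ derivation_mulmx. Qed.

Lemma barA : bar (map_mx D A) = B.
Proof. by apply/matrixP => i j; rewrite !mxE coefwiseC. Qed.

Lemma barT : bar (1%:M + T) = 1%:M + t *: (bar A *m bar A).
Proof. by rewrite map_mxD map_mx1 map_mxZ map_mxM. Qed.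

Lemma barR : (1%:M + t *: (bar A *m bar A)) *m bar R = 1%:M.
Proof.
have [X EX] := @resolvent_seriesE K N m.
by rewrite -barT -map_mxM EX map_mxD map_mx1 map_mxZ pi_trunc scale0r addr0.
Qed.

Lemma bar_tr : (bar A)^T = - bar A.
Proof. by rewrite !map_trmx generic_tr !map_mxN. Qed.

Lemma bar_resolvent_deriv : B *m bar R + bar A *m bar (map_mx D R) =
  bar R *m B *m bar R - t *: (bar A *m bar R *m B *m (bar A *m bar R)).
Proof.
apply: (resolvent_deriv barR).
have [X EX] := @resolvent_seriesE K N m.
have := congr1 (fun Y => bar (map_mx D Y)) EX; rewrite /= coefwise_mx1 coefwise_mxZ.
rewrite [in RHS]map_mxZ pi_trunc scale0r derivation_mulmx // coefwise_generic.
by rewrite map_mxD !map_mxM barT map_mxZ map_mxD !map_mxM barA.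
Qed.

Lemma bar_det_deriv : pi (D delta) =
  - (t * \tr (bar A *m bar R *m B)) * pi delta.
Proof.
have [s Es] := det_seriesE.
pose f : {rmorphism K -> P} := polyC \o @mpolyC so_dim K.
have := @derivation_binom P D D_add D_mul K f m (\det (1%:M + T) - 1) coefwise_const.
rewrite /= -!/(const_poly _ _) -!/(det_series _ _ _) addrC subrK => E.
move: E; set g := \det (1%:M + T) => E.
have gE : g - 1 = s * 'X^2 by rewrite /g Es addrAC subrr add0r.
have Dg : D (g - 1) = D g.
  by rewrite D_add (derivationN D_add) (derivation1 D_mul) oppr0 addr0.
(* Both [g - 1] and its derivative are divisible by tau^2, so the truncation error of
   [derivation_binom] is divisible by tau^(2m+2). *)
have tail0 : pi ((g - 1) ^+ m * D (g - 1)) = 0.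
  rewrite {2}gE D_mul (coefwiseX d_add) // mulr0 addr0 gE exprMn -exprM mulrACA -exprD.
  by rewrite addn2 rmorphM pi_trunc mulr0.
have piDg : pi (D g) = pi g * (t * \tr (bar A *m bar R *m B) *+ 2).
  rewrite /g (derivation_det D_add D_mul) coefwise_generic -trace_map_mx map_mxM.
  rewrite map_mx_adj barT map_mxZ map_mxD !map_mxM barA.
  by rewrite (det_resolvent_trace barR) -det_map_mx barT.
(* [Q] need not be a domain, so the factor [pi g] is cancelled through an explicit inverse. *)
have g_unit : pi g * \det (bar R) = 1.
  by rewrite -det_map_mx barT -det_mulmx barR det1.
have half : pi (cst (- 2^-1)) *+ 2 = -1.
  rewrite -[cst _]/(f _) -!rmorphMn /= -mulr_natr mulNr mulVf ?pnatr_eq0 //.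
  by rewrite !rmorphN !rmorph1.
rewrite -[X in _ + X]mulrA in E; have F := congr1 pi E.
rewrite rmorphD [pi (_ * (_ ^+ _ * _))]rmorphM tail0 mulr0 addr0 !rmorphM Dg piDg in F.
move: (pi (cst _)) half F => h half F.
rewrite -[LHS]mul1r -g_unit mulrAC F.
set w := t * _; transitivity ((h *+ 2) * (pi g * \det (bar R)) * w * pi delta).
  by ring.
by rewrite half g_unit mulr1 mulN1r.
Qed.

Lemma bar_gamma_deriv (x y : V) :
  let x' := bar (map_mx cst x) in let y' := bar (map_mx cst y) in
  pi (D (bil (A *m R) (map_mx cst x) (map_mx cst y) * delta)) =
  bil (bar R *m B *m bar R - t *: (bar A *m bar R *m B *m (bar A *m bar R))) x' y'
    * pi delta
  + bil (bar A *m bar R) x' y' * (- (t * \tr (bar A *m bar R *m B)) * pi delta).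
Proof.
move=> x' y'; have Dbil Y : D (bil Y (map_mx cst x) (map_mx cst y)) =
    bil (map_mx D Y) (map_mx cst x) (map_mx cst y).
  have Dcst (z : V) : map_mx D (map_mx cst z) = 0.
    by apply/matrixP => i j; rewrite !mxE coefwise_const.
  have trD (z : 'cV[P]_N) : map_mx D z^T = (map_mx D z)^T by rewrite map_trmx.
  transitivity (map_mx D ((map_mx cst x)^T *m Y *m map_mx cst y) 0 0).
    by rewrite [RHS]mxE.
  by rewrite !(derivation_mulmx D_add D_mul) trD !Dcst trmx0 mul0mx add0r mulmx0 addr0.
have pibil Y : pi (bil Y (map_mx cst x) (map_mx cst y)) = bil (bar Y) x' y'.
  transitivity (bar ((map_mx cst x)^T *m Y *m map_mx cst y) 0 0).
    by rewrite [RHS]mxE.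
  by rewrite !map_mxM -map_trmx.
have DE : bar (map_mx D (A *m R)) =
    bar R *m B *m bar R - t *: (bar A *m bar R *m B *m (bar A *m bar R)).
  by rewrite -bar_resolvent_deriv (derivation_mulmx D_add D_mul) map_mxD !map_mxM barA.
rewrite D_mul rmorphD [pi (_ * delta)]rmorphM [pi (_ * D _)]rmorphM Dbil !pibil.
by rewrite bar_det_deriv DE map_mxM.
Qed.
End Derivation.
End GammaDerivation.

Section GammaPairing.
Context {K : numFieldType} {N : nat}.
Local Notation so_dim := #|{: so_coord N}|.
Local Notation so_poly := (mpoly so_dim K).
Local Notation P := {poly so_poly}.
Local Notation cst := (@const_poly K N).
Local Notation A := (map_mx polyC (generic_mx K N) : 'M[P]_N).
Local Notation V := 'cV[K]_N.
Local Notation so := (so K N).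
Local Notation act := (@so_act K N).

Variable m : nat.
Local Notation R := (resolvent_series K N m).
Local Notation delta := (det_series K N m).
Local Notation M := (2 * m).+1.
Variables (Q : comNzRingType) (pi : {rmorphism P -> Q}).
Hypothesis pi_trunc : pi 'X^(M.+1) = 0.
Hypothesis pi_coef : forall p, pi p = 0 -> p`_(2 * m) = 0.
Local Notation bar := (map_mx pi).

Definition gamma_series (x y : V) : P :=
  bil (A *m R) (map_mx cst x) (map_mx cst y) * delta.

Lemma gammaE (x y : V) : gamma m x y = (gamma_series x y)`_(2 * m).
Proof. by []. Qed.

Lemma gamma_eq (p q : P) : pi p = pi q -> p`_(2 * m) = q`_(2 * m).
Proof.
move=> pq; apply/eqP; rewrite -subr_eq0 -coefB; apply/eqP.
by apply: pi_coef; rewrite raddfB /= pq subrr.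
Qed.

Lemma pi_coef3 (p q r : P) : pi p + (pi q + pi r) = 0 ->
  p`_(2 * m) + (q`_(2 * m) + r`_(2 * m)) = 0.
Proof. by rewrite -!raddfD -!coefD => /pi_coef. Qed.

Lemma map_cst n1 n2 (Y : 'M[K]_(n1, n2)) :
  map_mx cst Y = map_mx polyC (map_mx (mpolyC so_dim (R := K)) Y).
Proof. by apply/matrixP => i j; rewrite !mxE. Qed.

Lemma cst_linear c (x y : V) :
  map_mx cst (c *: x + y) = cst c *: map_mx cst x + map_mx cst y.
Proof.
by apply/matrixP => i j; rewrite !mxE /const_poly !(rmorphD, rmorphM).
Qed.

Lemma cst_coef c (p : P) i : (cst c * p)`_i = c *: p`_i.
Proof. by rewrite coefCM mul_mpolyC. Qed.

Lemma gamma_linl c (x x' y : V) : gamma m (c *: x + x') y = c *: gamma m x y + gamma m x' y.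
Proof.
rewrite !gammaE -cst_coef -coefD mulrA -mulrDl /gamma_series.
rewrite /bil cst_linear linearD linearZ /= !mulmxDl -!scalemxAl.
by rewrite [X in X * _]mxE [X in (X + _) * _]mxE.
Qed.

Lemma gamma_linr (x : V) c (y y' : V) : gamma m x (c *: y + y') = c *: gamma m x y + gamma m x y'.
Proof.
rewrite !gammaE -cst_coef -coefD mulrA -mulrDl /gamma_series.
rewrite /bil cst_linear mulmxDr -scalemxAr.
by rewrite [X in X * _]mxE [X in (X + _) * _]mxE.
Qed.

Let barR := barR pi_trunc.

Lemma pi_gamma_series x y : pi (gamma_series x y) =
  bil (bar A *m bar R) (bar (map_mx cst x)) (bar (map_mx cst y)) * pi delta.
Proof.
rewrite rmorphM; congr (_ * _).
transitivity (bar ((map_mx cst x)^T *m (A *m R) *m map_mx cst y) 0 0).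
  by rewrite [RHS]mxE.
by rewrite !map_mxM -map_trmx.
Qed.

Lemma gamma_alt (x : V) : gamma m x x = 0.
Proof.
have nz2 : (2 : K) != 0 by rewrite pnatr_eq0.
apply: (scalerI nz2); rewrite scaler0 scaler_nat gammaE -coefMn.
apply: etrans (coef0 _ (2 * m)); apply: gamma_eq.
rewrite raddf0 raddfMn /= pi_gamma_series -mulrnAl mulr2n.
have E := bil_resolvent_anti (bar_tr pi) barR (bar (map_mx cst x)) (bar (map_mx cst x)).
by rewrite {1}E addNr mul0r.
Qed.

(** In the direction z ^ w the generic matrix has derivative z w^T - w z^T, so [bar_gamma_deriv]
    produces the expression F of [resolvent_plucker]. *)
Lemma gamma_plucker : plucker_closed (gamma m : V -> V -> so_poly).
Proof.
move=> x y z w.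
have Dwedge (x' y' z' w' : V) : wderiv z' w' (gamma m x' y') =
    (coefwise (wderiv z' w') (gamma_series x' y'))`_(2 * m).
  by rewrite (coef_coefwise (wderivD z' w')).
have piD (x' y' z' w' : V) := @bar_gamma_deriv K N m (wderiv z' w')
  (dirderivD _) (dirderivM _) (dirderivC _) _ _ pi_trunc x' y'.
have Bw (z' w' : V) : bar (map_mx polyC (map_mx (wderiv z' w') (generic_mx K N))) =
    bar (map_mx cst z') *m (bar (map_mx cst w'))^T
    - bar (map_mx cst w') *m (bar (map_mx cst z'))^T.
  have -> : map_mx (wderiv z' w') (generic_mx K N) = map_mx (mpolyC so_dim (R := K)) (wedge z' w').
    by apply/matrixP => i j; rewrite [LHS]mxE [RHS]mxE; apply/vderiv_generic/wedge_skew.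
  by rewrite !map_mxB !map_mxM -!map_trmx -!map_cst.
pose u (z' : V) := bar (map_mx cst z').
pose F (Y : 'M[Q]_N) (x' y' : V) :=
  bil (bar R *m Y *m bar R - pi ('X ^+ 2) *: (bar A *m bar R *m Y *m (bar A *m bar R)))
    (u x') (u y') * pi delta
  + bil (bar A *m bar R) (u x') (u y')
    * (- (pi ('X ^+ 2) * \tr (bar A *m bar R *m Y)) * pi delta).
have piF (x' y' z' w' : V) : pi (coefwise (wderiv z' w') (gamma_series x' y')) =
    F (u z' *m (u w')^T - u w' *m (u z')^T) x' y'.
  by rewrite piD Bw.
rewrite (Dwedge x y z w) (Dwedge y z x w) (Dwedge z x y w); apply: pi_coef3.
have := resolvent_plucker (bar_tr pi) barR (pi delta) (u x) (u y) (u z) (u w).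
by apply: etrans; congr (_ + (_ + _)); exact: piF.
Qed.

Lemma trace_so_dual (Y : 'M[so_poly]_N) i j : (forall i j, Y j i = - Y i j) ->
  \tr (Y *m map_mx (mpolyC so_dim (R := K)) (so_dual K i j)) = Y i j.
Proof.
move=> Ys.
have tr_delta k l : \tr (Y *m delta_mx k l) = Y l k.
  rewrite /mxtrace (bigD1 l) //= big1 => [|h hl].
    rewrite addr0 mxE (bigD1 k) //= big1 => [|h hk].
      by rewrite !mxE !eqxx mulr1 addr0.
    by rewrite !mxE (negPf hk) mulr0.
  by rewrite mxE big1 // => q _; rewrite !mxE (negPf hl) andbF mulr0.
rewrite map_mxZ map_mxB !map_delta_mx -scalemxAr mulmxBr linearZ linearB /= !tr_delta.
rewrite (Ys i j) opprK -mulr2n mulrnAr -mulrnAl -rmorphMn -mulr_natr /=.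
by rewrite mulVf ?pnatr_eq0 // mpolyC1 mul1r.
Qed.

Lemma lin_form_trace (b : so) :
  lin_form b = \tr (generic_mx K N *m map_mx (mpolyC so_dim (R := K)) b).
Proof.
rewrite [in RHS](so_basisE b) -[so_mx _]/(val _) raddf_sum /= map_mx_sum mulmx_sumr.
rewrite linear_sum; apply: eq_bigr => k _ /=.
rewrite map_mxZ -scalemxAr mxtraceZ trace_so_dual ?generic_index ?mul_mpolyC //.
exact: generic_skew.
Qed.

(** An entry of a skew matrix is its trace against [so_dual], and under the trace form the adjoint
    action moves to the other argument ([trace_commutator]). *)
Lemma ad_deriv_generic (a : so) : map_mx (ad_deriv a) (generic_mx K N) =
  generic_mx K N *m map_mx (mpolyC so_dim (R := K)) a
  - map_mx (mpolyC so_dim (R := K)) a *m generic_mx K N.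
Proof.
set a' := map_mx _ (so_mx a); pose G := generic_mx K N.
have a's : a'^T = - a' by rewrite /a' map_trmx so_tr map_mxN.
have Gs : G^T = - G := generic_tr.
have brs : (G *m a' - a' *m G)^T = - (G *m a' - a' *m G).
  exact: (@commutator_tr _ _ G Gs a' a's).
have skew i j : (G *m a' - a' *m G) j i = - (G *m a' - a' *m G) i j.
  by have := congr1 (fun Y : 'M_N => Y i j) brs; rewrite [LHS]mxE [RHS]mxE.
apply/matrixP => i j; rewrite [LHS]mxE.
apply: (skew_ext (f := fun i j => ad_deriv a (G i j)) (g := G *m a' - a' *m G)) => //.
  move=> i' j'; rewrite [G j' i']generic_skew; apply/eqP.
  by rewrite -addr_eq0 /ad_deriv -dirderivD addNr dirderiv0.
move=> k; rewrite generic_index /ad_deriv dirderivX lin_form_trace.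
rewrite -(trace_so_dual _ _ skew) -[so_dual _ _ _]/(so_basis k) -/G.
rewrite -[so_mx _]/(so_mx a *m so_mx (so_basis k) - so_mx (so_basis k) *m so_mx a).
by rewrite map_mxB !map_mxM -/a' trace_commutator.
Qed.

Lemma gamma_ad (a : so) (x y : V) :
  gamma m (act a x) y + gamma m x (act a y) = ad_deriv a (gamma m x y).
Proof.
have dadd p q : ad_deriv a (p + q) = ad_deriv a p + ad_deriv a q := dirderivD _ p q.
have dmul p q : ad_deriv a (p * q) = ad_deriv a p * q + p * ad_deriv a q := dirderivM _ p q.
have dC c : ad_deriv a c%:MP = 0 := dirderivC _ c.
rewrite !gammaE -(coef_coefwise dadd) -coefD; apply: gamma_eq.
rewrite (bar_gamma_deriv dadd dmul dC pi_trunc) raddfD /= !pi_gamma_series.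
have act_bar (z : V) :
    bar (map_mx cst (act a z)) = bar (map_mx cst (so_mx a)) *m bar (map_mx cst z).
  by rewrite !map_cst /so_act !map_mxM.
rewrite !act_bar; apply: (resolvent_equivariant barR).
  by rewrite !map_trmx so_tr !map_cst !map_mxN.
by rewrite ad_deriv_generic !map_mxB !map_mxM -!map_cst.
Qed.
End GammaPairing.

Section Weights.
Context {K : numFieldType} {n : nat}.
Local Notation S := (mpoly n K).
Local Notation P := {poly S}.
Implicit Types (p q : P).

(* homogeneity for the grading in which tau has degree -1 *)
Definition weighted c p := forall i, p`_i \is (i + c).-homog.

Lemma weightedD c p q : weighted c p -> weighted c q -> weighted c (p + q).
Proof. by move=> hp hq i; rewrite coefD dhomogD. Qed.
Lemma weighted0 c : weighted c 0.
Proof. by move=> i; rewrite coef0 dhomog0. Qed.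
Lemma weightedM c c' p q : weighted c p -> weighted c' q -> weighted (c + c') (p * q).
Proof.
move=> hp hq i; rewrite coefM; apply: rpred_sum => j _.
have := dhomogM (hp j) (hq (i - j)%N); congr (_ \is _.-homog).
by rewrite addnACA subnKC // -ltnS.
Qed.
Lemma weighted_sum c J (r : seq J) (F : J -> P) :
  (forall j, weighted c (F j)) -> weighted c (\sum_(j <- r) F j).
Proof.
by move=> hF; elim/big_ind: _ => //; [exact: weighted0 | exact: weightedD].
Qed.
Lemma weightedC c (p : S) : p \is c.-homog -> weighted c p%:P.
Proof. by move=> hp [|i]; rewrite coefC //= dhomog0. Qed.
Lemma weighted1 : weighted 0 1.
Proof. by apply: weightedC; exact: dhomog1. Qed.
Lemma weighted_prod J (r : seq J) (F : J -> P) :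
  (forall j, weighted 0 (F j)) -> weighted 0 (\prod_(j <- r) F j).
Proof.
by move=> hF; elim/big_ind: _ => [|p q hp hq|//]; [exact: weighted1 | exact: (weightedM hp hq)].
Qed.
Lemma weightedN c p : weighted c p -> weighted c (- p).
Proof. by move=> hp i; rewrite coefN dhomogN. Qed.
Lemma weightedXn c k p : weighted (k + c) p -> weighted c ('X^k * p).
Proof.
move=> hp i; rewrite coefXnM; case: ltnP => [_|ki]; first exact: dhomog0.
by have := hp (i - k)%N; rewrite addnA subnK.
Qed.
Lemma weighted_exp k p : weighted 0 p -> weighted 0 (p ^+ k).
Proof.
move=> hp; elim: k => [|k IH]; first by rewrite expr0; exact: weighted1.
by rewrite exprS; exact: (weightedM hp IH).
Qed.

Definition weighted_mx c a b (Y : 'M[P]_(a, b)) := forall i j, weighted c (Y i j).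

Lemma weighted_mulmx c c' a b e (Y : 'M[P]_(a, b)) (Z : 'M[P]_(b, e)) :
  weighted_mx c Y -> weighted_mx c' Z -> weighted_mx (c + c') (Y *m Z).
Proof. by move=> hY hZ i j; rewrite mxE; apply: weighted_sum => l; exact: weightedM. Qed.

Lemma weighted_mx1 a : weighted_mx 0 (1%:M : 'M[P]_a).
Proof.
move=> i j; rewrite mxE; case: (i == j); first exact: weighted1.
exact: weighted0.
Qed.

Lemma weighted_det a (Y : 'M[P]_a) : weighted_mx 0 Y -> weighted 0 (\det Y).
Proof.
move=> hY; apply: weighted_sum => s; apply: (@weightedM 0 0).
  by apply: weighted_exp; apply: weightedN; exact: weighted1.
by apply: weighted_prod => i; exact: hY.
Qed.
End Weights.

Section GammaHomogeneous.
Context {K : numFieldType} {N : nat}.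
Variable m : nat.
Local Notation so_dim := #|{: so_coord N}|.
Local Notation so_poly := (mpoly so_dim K).
Local Notation P := {poly so_poly}.
Local Notation cst := (@const_poly K N).
Local Notation A := (map_mx polyC (generic_mx K N) : 'M[P]_N).
Local Notation T := ('X ^+ 2 *: (A *m A) : 'M[P]_N).
Local Notation V := 'cV[K]_N.

Lemma generic_weighted : weighted_mx 1 A.
Proof.
have coord1 i j : coord_fun K i j \is 1.-homog.
  rewrite /coord_fun; case: insubP => [k _ _|_]; last exact: dhomog0.
  by rewrite dhomogX /= mdeg1.
by move=> i j; rewrite !mxE; apply: weightedC; apply: rpredB; exact: coord1.
Qed.

Lemma generic_sqr_weighted : weighted_mx 0 T.
Proof.
move=> i j; rewrite mxE; apply: weightedXn.
exact: (weighted_mulmx generic_weighted generic_weighted).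
Qed.

Lemma cst_weighted c : weighted 0 (cst c).
Proof. by apply/weightedC; rewrite -[c%:MP]mulr1 mul_mpolyC dhomogZ ?dhomog1. Qed.

(** Each tau^2 comes with two factors A, which makes both series homogeneous of weight 0; the single
    remaining A contributes the 1. *)
Lemma gamma_homog (x y : V) : gamma m x y \is m.*2.+1.-homog.
Proof.
have hT := generic_sqr_weighted.
have hR : weighted_mx 0 (resolvent_series K N m).
  move=> i j; rewrite summxE; apply: weighted_sum => k; rewrite mxE.
  apply: (weightedM (cst_weighted _)); move: (k : nat) i j => l {k}.
  elim: l => [|l IH]; first by rewrite expr0; exact: weighted_mx1.
  by rewrite exprS -mulmxE; exact: (weighted_mulmx hT IH).
have hdet : weighted 0 (det_series K N m).
  apply: weighted_sum => k; apply: (weightedM (cst_weighted _)); apply: weighted_exp.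
  apply: weightedD; last by apply: weightedN; exact: weighted1.
  by apply: weighted_det => i j; rewrite mxE; apply: weightedD; [exact: weighted_mx1|exact: hT].
have hcst (z : V) : weighted_mx 0 (map_mx cst z) by move=> i j; rewrite mxE; exact: cst_weighted.
have hcstT (z : V) : weighted_mx 0 (map_mx cst z)^T.
  by move=> i j; rewrite !mxE; exact: cst_weighted.
have hbil : weighted 1 (bil (A *m resolvent_series K N m) (map_mx cst x) (map_mx cst y)).
  have := weighted_mulmx generic_weighted hR => /(weighted_mulmx (hcstT x)) h.
  exact: (weighted_mulmx h (hcst y)).
by have := weightedM hbil hdet (2 * m)%N; rewrite {2}mul2n addn0 addn1.
Qed.
End GammaHomogeneous.

(** * The value of gamma at the bivector of two basis vectors *)

Section GammaNonvanishing.
Context {K : numFieldType}.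
Variable m : nat.

(* Here h is y^(-1) up to terms of order tau^(2m+2), because
   (y h)' = 2 c s^m y' with s = y^2 - 1 divisible by tau^2. *)
Lemma det_series_square (y : {poly K}) : y = 1 - 'X^2 ->
  let h := \sum_(n < m.+1) (gen_binom (- 2^-1) n)%:P * (y ^+ 2 - 1) ^+ n in
  forall j, (j <= m)%N -> h`_(2 * j) = 1.
Proof.
move=> yE h; pose s := y ^+ 2 - 1.
have y0 : y != 0.
  apply: contra_neq (oner_neq0 K) => y0; have := congr1 (fun q : {poly K} => q`_0) yE.
  by rewrite y0 coefB coef1 coefXn coef0 subr0.
have sE : s = ('X^2 - 2) * 'X^2 by rewrite /s yE; ring.
pose c := ((m%:R + 2^-1) * gen_binom (- 2^-1) m : K)%:P.
have hE : (y * h)^`() = c * s ^+ m * (2 * y^`()).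
  (* After multiplication by y the left side is y y' h + y^2 h'. With 1 + s = y^2 the second summand
     is given by [derivation_binom], and its main part cancels the first. *)
  apply: (mulfI y0).
  have := @derivation_binom {poly K} (@deriv K) (@derivD K) (@derivM K) K polyC m s (@derivC K).
  rewrite /= -/h -/c /s addrC subrK derivB derivC subr0 derivM => E.
  rewrite expr2 derivM in E; transitivity (y * y^`() * h + y * y * h^`()); first by ring.
  rewrite E -/s; set a := (- 2^-1)%:P.
  have aE : a * 2 = -1.
    by rewrite /a -(polyC_natr _ 2) -polyCM mulNr mulVf ?pnatr_eq0 // polyCN.
  transitivity (y * y^`() * h * (1 + a * 2) + y * (c * s ^+ m * (2 * y^`()))); first by ring.
  by rewrite aE subrr mulr0 add0r.
have y'E : y^`() = - 2 * 'X.
  by rewrite yE derivB derivC derivXn sub0r expr1 -mulr_natl mulNr.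
(* The derivative [hE] is divisible by tau^(2m+1), so y h agrees with its constant term 1 up to
   degree 2m + 1. *)
have yh0 i : (i < (2 * m).+2)%N -> (y * h)`_i = (i == 0%N)%:R.
  case: i => [_|i im].
    rewrite -horner_coef0 hornerM yE !hornerE horner_sum big_ord_recl big1 => [|k _].
      rewrite !hornerE /gen_binom big_ord0 fact0.
      by rewrite /= expr0n subr0 !mul1r invr1 mulr1.
    rewrite hornerM horner_exp -[y ^+ 2 - 1]/s sE hornerM hornerXn expr0n /= mulr0.
    by rewrite expr0n mulr0.
  have : (y * h)^`()`_i = 0.
    rewrite hE y'E sE exprMn -exprM.
    have -> : c * (('X^2 - 2) ^+ m * 'X^(2 * m)) * (2 * (- 2 * 'X)) =
        c * ('X^2 - 2) ^+ m * (- 4) * 'X^((2 * m).+1) 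
      by rewrite ['X^((2 * m).+1)]exprSr; move: ('X^(2 * m)) (_ ^+ m) => a b; ring.
    by rewrite coefMXn (_ : (i < (2 * m).+1)%N).
  by rewrite coef_deriv => /eqP; rewrite mulrn_eq0 /= => /eqP.
elim=> [_|j IH jm].
  by have := yh0 0%N isT; rewrite yE mulrBl mul1r coefB coefXnM subr0.
have jm2 : ((2 * j.+1) < (2 * m).+2)%N by lia.
have := yh0 _ jm2; rewrite yE mulrBl mul1r coefB coefXnM mulnS /= addKn.
rewrite IH ?(ltnW jm) // => /eqP; rewrite subr_eq0 => /eqP.
exact.
Qed.

Variables (N : nat) (i0 i1 : 'I_N).
Hypothesis i01 : i0 != i1.
Local Notation so_dim := #|{: so_coord N}|.
Local Notation so_poly := (mpoly so_dim K).
Local Notation P := {poly so_poly}.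
Local Notation cst := (@const_poly K N).
Local Notation A := (map_mx polyC (generic_mx K N) : 'M[P]_N).
Local Notation T := ('X ^+ 2 *: (A *m A) : 'M[P]_N).
Local Notation u := (bas i0 : 'cV[K]_N).
Local Notation v := (bas i1 : 'cV[K]_N).
Local Notation W := (map_mx polyC (wedge u v) : 'M[{poly K}]_N).

Let H : {rmorphism P -> {poly K}} := map_poly (meval (wdir u v)).

Lemma eval_coef p i : (H p)`_i = wev u v p`_i.
Proof. exact: coef_map. Qed.

Lemma eval_cst c : H (cst c) = c%:P.
Proof. by rewrite /H /const_poly /= map_polyC /= mevalC. Qed.

Lemma eval_generic : map_mx H A = W.
Proof.
apply/matrixP => i j; rewrite [LHS]mxE [in LHS]mxE [RHS]mxE /H /= map_polyC /=.
by congr polyC; apply/meval_generic/wedge_skew.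
Qed.

Lemma eval_T : map_mx H T = 'X^2 *: (W *m W).
Proof. by rewrite map_mxZ map_mxM eval_generic /H /= map_polyXn. Qed.

Lemma wedge_bas1 : wedge u v *m v = u.
Proof.
by rewrite wedge_act !dot_bas eqxx (negPf i01) scale1r scale0r subr0.
Qed.

Lemma wedge_bas0 : wedge u v *m u = - v.
Proof.
by rewrite wedge_act !dot_bas eqxx eq_sym (negPf i01) scale1r scale0r sub0r.
Qed.

(** The square of [wedge u v] sends v to - v, so T acts on v as - tau^2 and the signs of the
    resolvent series cancel. *)
Lemma eval_resolvent :
  map_mx H (resolvent_series K N m) *m map_mx polyC v
  = (\sum_(n < m.+1) 'X^(2 * n)) *: map_mx polyC v.
Proof.
have Tv n : (map_mx H T) ^+ n *m map_mx polyC v = (- 'X^2) ^+ n *: map_mx polyC v.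
  elim: n => [|n IH]; first by rewrite !expr0 mul1mx scale1r.
  rewrite exprS -mulmxE -mulmxA IH -scalemxAr eval_T -scalemxAl -mulmxA -!map_mxM.
  by rewrite wedge_bas1 wedge_bas0 map_mxN ['X^2 *: - _]scalerN -scaleNr scalerA -exprSr.
have HX (Y : 'M[P]_N) n : map_mx H (Y ^+ n) = (map_mx H Y) ^+ n.
  elim: n => [|n IH]; first by rewrite !expr0 map_mx1.
  by rewrite !exprS -!mulmxE map_mxM IH.
rewrite /resolvent_series map_mx_sum mulmx_suml scaler_suml; apply: eq_bigr => n _.
rewrite map_mxZ -scalemxAl HX Tv scalerA eval_cst gen_binomN1; congr (_ *: _).
by rewrite rmorphXn rmorphN rmorph1 -exprMn mulN1r opprK -exprM.
Qed.

(** The square of [wedge u v] is minus the projection onto the span of u and v, so the matrix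
    becomes diagonal with two entries 1 - tau^2. *)
Lemma eval_det : H (\det (1%:M + T)) = (1 - 'X^2) ^+ 2.
Proof.
have -> : H (\det (1%:M + T)) = \det (diag_mx (\row_j
    (if (j == i0) || (j == i1) then 1 - 'X^2 else 1) : 'rV[{poly K}]_N)).
  rewrite -det_map_mx map_mxD map_mx1 eval_T -map_mxM; congr (\det _).
  apply/matrixP => i j.
  have -> : wedge u v *m wedge u v = - (u *m u^T + v *m v^T).
    rewrite {2}/wedge mulmxBr !mulmxA wedge_bas0 wedge_bas1 mulNmx opprD.
    by rewrite addrC.
  rewrite !mxE !big_ord1 !mxE !andbT.
  have p0 (l : 'I_N) : (i == l)%:R * (j == l)%:R = ((i == l) && (i == j))%:R :> K.
    by rewrite -natrM mulnb; congr (nat_of_bool _)%:R; case: eqVneq => // <-; rewrite eq_sym.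
  rewrite !p0; case: (i == j); rewrite ?andbT ?andbF /=; last first.
    by rewrite addr0 oppr0 polyC0 mulr0 addr0.
  case: eqVneq => [->|_]; first by rewrite (negPf i01) addr0 polyCN mulrN mulr1.
  case: eqVneq => _ /=; first by rewrite add0r polyCN mulrN mulr1.
  by rewrite addr0 oppr0 polyC0 mulr0 addr0.
rewrite det_diag (bigD1 i0) //= (bigD1 i1) /=; last by rewrite eq_sym.
rewrite !mxE !eqxx orbT big1 ?mulr1 // => j /andP[/negPf j0 /negPf j1].
by rewrite mxE j0 j1.
Qed.

(** Up to truncation both the bilinear factor and the determinant factor equal 1/(1 - tau^2) here,
    and tau^(2m) has coefficient m + 1 in the square of that series. *)
Lemma gamma_wdiag : wdiag (gamma m : 'cV[K]_N -> 'cV[K]_N -> so_poly) u v = m.+1%:R.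
Proof.
rewrite /wdiag gammaE -eval_coef rmorphM.
have -> : H (bil (A *m resolvent_series K N m) (map_mx cst u) (map_mx cst v)) =
    \sum_(n < m.+1) 'X^(2 * n).
  transitivity (map_mx H ((map_mx cst u)^T *m (A *m resolvent_series K N m) *m map_mx cst v) 0 0).
    by rewrite [RHS]mxE.
  have Hc (z : 'cV[K]_N) : map_mx H (map_mx cst z) = map_mx polyC z.
    by apply/matrixP => i j; rewrite !mxE eval_cst.
  rewrite !map_mxM -map_trmx !Hc eval_generic -!mulmxA eval_resolvent -!scalemxAr -map_mxM.
  rewrite wedge_bas1 map_trmx -map_mxM.
  have uu : (u^T *m u) 0 0 = 1.
    have <- : dot u u = 1 by rewrite dot_bas eqxx.
    by rewrite mxE; apply: eq_bigr => i _; rewrite mxE.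
  by rewrite mxE mxE uu rmorph1 mulr1.
have -> : H (det_series K N m) =
    \sum_(n < m.+1) (gen_binom (- 2^-1) n)%:P * ((1 - 'X^2) ^+ 2 - 1) ^+ n.
  rewrite /det_series rmorph_sum; apply: eq_bigr => n _.
  by rewrite rmorphM rmorphXn rmorphB eval_det eval_cst [H 1]rmorph1.
rewrite mulr_suml coef_sum.
rewrite (eq_bigr (fun=> 1)) => [|n _]; first by rewrite sumr_const card_ord.
rewrite coefXnM ltnNge leq_mul2l -ltnS ltn_ord /= -mulnBr.
exact: (det_series_square (erefl (1 - 'X^2 : {poly K})) (leq_subr n m)).
Qed.
End GammaNonvanishing.

(** * Assembling the classification of PBW deformations *)

Section Classification.
Context {K : numFieldType} {N : nat}.
Local Notation so_dim := #|{: so_coord N}|.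
Local Notation so_poly := (mpoly so_dim K).
Local Notation V := 'cV[K]_N.
Local Notation act := (@so_act K N).
Local Notation gam j := (@gamma K N j : V -> V -> so_poly).

Section Truncation.
Variable j : nat.
Local Notation P := {poly so_poly}.
Local Notation pi := (in_qpoly ('X^((2 * j).+2) : P)).

Let pi_trunc : pi 'X^((2 * j).+2) = 0.
Proof. by apply/in_qpolyXn_eq0; exists 1; rewrite mul1r. Qed.

Let pi_coef (p : P) : pi p = 0 -> p`_(2 * j) = 0.
Proof. by move=> /in_qpolyXn_eq0[q ->]; rewrite coefMXn ltnS leqnSn. Qed.

Lemma gamma_pairing : so_pairing (gam j).
Proof.
split; [exact: gamma_linl | exact: gamma_linr | exact: (gamma_alt pi_trunc pi_coef) |].
exact: (gamma_ad pi_trunc pi_coef).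
Qed.

Lemma gamma_closed : plucker_closed (gam j).
Proof. exact: (gamma_plucker pi_trunc pi_coef). Qed.
End Truncation.

Theorem so_PBW (kappa : V -> V -> uea (@so_br K N)) : (2 < N)%N ->
  alternating kappa -> equivariant act kappa ->
  PBW act kappa <-> exists m (z : 'I_m.+1 -> K), forall x y : V,
    kappa x y = \sum_(j < m.+1) (z j)%:S * so_r j x y.
Proof.
move=> N3 kappa_alt kappa_equiv.
have [k [kE kp PBWk]] := so_PBW_poly kappa_alt kappa_equiv.
pose i0 : 'I_N := Ordinal (ltn_trans (isT : 0 < 2)%N N3).
pose i1 : 'I_N := Ordinal (ltn_trans (isT : 1 < 2)%N N3).
have i01 : i0 != i1 by [].
have gamma0 j : wdiag (gam j) (bas i0) (bas i1) != 0.
  by rewrite gamma_wdiag // pnatr_eq0.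
apply: (iff_trans PBWk); apply: (iff_trans (plucker_closedP k)).
apply: (iff_trans (classification N3 i01 gamma_pairing gamma_closed (@gamma_homog K N) gamma0 kp)).
have sumE m (z : 'I_m.+1 -> K) x y : \sum_(j < m.+1) (z j)%:S * so_r j x y =
    symm (fun k => uea_in (@so_br K N) (so_basis k)) (\sum_(j < m.+1) z j *: gam j x y).
  rewrite symm_sum; apply: eq_bigr => j _; rewrite symmZ.
  by rewrite /so_r symmetrizationE.
split=> -[m [z E]]; exists m, z => x y; first by rewrite kE E sumE.
by apply: symm_so_inj; rewrite -sumE -kE E.
Qed.
End Classification.

Theorem theorem1p4 (R : realType) (N : nat) (hN : (3 <= N)%N)
    (kappa : 'cV[R[i]]_N -> 'cV[R[i]]_N -> uea (@so_br R[i] N))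
    (kappa_alt : alternating kappa)
    (kappa_equiv : equivariant (@so_act R[i] N) kappa) :
  PBW (@so_act R[i] N) kappa <->
  exists (k : nat) (zeta : 'I_k.+1 -> R[i]),
    forall x y : 'cV[R[i]]_N,
      kappa x y = \sum_(j < k.+1) (zeta j)%:S * so_r j x y.
Proof. exact: so_PBW. Qed.
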